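(* (1) Let $f:M\to N$ be a $(\pm)$-holomorphic horizontally weakly conformal map with dilation $\mu$ between almost contact metric manifolds $M=(M^{2m+1};\varphi,\xi,\eta,g)$ and $N=(N^{2n+1};\phi,\gamma,\sigma,h)$. (i) If $M\in\mathcal A_1\cup\mathcal A_6\cup\mathcal A_7$ and $N\in\mathcal A_1\cup\mathcal A_4\cup\mathcal A_6\cup\mathcal A_7$, then $f$ is a horizontally homothetic harmonic morphism with minimal fibres. (ii) If $M\in\mathcal A_4\cup\mathcal A_7^a$ and $N\in\mathcal A_1\cup\mathcal A_4\cup\mathcal A_6\cup\mathcal A_7^a$, then $f$ is a harmonic morphism if and only if $d\lambda(\xi)=0$. In particular: (a) if $f$ is horizontally homothetic (in particular, a horizontally conformal Riemannian submersion), then it is a harmonic morphism with minimal fibres; conversely, if $f$ is a harmonic morphism with minimal fibres, then it is horizontally homothetic. (b) If $M\in\mathcal A_4$ and $N\in\mathcal A_1\cup\mathcal A_4\cup\mathcal A_6\cup\mathcal A_7$, then $f$ is a horizontally homothetic harmonic morphism (and therefore has minimal fibres) if and only if $d\lambda(\xi)=0$. (iii) If $M\in\mathcal B_2^a$ and $N\in\mathcal B_2^a$, then $f$ is a harmonic morphism if and only if $d\lambda(\xi)=0$. In particular: (a) if $f$ is horizontally homothetic (in particular, a horizontally conformal Riemannian submersion), then it is a harmonic morphism with minimal fibres; conversely, if $f$ is a harmonic morphism with minimal fibres, then it is horizontally homothetic. (b) If $M\in\mathcal B_1\cup\mathcal B_2$ and $N\in\mathcal B_1\cup\mathcal B_2$,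 then $f$ is a horizontally homothetic harmonic morphism (and therefore has minimal fibres) if and only if $d\lambda(\xi)=0$. (iv) If $M\in\mathcal B_2^a$ and $N\in\mathcal B_3$ is almost $\beta_N$-Kenmotsu, then $f$ is a harmonic morphism if and only if $d\lambda(\xi)-2n\lambda^2\beta_N=0$. (v) If $M\in\mathcal B_3$ is almost $\beta_M$-Kenmotsu and $N\in\mathcal B_2^a$, then $f$ is a harmonic morphism if and only if $d\lambda(\xi)+2m\lambda\beta_M=0$. (vi) Let $M,N\in\mathcal B_3$ be almost $\beta_M$-Kenmotsu and almost $\beta_N$-Kenmotsu, respectively. Then: (a) $f$ is a harmonic morphism if and only if $d\lambda_p(\xi)+2\lambda_p[m\beta_M(p)-n\lambda_p\beta_N(q)]=0$ for all $p\in M$, $q=f(p)$. Suppose further that $f$ has minimal fibres; then $f$ is harmonic (so is a harmonic morphism) if and only if $f$ is horizontally homothetic with dilation given by $\mu(p)=|\lambda(p)|=\left|\frac{m\beta_M(p)}{n\beta_N(q)}\right|$, $p\in M$ (which is constant along horizontal curves). (b) Any two of the following imply the third: $f$ is a harmonic morphism; $\lambda(p)=\frac{m\beta_M(p)}{n\beta_N(q)}$ for all $p\in M$, $q=f(p)$; $d\lambda_p(\xi)=0$ for all $p\in M$. (c) Suppose $\beta_M$ and $\beta_N$ are both constant functions. Then the following are equivalent: $f$ is a harmonic morphism with minimal fibres; $f$ is horizontally homothetic with dilation $\mu=|\lambda|=\left|\frac{m\beta_M}{n\beta_N}\right|$. (2) Let $f:M\to(H_1^{2n};J_1,G_1)$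 be a $(\pm)$-holomorphic horizontally weakly conformal map into an almost Hermitian manifold, where $M\in\mathcal A_1\cup\mathcal A_2\cup\mathcal A_3\cup\mathcal A_4\cup\mathcal A_6\cup\mathcal A_7^a\cup\mathcal B_2^a\cup\mathcal B_3\cup\mathcal C_2$. Then $f$ is a harmonic morphism if and only if $H_1^{2n}$ is semi-Kähler.
   Context: Manifolds and maps are smooth; $\nabla$ denotes Levi-Civita connections. An almost contact metric manifold $M=(M^{2m+1};\varphi,\xi,\eta,g)$ is a $(2m+1)$-dimensional Riemannian manifold with a $(1,1)$-tensor $\varphi$, a vector field $\xi$ and a 1-form $\eta$ such that $\varphi^2X=-X+\eta(X)\xi$, $\eta(\xi)=1$, $g(\varphi X,\varphi Y)=g(X,Y)-\eta(X)\eta(Y)$. Put $\Omega(X,Y)=g(X,\varphi Y)$, $P(X,Y)=(\nabla_X\varphi)Y+(\nabla_{\varphi X}\varphi)\varphi Y$, $Q(X,Y)=(\nabla_X\varphi)Y+(\nabla_Y\varphi)X$, $W_X=\nabla_XX+\nabla_{\varphi X}(\varphi X)$, $2\mathfrak h=\mathcal L_\xi\varphi$. Conventions: $2d\eta(X,Y)=X\eta(Y)-Y\eta(X)-\eta([X,Y])$; $d\Omega(X,Y,Z)$ is the cyclic sum of $(\nabla_X\Omega)(Y,Z)$ and $(\eta\wedge\Omega)(X,Y,Z)$ the cyclic sum of $\eta(X)\Omega(Y,Z)$; $\{e_i;\varphi e_i;\xi\}_{1\le i\le m}$ is any local orthonormal frame; $\delta\eta=\eta(\sum_iW_{e_i})=-\operatorname{div}\xi$;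 $\delta\Omega(X)=g(-\varphi(\nabla_\xi\xi)+\sum_iP(e_i,e_i),X)$. $M$ is normal if $[\varphi,\varphi]+2d\eta\otimes\xi=0$, where $[\varphi,\varphi](X,Y)=\varphi^2[X,Y]+[\varphi X,\varphi Y]-\varphi[\varphi X,Y]-\varphi[X,\varphi Y]$. Classes. $\mathcal A_1$: $\alpha$-contact metric manifolds ($d\eta=\alpha\Omega$, $\alpha\neq0$ a real constant); quasi-contact metric manifolds ($P(X,Y)=2g(X,Y)\xi-\eta(Y)\{X+\eta(X)\xi+\mathfrak hX\}$); quasi-$\mathcal K$-Sasakian manifolds ($P(X,Y)=2g(X,Y)\xi-2\eta(Y)X+\eta(Y)\nabla_{\varphi X}\xi$); strongly pseudoconvex CR-manifolds ($d\eta=\Omega$ and $(\nabla_X\varphi)Y=g(X+\mathfrak hX,Y)\xi-\eta(Y)(X+\mathfrak hX)$); $\alpha$-Sasakian manifolds ($d\eta=\alpha\Omega$, $\alpha\neq0$ constant, and normal). $\mathcal A_2$: nearly trans-Sasakian manifolds of type $(\wp,\theta)$: $Q(X,Y)=\wp\{2g(X,Y)\xi-\eta(X)Y-\eta(Y)X\}-\theta\{\eta(X)\varphi Y+\eta(Y)\varphi X\}$ with nowhere vanishing functions $\wp,\theta$. $\mathcal A_3$: trans-Sasakian manifolds of type $(\wp,\theta)$: normal with $(\nabla_X\varphi)Y=\wp\{g(X,Y)\xi-\eta(Y)X\}+\theta\{g(\varphi X,Y)\xi-\eta(Y)\varphi X\}$, where $2m\wp=\delta\Omega(\xi)$, $2m\theta=-\delta\eta$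 and $\wp,\theta$ vanish nowhere. $\mathcal A_4$: quasi-Sasakian manifolds (normal, $d\Omega=0$, and $\eta\wedge(d\eta)^r\neq0$, $(d\eta)^{r+1}=0$ for some $1\le r\le m-1$). $\mathcal A_6$: nearly $\alpha$-Sasakian manifolds ($Q(X,Y)=\alpha\{2g(X,Y)\xi-\eta(Y)X-\eta(X)Y\}$, $\alpha\ne0$ constant). $\mathcal A_7^a$: almost semi-Sasakian manifolds ($\delta\Omega=2m\eta$); $\mathcal A_7$: semi-Sasakian manifolds (almost semi-Sasakian and normal). $\mathcal B_1$: cosymplectic ($d\eta=0$, $d\Omega=0$, normal), almost cosymplectic ($d\eta=0$, $d\Omega=0$), nearly cosymplectic ($(\nabla_X\varphi)X=0$), nearly-$\mathcal K$-cosymplectic ($(\nabla_X\varphi)X=0$ and $(\nabla_X\varphi)\xi=0$), quasi-$\mathcal K$-cosymplectic ($P(X,Y)=\eta(Y)\nabla_{\varphi X}\xi$) manifolds. $\mathcal B_2^a$: almost semi-cosymplectic manifolds ($\delta\eta=0$ and $\delta\Omega=0$); $\mathcal B_2$: semi-cosymplectic manifolds (almost semi-cosymplectic and normal). $\mathcal B_3$: almost $\beta$-Kenmotsu manifolds ($d\Omega=2\beta\,\eta\wedge\Omega$, $d\eta=0$, $d\beta\wedge\eta=0$ for a nowhere vanishing smooth function $\beta$), including the $\beta$-Kenmotsu (normal) and the CR-integrable ($(\nabla_X\varphi)Y=g(\mathfrak hX,Y)\xi-\eta(Y)\mathfrak hX+\beta\{g(\varphi X,Y)\xi-\eta(Y)\varphi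 X\}$) ones. $\mathcal C_2$: semi-Kähler manifolds: almost Hermitian $(H;J,G)$ with $\sum_iS^H(Je_i,e_i)=0$ for local orthonormal frames $\{e_i;Je_i\}$, where $S^H(X,Y)=(\nabla_XJ)Y-(\nabla_YJ)X$. For $N=(N^{2n+1};\phi,\gamma,\sigma,h)$ the same notions are used with $(\phi,\gamma,\sigma,h,n)$; functions on $N$ are evaluated along $f$. $f$ is $(\pm)$-holomorphic if $f_*$ intertwines the structure tensors ($\varphi$ or $J$ on the domain, $\phi$ or $J_1$ on the target) up to one fixed sign $\pm$. In (1), $\lambda\in C^\infty(M)$ is the function with $f_*\xi=\lambda\gamma$ (it exists for $(\pm)$-holomorphic $f$). $f$ is horizontally weakly conformal with dilation $\mu\ge0$ if $h(f_*X,f_*Y)=\mu(p)^2g(X,Y)$ for all $p$ and $X,Y\in\mathcal H_p=(\ker f_{*p})^\perp$ ($g$, $h$ the domain and target metrics), and $f_{*p}:\mathcal H_p\to T_{f(p)}N$ is surjective where $\mu(p)>0$; horizontally conformal if moreover $\mu>0$ everywhere; horizontally homothetic if $d\mu(X)=0$ for all horizontal $X$. $f$ is harmonic if its tension field vanishes; a harmonic morphism is a harmonic horizontally weakly conformal map.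
   Formalization: In (1)(vi), all after the first sentence of (a) assumes f non-constant on each connected component; in (2), ''only if'' is proved for surjective f, or at points of f(M) for f non-constant on each component (constant maps are counterexamples); m, n ≥ 1 throughout. *)

(* Defs.v *)
From HB Require Import structures.
From mathcomp Require Import all_boot all_order all_algebra all_fingroup.
From mathcomp Require Import all_classical all_reals all_analysis.

Set Implicit Arguments.
Unset Strict Implicit.
Unset Printing Implicit Defensive.

Import Order.TTheory GRing.Theory Num.Theory.
Import numFieldNormedType.Exports.

Local Open Scope classical_set_scope.
Local Open Scope ring_scope.

Fixpoint iterD (R : realType) (d : nat) (W : normedModType R)
    (vs : seq 'rV[R]_d) (F : 'rV[R]_d -> W) : 'rV[R]_d -> W :=
  if vs is v :: vs' then fun x => 'D_v (iterD vs' F) x else F.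

(* C^infinity on an open set U: all iterated directional derivatives exist and
   are continuous on U.  Only used for open U. *)
Definition smooth_on (R : realType) (d : nat) (W : normedModType R)
    (U : set 'rV[R]_d) (F : 'rV[R]_d -> W) : Prop :=
  forall (vs : seq 'rV[R]_d) (x : 'rV[R]_d), U x ->
    {for x, continuous (iterD vs F)} /\
    forall v : 'rV[R]_d, derivable (iterD vs F) x v.

(* A locally Euclidean space with a preferred chart [chart p] around every
   point p (defined on [cdom p], with inverse [ichart p]); the charts [chart p]
   form the atlas.  Outside their domains [chart p] and [ichart p] are
   irrelevant. *)
Record charted (R : realType) (d : nat) := Charted {
  points :> topologicalType;
  cdom : points -> set points;
  chart : points -> points -> 'rV[R]_d;
  ichart : points -> 'rV[R]_d -> points;
  cdom_open : forall p, open (cdom p);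
  cdom_refl : forall p, cdom p p;
  chart_open : forall p, open (chart p @` cdom p);
  chartK : forall p q, cdom p q -> ichart p (chart p q) = q;
  chart_continuous : forall p q, cdom p q -> {for q, continuous (chart p)};
  ichart_continuous : forall p x, (chart p @` cdom p) x ->
    {for x, continuous (ichart p)}
}.

(* only used for open U *)
Definition smoothM (R : realType) (d : nat) (M : charted R d)
    (W : normedModType R) (U : set M) (F : M -> W) : Prop :=
  forall p : M, smooth_on (chart p @` (U `&` cdom p)) (F \o ichart p).

Record manifold (R : realType) (d : nat) := Manifold {
  charted_of :> charted R d;
  manifold_hausdorff : hausdorff_space charted_of;
  manifold_second_countable : @second_countable charted_of;
  manifold_smooth : forall p : charted_of, smoothM (cdom p) (chart p)
}.

Definition smooth_fun (R : realType) (d : nat) (M : manifold R d)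
    (F : M -> R) : Prop := smoothM setT F.

(* A tangent vector at p is represented by the row of its components in the
   preferred chart [chart p]; so every tangent space is 'rV[R]_d, but the rows
   representing vectors at different points refer to different charts. *)

(* the derivative dF_p(v); it only depends on F near p *)
Definition dfun (R : realType) (d : nat) (M : manifold R d)
    (W : normedModType R) (F : M -> W) (p : M) (v : 'rV[R]_d) : W :=
  'D_v (F \o ichart p) (chart p p).

Definition vfield (R : realType) (d : nat) (M : manifold R d) := M -> 'rV[R]_d.

(* components of the vector field X in the fixed chart [chart p], at points q
   of [cdom p] *)
Definition coord_field (R : realType) (d : nat) (M : manifold R d) (p : M)
    (X : vfield M) : M -> 'rV[R]_d :=
  fun q => dfun (chart p) q (X q).

(* the local vector field on [cdom p] whose components in [chart p] are
   constantly v; it extends the tangent vector v at p *)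
Definition cst_ext (R : realType) (d : nat) (M : manifold R d) (p : M)
    (v : 'rV[R]_d) : vfield M :=
  fun q => 'D_v (chart q \o ichart p) (chart p q).

Definition smooth_field (R : realType) (d : nat) (M : manifold R d)
    (U : set M) (X : vfield M) : Prop :=
  forall p : M, smoothM (U `&` cdom p) (coord_field p X).

Definition bracket (R : realType) (d : nat) (M : manifold R d)
    (X Y : vfield M) : vfield M :=
  fun p => dfun (coord_field p Y) p (X p) - dfun (coord_field p X) p (Y p).

(* A (1,1)-tensor A sends the tangent vector v at p to [v *m A p]. *)
Definition app_endo (R : realType) (d : nat) (M : manifold R d)
    (A : M -> 'M[R]_d) (X : vfield M) : vfield M :=
  fun q => X q *m A q.

Definition smooth_endo (R : realType) (d : nat) (M : manifold R d)
    (A : M -> 'M[R]_d) : Prop :=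
  forall (p : M) (v : 'rV[R]_d), smooth_field (cdom p) (app_endo A (cst_ext p v)).

Definition smooth_map (R : realType) (a b : nat) (M : manifold R a)
    (N : manifold R b) (f : M -> N) : Prop :=
  continuous f /\
  forall q : N, smoothM (f @^-1` cdom q) (chart q \o f).

(* f_* at p, in the preferred charts at p and at f p *)
Definition dmap (R : realType) (a b : nat) (M : manifold R a)
    (N : manifold R b) (f : M -> N) (p : M) (v : 'rV[R]_a) : 'rV[R]_b :=
  dfun (chart (f p) \o f) p v.

Definition bil (R : realType) (d : nat) (A : 'M[R]_d) (v w : 'rV[R]_d) : R :=
  (v *m A *m w^T) 0 0.

Record riemannian (R : realType) (d : nat) := Riemannian {
  manifold_of :> manifold R d;
  met : manifold_of -> 'M[R]_d;
  met_sym : forall p, (met p)^T = met p;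
  met_pos : forall p v, v != 0 -> 0 < bil (met p) v v;
  met_smooth : forall (p : manifold_of) (v w : 'rV[R]_d),
    smoothM (cdom p) (fun q => bil (met q) (cst_ext p v q) (cst_ext p w q))
}.

Definition gmet (R : realType) (d : nat) (M : riemannian R d) (p : M)
    (v w : 'rV[R]_d) : R := bil (met p) v w.

(* Christoffel symbols at p of [chart p], as a bilinear map: the vector K with
   2 g(K, e_l) = v g(w, e_l) + w g(v, e_l) - e_l g(v, w), all vectors being
   extended with constant components. *)
Definition christoffel (R : realType) (d : nat) (M : riemannian R d) (p : M)
    (v w : 'rV[R]_d) : 'rV[R]_d :=
  let e (l : 'I_d) : 'rV[R]_d := delta_mx 0 l in
  let dg (u x y : 'rV[R]_d) : R :=
    dfun (fun q => gmet q (cst_ext p x q) (cst_ext p y q)) p u in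
  (\row_l (2^-1 * (dg v w (e l) + dg w v (e l) - dg (e l) v w)))
    *m invmx (met p).

(* Levi-Civita connection: nabla_v Y at p *)
Definition nabla (R : realType) (d : nat) (M : riemannian R d) (p : M)
    (v : 'rV[R]_d) (Y : vfield M) : 'rV[R]_d :=
  dfun (coord_field p Y) p v + christoffel p v (Y p).

(* covariant derivative (nabla_v A) w at p of a (1,1)-tensor *)
Definition nabla_endo (R : realType) (d : nat) (M : riemannian R d)
    (A : M -> 'M[R]_d) (p : M) (v w : 'rV[R]_d) : 'rV[R]_d :=
  nabla p v (app_endo A (cst_ext p w)) - nabla p v (cst_ext p w) *m A p.

Definition divergence (R : realType) (d : nat) (M : riemannian R d)
    (X : vfield M) (p : M) : R :=
  \sum_(i < d) (nabla p (delta_mx 0 i) X) 0 i.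

(* Connection of the pullback bundle f^*TN: nabla^f_v s at p, for a section s
   along f, i.e. s q is tangent to N at f q. *)
Definition nabla_pull (R : realType) (a b : nat) (M : riemannian R a)
    (N : riemannian R b) (f : M -> N) (p : M) (v : 'rV[R]_a)
    (s : M -> 'rV[R]_b) : 'rV[R]_b :=
  dfun (fun q : M => dfun (chart (f p)) (f q) (s q)) p v
  + christoffel (f p) (dmap f p v) (s p).

Definition second_fund_form (R : realType) (a b : nat) (M : riemannian R a)
    (N : riemannian R b) (f : M -> N) (p : M) (v w : 'rV[R]_a) : 'rV[R]_b :=
  nabla_pull f p v (fun q => dmap f q (cst_ext p w q))
  - dmap f p (nabla p v (cst_ext p w)).

Definition tension (R : realType) (a b : nat) (M : riemannian R a)
    (N : riemannian R b) (f : M -> N) (p : M) : 'rV[R]_b :=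
  \sum_(i < a) \sum_(j < a)
    (invmx (met p)) i j *:
      second_fund_form f p (delta_mx 0 i) (delta_mx 0 j).

Definition harmonic_map (R : realType) (a b : nat) (M : riemannian R a)
    (N : riemannian R b) (f : M -> N) : Prop :=
  forall p : M, tension f p = 0.

Definition horizontal (R : realType) (a b : nat) (M : riemannian R a)
    (N : riemannian R b) (f : M -> N) (p : M) (X : 'rV[R]_a) : Prop :=
  forall V : 'rV[R]_a, dmap f p V = 0 -> gmet p X V = 0.

Definition hwc (R : realType) (a b : nat) (M : riemannian R a)
    (N : riemannian R b) (f : M -> N) (mu : M -> R) : Prop :=
  forall p : M,
    [/\ 0 <= mu p,
        forall X Y, horizontal f p X -> horizontal f p Y ->
          gmet (f p) (dmap f p X) (dmap f p Y)
          = mu p ^+ 2 * gmet p X Y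
      & 0 < mu p -> forall Z : 'rV[R]_b,
          exists2 X, horizontal f p X & dmap f p X = Z].

Definition horizontally_conformal (R : realType) (a b : nat)
    (M : riemannian R a) (N : riemannian R b) (f : M -> N) (mu : M -> R) :
    Prop :=
  hwc f mu /\ forall p : M, 0 < mu p.

Definition horizontally_homothetic (R : realType) (a b : nat)
    (M : riemannian R a) (N : riemannian R b) (f : M -> N) (mu : M -> R) :
    Prop :=
  hwc f mu /\
  forall (p : M) (X : 'rV[R]_a), horizontal f p X -> dfun mu p X = 0.

Definition riemannian_submersion (R : realType) (a b : nat)
    (M : riemannian R a) (N : riemannian R b) (f : M -> N) : Prop :=
  horizontally_conformal f (fun _ : M => 1).

Definition harmonic_morphism (R : realType) (a b : nat) (M : riemannian R a)
    (N : riemannian R b) (f : M -> N) : Prop :=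
  harmonic_map f /\ exists mu : M -> R, hwc f mu.

(* At every regular point p the mean curvature vector of the fibre through p
   vanishes; V is any local vertical frame that is orthonormal at p. *)
Definition minimal_fibres (R : realType) (a b : nat) (M : riemannian R a)
    (N : riemannian R b) (f : M -> N) : Prop :=
  forall p : M, (forall Z : 'rV[R]_b, exists X, dmap f p X = Z) ->
  forall (U : set M) (k : nat) (V : 'I_k -> vfield M),
    open U -> U p ->
    (forall i, smooth_field U (V i)) ->
    (forall i q, U q -> dmap f q (V i q) = 0) ->
    (forall i j, gmet p (V i p) (V j p) = (i == j)%:R) ->
    (forall X, dmap f p X = 0 ->
       exists c : 'I_k -> R, X = \sum_i c i *: V i p) ->
  forall X : 'rV[R]_a, horizontal f p X ->
    gmet p (\sum_i nabla p (V i p) (V i)) X = 0.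

(* For connected M this says that f is not constant. *)
Definition nowhere_componentwise_constant (R : realType) (a b : nat)
    (M : manifold R a) (N : manifold R b) (f : M -> N) : Prop :=
  forall p : M, exists2 q : M, connected_component setT p q & f q <> f p.

Definition pm_holomorphic (R : realType) (a b : nat) (M : manifold R a)
    (N : manifold R b) (A : M -> 'M[R]_a) (B : N -> 'M[R]_b) (f : M -> N) :
    Prop :=
  exists s : R, (s = 1 \/ s = -1) /\
    forall (p : M) (X : 'rV[R]_a),
      dmap f p (X *m A p) = s *: (dmap f p X *m B (f p)).

(* [eta_vec p] is the column of components of the 1-form eta at p *)
Record acm (R : realType) (m : nat) := Acm {
  acm_riem :> riemannian R (m.*2.+1);
  phi : acm_riem -> 'M[R]_(m.*2.+1);
  xi : vfield acm_riem;
  eta_vec : acm_riem -> 'cV[R]_(m.*2.+1);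
  phi_smooth : smooth_endo phi;
  xi_smooth : smooth_field setT xi;
  eta_smooth : forall (p : acm_riem) (v : 'rV[R]_(m.*2.+1)),
    smoothM (cdom p) (fun q => (cst_ext p v q *m eta_vec q) 0 0);
  phi_sq : forall p (X : 'rV[R]_(m.*2.+1)),
    X *m phi p *m phi p = - X + (X *m eta_vec p) 0 0 *: xi p;
  eta_xi : forall p, (xi p *m eta_vec p) 0 0 = 1;
  phi_metric : forall p (X Y : 'rV[R]_(m.*2.+1)),
    gmet p (X *m phi p) (Y *m phi p)
    = gmet p X Y
      - (X *m eta_vec p) 0 0 * (Y *m eta_vec p) 0 0
}.

Record almost_hermitian (R : realType) (n : nat) := AlmostHermitian {
  ah_riem :> riemannian R (n.*2);
  cplx : ah_riem -> 'M[R]_(n.*2);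
  cplx_smooth : smooth_endo cplx;
  cplx_sq : forall p (X : 'rV[R]_(n.*2)), X *m cplx p *m cplx p = - X;
  cplx_metric : forall p (X Y : 'rV[R]_(n.*2)),
    gmet p (X *m cplx p) (Y *m cplx p) = gmet p X Y
}.

Section AlmostContact.
Variables (R : realType) (m : nat) (M : acm R m).
Local Notation T := 'rV[R]_(m.*2.+1).
Implicit Types (p : M) (X Y Z v : T).

Definition eta p X : R := (X *m eta_vec p) 0 0.

Definition Omega p X Y : R := gmet p X (Y *m phi p).

Definition nabla_phi p X Y : T := nabla_endo (@phi R m M) p X Y.

Definition nabla_xi p X : T := nabla p X (@xi R m M).

Definition Pten p X Y : T :=
  nabla_phi p X Y + nabla_phi p (X *m phi p) (Y *m phi p).

Definition Qten p X Y : T := nabla_phi p X Y + nabla_phi p Y X.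

(* h X, where 2 h = L_xi phi *)
Definition hten p X : T :=
  2^-1 *: (bracket (@xi R m M) (app_endo (@phi R m M) (cst_ext p X)) p
           - bracket (@xi R m M) (cst_ext p X) p *m phi p).

Definition deta p X Y : R :=
  let x := cst_ext p X in let y := cst_ext p Y in
  2^-1 * (dfun (fun q => eta q (y q)) p X - dfun (fun q => eta q (x q)) p Y
          - eta p (bracket x y p)).

Definition nabla_Omega p X Y Z : R :=
  let y := cst_ext p Y in let z := cst_ext p Z in
  dfun (fun q => Omega q (y q) (z q)) p X
  - Omega p (nabla p X y) Z - Omega p Y (nabla p X z).

Definition dOmega p X Y Z : R :=
  nabla_Omega p X Y Z + nabla_Omega p Y Z X + nabla_Omega p Z X Y.

Definition eta_wedge_Omega p X Y Z : R :=
  eta p X * Omega p Y Z + eta p Y * Omega p Z X + eta p Z * Omega p X Y.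

(* (deta)^k and eta /\ (deta)^k up to a nonzero combinatorial factor: the
   2k (resp. 2k+1) arguments are indexed by 'I_k * bool (resp. option of it),
   and the tensor product is antisymmetrised. *)
Definition deta_pow k p (X : 'I_k * bool -> T) : R :=
  \sum_(s : {perm 'I_k * bool}) (-1) ^+ odd_perm s *
    \prod_(i < k) deta p (X (s (i, false))) (X (s (i, true))).

Definition eta_wedge_deta_pow k p (X : option ('I_k * bool) -> T) : R :=
  \sum_(s : {perm option ('I_k * bool)}) (-1) ^+ odd_perm s *
    (eta p (X (s None)) *
     \prod_(i < k) deta p (X (s (Some (i, false)))) (X (s (Some (i, true))))).

Definition nijenhuis p X Y : T :=
  let F := @phi R m M in
  let x := cst_ext p X in let y := cst_ext p Y in
  bracket x y p *m phi p *m phi p + bracket (app_endo F x) (app_endo F y) p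
  - bracket (app_endo F x) y p *m phi p - bracket x (app_endo F y) p *m phi p.

Definition normal_acm : Prop :=
  forall p X Y, nijenhuis p X Y + (2 * deta p X Y) *: xi p = 0.

(* {e_i; phi e_i; xi} is an orthonormal basis at p *)
Definition acm_frame p (e : 'I_m -> T) : Prop :=
  [/\ forall i j, gmet p (e i) (e j) = (i == j)%:R,
      forall i j, gmet p (e i *m phi p) (e j *m phi p) = (i == j)%:R,
      forall i j, gmet p (e i) (e j *m phi p) = 0,
      forall i, gmet p (e i) (xi p) = 0
    & forall i, gmet p (e i *m phi p) (xi p) = 0] /\
  gmet p (xi p) (xi p) = 1.

Definition delta_eta p : R := - divergence (@xi R m M) p.

(* delta Omega computed in the frame e; it does not depend on e *)
Definition delta_Omega p (e : 'I_m -> T) X : R :=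
  gmet p
    (- (nabla_xi p (xi p) *m phi p) + \sum_i Pten p (e i) (e i)) X.

Definition contact_metric (alpha : R) : Prop :=
  alpha <> 0 /\ forall p X Y, deta p X Y = alpha * Omega p X Y.

Definition alpha_contact_metric : Prop := exists alpha, contact_metric alpha.

Definition quasi_contact_metric : Prop :=
  forall p X Y,
    Pten p X Y = (2 * gmet p X Y) *: xi p
                 - eta p Y *: (X + eta p X *: xi p + hten p X).

Definition quasi_K_sasakian : Prop :=
  forall p X Y,
    Pten p X Y = (2 * gmet p X Y) *: xi p - (2 * eta p Y) *: X
                 + eta p Y *: nabla_xi p (X *m phi p).

Definition strongly_pseudoconvex_CR : Prop :=
  (forall p X Y, deta p X Y = Omega p X Y) /\
  (forall p X Y,
    nabla_phi p X Y = gmet p (X + hten p X) Y *: xi p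
                      - eta p Y *: (X + hten p X)).

Definition alpha_sasakian : Prop :=
  (exists alpha, contact_metric alpha) /\ normal_acm.

Definition classA1 : Prop :=
  [\/ alpha_contact_metric, quasi_contact_metric, quasi_K_sasakian
    | strongly_pseudoconvex_CR \/ alpha_sasakian].

Definition nearly_trans_sasakian : Prop :=
  exists wp th : M -> R,
    [/\ smooth_fun wp, smooth_fun th, forall p, wp p <> 0, forall p, th p <> 0
      & forall p X Y,
          Qten p X Y
          = wp p *: ((2 * gmet p X Y) *: xi p
                     - eta p X *: Y - eta p Y *: X)
            - th p *: (eta p X *: (Y *m phi p) + eta p Y *: (X *m phi p))].

Definition classA2 : Prop := nearly_trans_sasakian.

Definition trans_sasakian : Prop :=
  exists wp th : M -> R,
    [/\ smooth_fun wp, smooth_fun th, forall p, wp p <> 0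
      & forall p, th p <> 0] /\
    [/\ normal_acm,
        forall p X Y,
          nabla_phi p X Y
          = wp p *: (gmet p X Y *: xi p - eta p Y *: X)
            + th p *: (gmet p (X *m phi p) Y *: xi p
                       - eta p Y *: (X *m phi p)),
        forall p e, acm_frame p e ->
          (2 * m)%:R * wp p = delta_Omega p e (xi p)
      & forall p, (2 * m)%:R * th p = - delta_eta p].

Definition classA3 : Prop := trans_sasakian.

Definition quasi_sasakian : Prop :=
  [/\ normal_acm, forall p X Y Z, dOmega p X Y Z = 0
    & exists r : nat,
        [/\ (1 <= r <= m.-1)%N,
            forall p, exists vs, @eta_wedge_deta_pow r p vs <> 0
          & forall p vs, @deta_pow r.+1 p vs = 0]].

Definition classA4 : Prop := quasi_sasakian.

Definition nearly_alpha_sasakian : Prop :=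
  exists alpha : R, alpha <> 0 /\
    forall p X Y,
      Qten p X Y = alpha *: ((2 * gmet p X Y) *: xi p
                             - eta p Y *: X - eta p X *: Y).

Definition classA6 : Prop := nearly_alpha_sasakian.

(* almost semi-Sasakian manifolds *)
Definition classA7a : Prop :=
  forall p e X, acm_frame p e -> delta_Omega p e X = (2 * m)%:R * eta p X.

Definition classA7 : Prop := classA7a /\ normal_acm.

Definition almost_cosymplectic : Prop :=
  (forall p X Y, deta p X Y = 0) /\ (forall p X Y Z, dOmega p X Y Z = 0).

Definition cosymplectic : Prop := almost_cosymplectic /\ normal_acm.

Definition nearly_cosymplectic : Prop := forall p X, nabla_phi p X X = 0.

Definition nearly_K_cosymplectic : Prop :=
  (forall p X, nabla_phi p X X = 0) /\
  (forall p X, nabla_phi p X (xi p) = 0).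

Definition quasi_K_cosymplectic : Prop :=
  forall p X Y, Pten p X Y = eta p Y *: nabla_xi p (X *m phi p).

Definition classB1 : Prop :=
  [\/ cosymplectic, almost_cosymplectic, nearly_cosymplectic
    | nearly_K_cosymplectic \/ quasi_K_cosymplectic].

(* almost semi-cosymplectic *)
Definition classB2a : Prop :=
  (forall p, delta_eta p = 0) /\
  (forall p e X, acm_frame p e -> delta_Omega p e X = 0).

Definition classB2 : Prop := classB2a /\ normal_acm.

Definition almost_kenmotsu (beta : M -> R) : Prop :=
  [/\ smooth_fun beta, forall p, beta p <> 0,
      forall p X Y Z, dOmega p X Y Z = 2 * beta p * eta_wedge_Omega p X Y Z,
      forall p X Y, deta p X Y = 0
    & forall p X Y, dfun beta p X * eta p Y - dfun beta p Y * eta p X = 0].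

Definition classB3 : Prop := exists beta, almost_kenmotsu beta.

End AlmostContact.

Section AlmostHermitianSection.
Variables (R : realType) (n : nat) (H : almost_hermitian R n).
Local Notation T := 'rV[R]_(n.*2).
Implicit Types (p : H) (X Y : T).

Definition nabla_cplx p X Y : T := nabla_endo (@cplx R n H) p X Y.

Definition SH p X Y : T := nabla_cplx p X Y - nabla_cplx p Y X.

(* {e_i; J e_i} is an orthonormal basis at p *)
Definition ah_frame p (e : 'I_n -> T) : Prop :=
  [/\ forall i j, gmet p (e i) (e j) = (i == j)%:R,
      forall i j, gmet p (e i *m cplx p) (e j *m cplx p) = (i == j)%:R
    & forall i j, gmet p (e i) (e j *m cplx p) = 0].

Definition semi_kahler_at p : Prop :=
  forall e, ah_frame p e -> \sum_i SH p (e i *m cplx p) (e i) = 0.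

Definition semi_kahler : Prop := forall p, semi_kahler_at p.

End AlmostHermitianSection.

(* Main.v *)
(* Let J be the differential of f.  Since f intertwines the structure tensors, J xi = lam gamma
   and the pullback of sigma is lam eta, and weak conformality gives mu^2 = lam^2.
   Differentiating J phi = s phi J and contracting with the metric shows that the tension field is
   a multiple of gamma as soon as the traces of nabla phi on both sides are multiples of the Reeb
   fields, as they are in all the classes; differentiating sigma J = lam eta and contracting gives
   its remaining component
     sigma(tau) = d lam (xi) + lam div xi - lam^2 div gamma.
   If both Reeb fields are geodesic, then d lam = d lam (xi) eta, and d(d lam) = 0 together with
   a nonzero trace of d eta against Omega forces d lam = 0.  The derivative of the conformality
   relation expresses the horizontal part of tau through the horizontal part of d(lam^2), while
   the vertical part of tau is the image of minus the mean curvature of the fibre; hence at a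
   regular point any two of harmonicity, minimality of the fibre and homothety imply the third.
   Where lam vanishes df vanishes, so that an open set of critical points is treated by the local
   constancy of f there.  For a Hermitian target the trace identity for J phi reads
   J1 tau = - mu^2 tr nabla J1, where J1 is its structure tensor. *)

Require Import Defs.
From HB Require Import structures.
From mathcomp Require Import all_boot all_order all_algebra all_fingroup.
From mathcomp Require Import all_classical all_reals all_analysis.
From mathcomp Require Import ring lra zify.

Set Implicit Arguments.
Unset Strict Implicit.
Unset Printing Implicit Defensive.

Import Order.TTheory GRing.Theory Num.Theory.
Import numFieldNormedType.Exports.

Local Open Scope classical_set_scope.
Local Open Scope ring_scope.

(** * Calculus on R^d *)

(** A tangent vector is a row in the preferred chart of its own base point, so a field can be
    differentiated only after transport to one fixed chart. Tensors are therefore matrices in a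
    fixed chart, with a covariant derivative [cov] that obeys a single Leibniz rule, and a tensor
    identity is differentiated by comparing two products. In the almost semi-Sasakian case div xi =
    0 is not visible from the definition: the trace of nabla phi is the divergence of the bivector
    g^-1 phi, and the double divergence of a bivector vanishes. The horizontal part of the tension
    carries the factor 2 - b, where b is the dimension of the target; b = 2n+1 is odd, so the factor
    is never 0. When beta_M and beta_N are constant, the prescribed dilation does not give
    harmonicity at once: a second trace, over the horizontal space, yields beta_M = lam beta_N, and
    both together force m = n. A surjective map into a Hermitian manifold is treated without
    connectedness: the image of an open set of critical points is countable, whereas a nonempty open
    set of the target is not. *)

Section RowCalculus.
Context {R : realType}.

Lemma row_normE {d} (h : 'rV[R]_d) (i : 'I_d) : `|h 0 i| <= `|h|.
Proof.
rewrite [leRHS]/Num.Def.normr/= mx_normrE.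
exact: (le_bigmax _ (fun ij : 'I_1 * 'I_d => `|h ij.1 ij.2|) (ord0, i)).
Qed.

Lemma row_norm_le {d} (h : 'rV[R]_d) (e : R) : 0 <= e ->
  (forall i, `|h 0 i| <= e) -> `|h| <= e.
Proof.
move=> e0 he; rewrite /Num.Def.normr/= mx_normrE.
by apply: bigmax_le => // -[i j] _ /=; rewrite ord1.
Qed.

Lemma differentiable_of_approx {V W : normedModType R} (f : V -> W)
    (df : {linear V -> W}) x : continuous df ->
  (forall e : R, 0 < e -> \forall h \near (0 : V),
     `|f (h + x) - f x - df h| <= e * `|h|) ->
  differentiable f x.
Proof.
move=> dfc fdf.
have E : f \o shift x = cst (f x) + df +o_ 0 id.
  apply/eqaddoP => e e0; near=> h.
  have : `|f (h + x) - f x - df h| <= e * `|h| by near: h; exact: fdf.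
  by rewrite -addrA -opprD.
by apply/diff_locallyP; rewrite (diff_unique dfc E).
Unshelve. all: by end_near. Qed.

Lemma approx_differentiable {d} (F : 'rV[R]_d -> R) x (c : 'I_d -> R) :
  (forall e, 0 < e -> \forall h \near (0 : 'rV[R]_d),
     `|F (h + x) - F x - \sum_i c i * h 0 i| <= e * `|h|) ->
  differentiable F x.
Proof.
move=> Fc; pose l (h : 'rV[R]_d) : R := \sum_i c i * h 0 i.
have llin : linear l.
  move=> a u v; rewrite /l scaler_sumr -big_split; apply: eq_bigr => i _ /=.
  by rewrite !mxE mulrDr [a *: _]mulrCA.
pose lM := GRing.isLinear.Build _ _ _ _ _ llin.
pose L : {linear 'rV[R]_d -> R} := HB.pack l lM.
have lc : continuous l.
  have -> : l = \sum_i (c i *: (fun h : 'rV[R]_d => h 0 i : R)).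
    by apply/funext => h; rewrite fct_sumE.
  move=> u; apply/differentiable_continuous/differentiable_sum => i.
  exact/differentiableZ/differentiable_coord.
have Lc : continuous L by [].
exact: (@differentiable_of_approx _ _ F L x Lc).
Qed.

Lemma is_derive_line {d} {W : normedModType R} (F : 'rV[R]_d -> W) y v s :
  derivable F (s *: v + y) v ->
  is_derive s 1 (fun t : R => F (t *: v + y)) ('D_v F (s *: v + y)).
Proof.
move=> Fd.
have E : (fun h : R => h^-1 *: ((F \o shift (s *: v + y)) (h *: v) - F (s *: v + y)))
  = (fun h : R => h^-1 *: (((fun t : R => F (t *: v + y)) \o shift s) (h *: 1)
       - F (s *: v + y))).
  apply/funext => h /=; congr (_ *: (F _ - _)).
  by rewrite [_%:A]mulr1 scalerDl addrA.
by split; rewrite /derivable /derive -E.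
Qed.

(** The sign of [t] is left free: the mean value theorem is applied on [0, t] or on [t, 0], so that
    uses along coordinate increments need no case distinction. *)
Lemma line_MVT {d} (F : 'rV[R]_d -> R) y v (t : R) :
  (forall s : R, `|s| <= `|t| -> derivable F (s *: v + y) v) ->
  exists2 s : R, `|s| <= `|t| & F (t *: v + y) - F y = 'D_v F (s *: v + y) * t.
Proof.
move=> Fd; pose g s : R := F (s *: v + y).
have gd (s : R) : `|s| <= `|t| -> is_derive s 1 g ('D_v F (s *: v + y)).
  by move=> st; apply/is_derive_line/Fd.
have gc a b : (forall s, s \in `[a, b]%R -> `|s| <= `|t|) ->
    {within `[a, b], continuous g}.
  move=> ab; apply: continuous_in_subspaceT => s.
  rewrite inE => /ab/gd sd; apply: differentiable_continuous.
  by apply/derivable1_diffP; apply: ex_derive.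
have g0 : g 0 = F y by rewrite /g scale0r add0r.
have [t0|t0|<-] := ltgtP 0 t.
- have b s : s \in `[0, t]%R -> `|s| <= `|t|.
    by rewrite in_itv /= => /andP[s0 st]; rewrite !ger0_norm // ltW.
  have [|c ct] := @MVT R g (fun s => 'D_v F (s *: v + y)) 0 t t0 _ (gc _ _ b).
    by move=> s /subset_itv_oo_cc/b/gd.
  rewrite g0 subr0 => E; exists c => //.
  by have := b c (subset_itv_oo_cc ct); rewrite (gtr0_norm t0).
- have b s : s \in `[t, 0]%R -> `|s| <= `|t|.
    rewrite in_itv /= => /andP[ts s0].
    by rewrite !ler0_norm // ?lerN2 // ltW.
  have [|c ct] := @MVT R g (fun s => 'D_v F (s *: v + y)) t 0 t0 _ (gc _ _ b).
    by move=> s /subset_itv_oo_cc/b/gd.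
  rewrite g0 sub0r => E; exists c => //.
    by have := b c (subset_itv_oo_cc ct); rewrite (ltr0_norm t0).
  by rewrite -[LHS]opprB -/(g t) E mulrN opprK.
- by exists 0; rewrite // scale0r add0r subrr mulr0.
Qed.

(** The increment is telescoped along the coordinates and each step is controlled by the mean value
    theorem. This is the passage from directional derivatives, the only ones in the definition of
    smoothness, to total differentiability. *)
Lemma continuous_partials_differentiable {d} (F : 'rV[R]_d -> R) x :
  (\forall y \near x, forall i : 'I_d, derivable F y (delta_mx 0 i)) ->
  (forall i : 'I_d, {for x, continuous ('D_(delta_mx 0 i) F)}) ->
  differentiable F x.
Proof.
move=> Fd Fc; apply: (@approx_differentiable _ _ _
  (fun i => 'D_(delta_mx 0 i) F x)) => e e0.
(* Division by [d.+1] instead of [d] keeps the bound meaningful in dimension 0. *)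
have d0 : 0 < e / d.+1%:R :> R by rewrite divr_gt0.
have near1 : \forall y \near x, (forall i : 'I_d, derivable F y (delta_mx 0 i)) /\
    forall i : 'I_d, `|'D_(delta_mx 0 i) F x - 'D_(delta_mx 0 i) F y| <= e / d.+1%:R.
  apply: filterI => //.
  apply: filter_forall (fun i => (cvgrPdist_le _ _).1 (Fc i) _ d0).
have [r /= r0 Hr] := (nbhs_ballP _ _).1 near1.
apply/nbhs_ballP; exists r => //= h; rewrite -ball_normE /= sub0r normrN => hr.
(* [tr k] keeps the first k coordinates of [h]; its norm never exceeds that of [h], so all
   intermediate points stay in the ball. *)
pose tr k : 'rV[R]_d := \row_j (if (j < k)%N then h 0 j else 0).
have tr0 : tr 0%N = 0 by apply/rowP => j; rewrite !mxE.
have trd : tr d = h by apply/rowP => j; rewrite !mxE ltn_ord.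
have trS (k : 'I_d) : tr k.+1 = h 0 k *: delta_mx 0 k + tr k.
  apply/rowP => j; rewrite !mxE /=.
  have [->|jk] := eqVneq j k; first by rewrite ltnS leqnn ltnn mulr1 addr0.
  by rewrite mulr0 add0r ltnS leq_eqVlt val_eqE (negbTE jk).
have -> : F (h + x) - F x = \sum_(k < d) (F (tr k.+1 + x) - F (tr k + x)).
  rewrite -(big_mkord xpredT (fun k => F (tr k.+1 + x) - F (tr k + x))).
  by rewrite telescope_sumr // trd tr0 add0r.
rewrite -sumrB (le_trans (ler_norm_sum _ _ _)) //.
apply: (@le_trans _ _ (\sum_(k < d) e / d.+1%:R * `|h|)); last first.
  rewrite -mulr_suml ler_wpM2r // sumr_const card_ord -[leLHS]mulr_natl mulrCA.
  by rewrite ler_piMr ?(ltW e0) // ler_pdivrMr // mul1r ler_nat.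
apply: ler_sum => k _.
have tb s : `|s| <= `|h 0 k| -> ball x r (s *: delta_mx 0 k + (tr k + x)).
  move=> sh; rewrite -ball_normE /= addrA opprD addrCA subrr addr0 normrN.
  apply: le_lt_trans hr; apply: row_norm_le => // j; rewrite !mxE /=.
  have [->|jk] := eqVneq j k.
    by rewrite ltnn mulr1 addr0 (le_trans sh) // row_normE.
  by rewrite mulr0 add0r; case: ifP; rewrite ?normr0 // row_normE.
have [s sh] := @line_MVT _ F (tr k + x) (delta_mx 0 k) (h 0 k)
  (fun s sh => (Hr _ (tb s sh)).1 k).
rewrite addrA -trS => ->; rewrite -mulrBl normrM.
rewrite ler_pM // ?row_normE // distrC.
exact: (Hr _ (tb s sh)).2.
Qed.

Lemma dist_le_halves (e a b c : R) :
  `|a - b| <= e / 2 -> `|c - b| <= e / 2 -> `|a - c| <= e.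
Proof.
move=> ab cb; apply: le_trans (ler_distD b _ _) _.
by rewrite [leRHS]splitr lerD // distrC.
Qed.

(** Two applications of the mean value theorem, in either order, express the same second difference
    by each mixed derivative at some nearby point. Continuity at [x] then makes the two values at
    [x] differ by at most any e > 0. *)
Lemma clairaut {d} (F : 'rV[R]_d -> R) x v w :
  (\forall y \near x, [/\ derivable F y v, derivable F y w,
     derivable ('D_v F) y w & derivable ('D_w F) y v]) ->
  {for x, continuous ('D_w ('D_v F))} -> {for x, continuous ('D_v ('D_w F))} ->
  'D_w ('D_v F) x = 'D_v ('D_w F) x.
Proof.
move=> Fd c1 c2; apply/eqP; rewrite -subr_eq0 -normr_le0.
apply/ler_addgt0Pl => e e0; rewrite addr0.
have e2 : 0 < e / 2 by rewrite divr_gt0.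
have near1 : \forall y \near x, [/\ derivable F y v, derivable F y w,
     derivable ('D_v F) y w & derivable ('D_w F) y v] /\
   `|'D_w ('D_v F) x - 'D_w ('D_v F) y| <= e / 2 /\
   `|'D_v ('D_w F) x - 'D_v ('D_w F) y| <= e / 2.
  apply: filterI => //; apply: filterI.
    exact: ((cvgrPdist_le _ _).1 c1 _ e2).
  exact: ((cvgrPdist_le _ _).1 c2 _ e2).
have [r /= r0 Hr] := (nbhs_ballP _ _).1 near1.
(* With this choice t (|v| + |w| + 1) = r / 2, so the whole parallelogram lies in the ball; the
   summand 1 avoids division by zero. *)
pose t : R := r / 2 / (`|v| + `|w| + 1).
have n0 : 0 < `|v| + `|w| + 1 by rewrite ltr_wpDl // addr_ge0.
have t0 : 0 < t by rewrite !divr_gt0.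
have tb a b : `|a| <= `|t| -> `|b| <= `|t| -> ball x r (a *: v + (b *: w + x)).
  rewrite (gtr0_norm t0) => at_ bt.
  rewrite -ball_normE /= addrA opprD addrCA subrr addr0 normrN.
  apply: (le_lt_trans (ler_normD _ _)); rewrite !normrZ.
  apply: (@le_lt_trans _ _ (t * (`|v| + `|w| + 1))).
    rewrite 2!mulrDr mulr1 -[leLHS]addr0 !lerD ?ler_wpM2r //; exact: ltW.
  by rewrite /t divfK ?gt_eqF // ltr_pdivrMr // ltr_pMr // ltr1n.
have le00 : `|0 : R| <= `|t| by rewrite normr0.
have lett : `|t| <= `|t| by [].
have C (a b : R) : a *: v + (b *: w + x) = b *: w + (a *: v + x) by rewrite addrCA.
(* the second difference of F, computed in both orders *)
have [s1 s1t E1] : exists2 s : R, `|s| <= `|t| &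
   F (t *: v + (t *: w + x)) - F (t *: v + x) - (F (t *: w + x) - F x)
   = ('D_v F (s *: v + (t *: w + x)) - 'D_v F (s *: v + x)) * t.
  pose F2 y := F (t *: w + y) - F y.
  have Fs y : derivable F (t *: w + y) v ->
      is_derive y v (fun y => F (t *: w + y)) ('D_v F (t *: w + y)).
    move=> dF; have E : (fun h : R => h^-1 *: ((F \o shift (t *: w + y)) (h *: v) - F (t *: w + y)))
     = (fun h => h^-1 *: (((fun y => F (t *: w + y)) \o shift y) (h *: v) - F (t *: w + y))).
      by apply/funext => h /=; rewrite addrCA.
    by split; rewrite /derivable /derive -E.
  have F2d (s : R) : `|s| <= `|t| -> is_derive (s *: v + x) v F2
      ('D_v F (s *: v + (t *: w + x)) - 'D_v F (s *: v + x)).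
    move=> st; rewrite addrCA; apply: is_deriveB.
      apply: Fs; rewrite addrCA; by have [[? _ _ _] _] := Hr _ (tb s t st lett).
    apply: derivableP; have [[+ _ _ _] _] := Hr _ (tb s 0 st le00).
    by rewrite scale0r add0r.
  have [s st] := @line_MVT _ F2 x v t (fun s st => @ex_derive _ _ _ _ _ _ _ (F2d s st)).
  rewrite (@derive_val _ _ _ _ _ _ _ (F2d s st)) /F2 => E.
  exists s => //; rewrite -E [t *: w + (_ + _)]addrCA; ring.
have [s2 s2t E2] : exists2 s : R, `|s| <= `|t| &
   F (t *: v + (t *: w + x)) - F (t *: w + x) - (F (t *: v + x) - F x)
   = ('D_w F (t *: v + (s *: w + x)) - 'D_w F (s *: w + x)) * t.
  pose F2 y := F (t *: v + y) - F y.
  have Fs y : derivable F (t *: v + y) w ->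
      is_derive y w (fun y => F (t *: v + y)) ('D_w F (t *: v + y)).
    move=> dF; have E : (fun h : R => h^-1 *: ((F \o shift (t *: v + y)) (h *: w) - F (t *: v + y)))
     = (fun h => h^-1 *: (((fun y => F (t *: v + y)) \o shift y) (h *: w) - F (t *: v + y))).
      by apply/funext => h /=; rewrite addrCA.
    by split; rewrite /derivable /derive -E.
  have F2d (s : R) : `|s| <= `|t| -> is_derive (s *: w + x) w F2
      ('D_w F (t *: v + (s *: w + x)) - 'D_w F (s *: w + x)).
    move=> st; apply: is_deriveB.
      apply: Fs; by have [[_ ? _ _] _] := Hr _ (tb t s lett st).
    apply: derivableP; have [[_ + _ _] _] := Hr _ (tb 0 s le00 st).
    by rewrite scale0r add0r.
  have [s st] := @line_MVT _ F2 x w t (fun s st => @ex_derive _ _ _ _ _ _ _ (F2d s st)).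
  rewrite (@derive_val _ _ _ _ _ _ _ (F2d s st)) /F2 => E.
  by exists s.
have [b1 b1t E3] : exists2 b : R, `|b| <= `|t| &
    'D_v F (s1 *: v + (t *: w + x)) - 'D_v F (s1 *: v + x)
    = 'D_w ('D_v F) (s1 *: v + (b *: w + x)) * t.
  have [b bt E] := @line_MVT _ ('D_v F) (s1 *: v + x) w t (fun b bt =>
    ltac:(rewrite addrCA; by have [[_ _ ? _] _] := Hr _ (tb s1 b s1t bt))).
  exists b; first exact: bt.
  by rewrite !C; exact: E.
have [a2 a2t E4] : exists2 a : R, `|a| <= `|t| &
    'D_w F (t *: v + (s2 *: w + x)) - 'D_w F (s2 *: w + x)
    = 'D_v ('D_w F) (a *: v + (s2 *: w + x)) * t.
  exact: (@line_MVT _ ('D_w F) (s2 *: w + x) v t (fun a at_ =>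
    ltac:(by have [[_ _ _ ?] _] := Hr _ (tb a s2 at_ s2t)))).
have E5 : 'D_w ('D_v F) (s1 *: v + (b1 *: w + x))
        = 'D_v ('D_w F) (a2 *: v + (s2 *: w + x)).
  have aux (X Y Z W P Q A B : R) : X - Y - (Z - W) = P * t ->
      X - Z - (Y - W) = Q * t -> P = A * t -> Q = B * t -> A = B.
    have t0' : t != 0 by rewrite gt_eqF.
    move=> f1 f2 f3 f4; apply: (mulIf t0'); apply: (mulIf t0').
    by rewrite -f3 -f4 -f1 -f2; ring.
  exact: aux E1 E2 E3 E4.
have [_ [h1 _]] := Hr _ (tb s1 b1 s1t b1t).
have [_ [_ h2]] := Hr _ (tb a2 s2 a2t s2t).
by apply: dist_le_halves h1 _; rewrite E5; exact: h2.
Qed.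

End RowCalculus.

Local Opaque derive derivable.

(** * Smooth functions on open sets of R^d *)

Section SmoothOn.
Context {R : realType}.

Lemma differentiable_mx {V : normedModType R} {m n} (F : V -> 'M[R]_(m, n)) x :
  (forall i j, differentiable (fun y => F y i j) x) -> differentiable F x.
Proof.
move=> Fd.
have -> : F = \sum_i \sum_j (fun y => F y i j *: delta_mx i j).
  apply/funext => y; rewrite fct_sumE [LHS]matrix_sum_delta.
  by apply: eq_bigr => i _; rewrite fct_sumE.
by apply: differentiable_sum => i; apply: differentiable_sum => j;
  apply: differentiableZl.
Qed.

Lemma differentiable_entry {V : normedModType R} {m n} (F : V -> 'M[R]_(m, n))
    x i j : differentiable F x -> differentiable (fun y => F y i j) x.
Proof.
move=> Fd; apply: (@differentiable_comp _ _ _ _ F (fun N : 'M[R]_(m, n) => N i j : R)) => //.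
exact: differentiable_coord.
Qed.

Lemma derive_entry {V : normedModType R} {m n} (F : V -> 'M[R]_(m, n)) x v i j :
  derivable F x v -> ('D_v F x) i j = 'D_v (fun y => F y i j) x.
Proof. by move=> Fd; rewrite derive_mx // mxE. Qed.

Lemma continuous_mx {T : topologicalType} {m n} (F : T -> 'M[R]_(m, n)) x :
  (forall i j, {for x, continuous (fun y => F y i j)}) -> {for x, continuous F}.
Proof.
move=> Fc; apply/cvgrPdist_le => e e0.
have H : \forall y \near x, forall ij : 'I_m * 'I_n,
    `|F x ij.1 ij.2 - F y ij.1 ij.2| <= e.
  apply: filter_forall (fun ij => (cvgrPdist_le _ _).1 (Fc ij.1 ij.2) _ e0).
apply: filterS H => y H.
rewrite /Num.Def.normr/= mx_normrE; apply: bigmax_le; first exact: ltW.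
by move=> ij _; rewrite !mxE; exact: H.
Qed.

Lemma iterD_cat {d} {W : normedModType R} vs ws (F : 'rV[R]_d -> W) :
  Defs.iterD (vs ++ ws) F = Defs.iterD vs (Defs.iterD ws F).
Proof. by elim: vs => //= v vs ->. Qed.

Lemma near_open {T : topologicalType} (U : set T) (P : T -> Prop) x :
  open U -> U x -> (forall y, U y -> P y) -> \forall y \near x, P y.
Proof. by move=> Uo Ux UP; apply: filterS UP _; exact: open_nbhs_nbhs. Qed.

Lemma eq_iterD {d} {W : normedModType R} (U : set 'rV[R]_d) (F G : 'rV[R]_d -> W) :
  open U -> (forall x, U x -> F x = G x) ->
  forall vs x, U x -> Defs.iterD vs F x = Defs.iterD vs G x.
Proof.
move=> Uo FG; elim=> [|v vs IH] x Ux /=; first exact: FG.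
by apply: near_eq_derive; exact: (near_open _ _ IH).
Qed.

Lemma continuous_near_eq {T S : topologicalType} (F G : T -> S) x :
  {near x, F =1 G} -> {for x, continuous F} -> {for x, continuous G}.
Proof.
move=> FG Fc; have Fx := nbhs_singleton FG.
rewrite /prop_for /continuous_at -Fx.
by apply: cvg_trans Fc; apply: near_eq_cvg; apply: filterS FG => y ->.
Qed.

Lemma smooth_on_ext {d} {W : normedModType R} (U : set 'rV[R]_d)
    (F G : 'rV[R]_d -> W) :
  open U -> (forall x, U x -> F x = G x) -> smooth_on U F -> smooth_on U G.
Proof.
move=> Uo FG Fs vs x Ux; have [Fc Fd] := Fs vs x Ux.
have E : {near x, Defs.iterD vs F =1 Defs.iterD vs G}.
  by apply: (near_open Uo Ux); exact: (eq_iterD Uo FG).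
split; first exact: continuous_near_eq Fc.
by move=> v; apply: near_eq_derivable (Fd v).
Qed.

Lemma smooth_on_sub {d} {W : normedModType R} (U V : set 'rV[R]_d)
    (F : 'rV[R]_d -> W) : V `<=` U -> smooth_on U F -> smooth_on V F.
Proof. by move=> VU Fs vs x /VU; exact: Fs. Qed.

Lemma smooth_on_derive {d} {W : normedModType R} (U : set 'rV[R]_d)
    (F : 'rV[R]_d -> W) v : smooth_on U F -> smooth_on U ('D_v F).
Proof. by move=> Fs vs x /(Fs (rcons vs v) x); rewrite -cats1 iterD_cat. Qed.

Lemma smooth_on_continuous {d} {W : normedModType R} (U : set 'rV[R]_d)
    (F : 'rV[R]_d -> W) x : smooth_on U F -> U x -> {for x, continuous F}.
Proof. by move=> Fs /(Fs [::] x)[]. Qed.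

Lemma smooth_on_derivable {d} {W : normedModType R} (U : set 'rV[R]_d)
    (F : 'rV[R]_d -> W) x v : smooth_on U F -> U x -> derivable F x v.
Proof. by move=> Fs /(Fs [::] x)[]. Qed.

Lemma iterD_entry {d m n} (U : set 'rV[R]_d) (F : 'rV[R]_d -> 'M[R]_(m, n)) i j :
  open U -> smooth_on U F -> forall vs x, U x ->
  Defs.iterD vs F x i j = Defs.iterD vs (fun y => F y i j) x.
Proof.
move=> Uo Fs; elim=> [//|v vs IH] x Ux /=.
rewrite derive_entry; last by have [_] := Fs vs x Ux.
by apply: near_eq_derive; exact: (near_open _ _ IH).
Qed.

Lemma smooth_on_entry {d m n} (U : set 'rV[R]_d) (F : 'rV[R]_d -> 'M[R]_(m, n)) i j :
  open U -> smooth_on U F -> smooth_on U (fun y => F y i j).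
Proof.
move=> Uo Fs vs x Ux; have [Fc Fd] := Fs vs x Ux.
have E : {near x, (fun y => Defs.iterD vs F y i j) =1 Defs.iterD vs (fun y => F y i j)}.
  by apply: (near_open Uo Ux); exact: (iterD_entry _ _ Uo Fs).
split.
  apply: continuous_near_eq E _.
  apply: (@continuous_comp _ _ _ (Defs.iterD vs F) (fun N : 'M[R]_(m, n) => N i j)) => //.
  exact: coord_continuous.
by move=> v; apply: near_eq_derivable E _; exact: (derivable_mxP _ _ _).1 (Fd v) i j.
Qed.

(** Entries commute with a derivative only where the matrix function is derivable, so the entrywise
    formula, continuity and derivability are proved together by induction on the list of
    directions. *)
Lemma smooth_on_mx {d m n} (U : set 'rV[R]_d) (F : 'rV[R]_d -> 'M[R]_(m, n)) :
  open U -> (forall i j, smooth_on U (fun y => F y i j)) -> smooth_on U F.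
Proof.
move=> Uo Fs.
suff H vs : forall x, U x ->
    (forall i j, Defs.iterD vs F x i j = Defs.iterD vs (fun y => F y i j) x) /\
    {for x, continuous (Defs.iterD vs F)} /\ forall v, derivable (Defs.iterD vs F) x v.
  by move=> vs x /(H vs x)[].
elim: vs => [|v vs IH] x Ux /=.
  split=> //; split; first by apply: continuous_mx => i j; have [] := Fs i j [::] x Ux.
  by move=> v; apply/derivable_mxP => i j; have [] := Fs i j [::] x Ux.
have E y i j : U y -> ('D_v (Defs.iterD vs F) y) i j
    = 'D_v (Defs.iterD vs (fun z => F z i j)) y.
  move=> Uy; have [_ [_ Fd]] := IH y Uy; rewrite derive_entry //.
  by apply: near_eq_derive; apply: (near_open Uo Uy) => z /IH[].
have E' i j : {near x, Defs.iterD (v :: vs) (fun z => F z i j)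
    =1 (fun y => ('D_v (Defs.iterD vs F) y) i j)}.
  by apply: (near_open Uo Ux) => y /E ->.
split; first by move=> i j; exact: E.
split.
  apply: continuous_mx => i j; apply: continuous_near_eq (E' i j) _.
  by have [] := Fs i j (v :: vs) x Ux.
move=> w; apply/derivable_mxP => i j; apply: near_eq_derivable (E' i j) _.
by have [_] := Fs i j (v :: vs) x Ux.
Qed.

(** Turns the definition by iterated directional derivatives into total differentiability, on which
    the chain rule and all later Leibniz rules rest. *)
Lemma smooth_on_differentiable {d m n} (U : set 'rV[R]_d)
    (F : 'rV[R]_d -> 'M[R]_(m, n)) x :
  open U -> smooth_on U F -> U x -> differentiable F x.
Proof.
move=> Uo Fs Ux; apply: differentiable_mx => i j.
have Fij := smooth_on_entry i j Uo Fs.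
apply: continuous_partials_differentiable => [|k].
  by apply: (near_open Uo Ux) => y Uy k; exact: smooth_on_derivable Uy.
by apply: smooth_on_continuous Ux; exact: smooth_on_derive.
Qed.

Lemma smooth_on_differentiable1 {d} (U : set 'rV[R]_d) (F : 'rV[R]_d -> R) x :
  open U -> smooth_on U F -> U x -> differentiable F x.
Proof.
move=> Uo Fs Ux; apply: continuous_partials_differentiable => [|k].
  by apply: (near_open Uo Ux) => y Uy k; exact: smooth_on_derivable Uy.
by apply: smooth_on_continuous Ux; exact: smooth_on_derive.
Qed.

Lemma smooth_on_clairaut1 {d} (U : set 'rV[R]_d) (F : 'rV[R]_d -> R) x v w :
  open U -> smooth_on U F -> U x -> 'D_w ('D_v F) x = 'D_v ('D_w F) x.
Proof.
move=> Uo Fs Ux; have Fv := smooth_on_derive v Fs; have Fw := smooth_on_derive w Fs.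
apply: clairaut.
- by apply: (near_open Uo Ux) => y Uy; split;
  [exact: (smooth_on_derivable Fs Uy)|exact: (smooth_on_derivable Fs Uy)
  |exact: (smooth_on_derivable Fv Uy)|exact: (smooth_on_derivable Fw Uy)].
- exact: (smooth_on_continuous (smooth_on_derive w Fv) Ux).
- exact: (smooth_on_continuous (smooth_on_derive v Fw) Ux).
Qed.

Lemma smooth_on_clairaut {d m n} (U : set 'rV[R]_d)
    (F : 'rV[R]_d -> 'M[R]_(m, n)) x v w :
  open U -> smooth_on U F -> U x -> 'D_w ('D_v F) x = 'D_v ('D_w F) x.
Proof.
move=> Uo Fs Ux; apply/matrixP => i j.
have Fij := smooth_on_entry i j Uo Fs.
have E u w' : ('D_w' ('D_u F) x) i j = 'D_w' ('D_u (fun y => F y i j)) x.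
  by rewrite (@iterD_entry _ _ _ U F i j Uo Fs [:: w'; u]).
exact: (etrans (E v w) (etrans (smooth_on_clairaut1 v w Uo Fij Ux) (esym (E w v)))).
Qed.

Lemma smooth_on_cst {d} (U : set 'rV[R]_d) (c : R) : smooth_on U (fun=> c).
Proof.
move=> [|u vs] x Ux; first by split=> [|v]; [exact: cst_continuous|exact: derivable_cst].
have -> : Defs.iterD (u :: vs) (fun=> c) = (fun=> 0).
  elim: vs u => [|w vs IH] u; first by apply/funext => y /=; rewrite derive_cst.
  by apply/funext => y; rewrite /= -/(Defs.iterD (w :: vs) _) IH derive_cst.
by split=> [|v]; [exact: cst_continuous|exact: derivable_cst].
Qed.

(* The algebra generated by the smooth functions on U and the pullbacks under
   G of the smooth functions on V; by the chain rule it is closed under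
   derivation, so that all its elements are smooth. *)
Inductive smooth_alg {a b} (U : set 'rV[R]_a) (V : set 'rV[R]_b)
    (G : 'rV[R]_a -> 'rV[R]_b) : ('rV[R]_a -> R) -> Prop :=
| smooth_alg_pull A : smooth_on V A -> smooth_alg U V G (A \o G)
| smooth_alg_base B : smooth_on U B -> smooth_alg U V G B
| smooth_alg_add A B : smooth_alg U V G A -> smooth_alg U V G B ->
    smooth_alg U V G (A \+ B)
| smooth_alg_mul A B : smooth_alg U V G A -> smooth_alg U V G B ->
    smooth_alg U V G (A \* B).

Lemma derive_sum_row {d} {W : normedModType R} (F : 'rV[R]_d -> W) x v :
  differentiable F x -> 'D_v F x = \sum_i v 0 i *: 'D_(delta_mx 0 i) F x.
Proof.
move=> Fd; rewrite deriveE // [in LHS](row_sum_delta v) linear_sum.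
by apply: eq_bigr => i _; rewrite linearZ /= deriveE.
Qed.

Lemma derive_comp {V W Z : normedModType R} (F : W -> Z) (G : V -> W) x v :
  differentiable G x -> differentiable F (G x) ->
  'D_v (F \o G) x = 'D_('D_v G x) F (G x).
Proof.
move=> Gd Fd; rewrite deriveE; last exact: differentiable_comp.
by rewrite diff_comp // /= !deriveE.
Qed.

Lemma smooth_alg_derive {a b} (U : set 'rV[R]_a) (V : set 'rV[R]_b) G F :
  open U -> open V -> smooth_on U G -> (forall x, U x -> V (G x)) ->
  smooth_alg U V G F ->
  (forall x, U x -> differentiable F x) /\
  forall v, exists2 F', smooth_alg U V G F' & forall x, U x -> 'D_v F x = F' x.
Proof.
move=> Uo Vo Gs GUV; elim=> {F}[A As|B Bs|A B _ [Ad IHA] _ [Bd IHB]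
    |A B Aa [Ad IHA] Ba [Bd IHB]].
- have Ad x : U x -> differentiable A (G x).
    by move=> /GUV; exact: smooth_on_differentiable1.
  have Gd x : U x -> differentiable G x by exact: smooth_on_differentiable.
  split=> [x Ux|v]; first by apply: differentiable_comp; [exact: Gd|exact: Ad].
  exists (fun x => \sum_i 'D_v (fun y => G y 0 i) x * 'D_(delta_mx 0 i) A (G x)).
    have H (s : seq 'I_b) : smooth_alg U V G
      (fun x => \sum_(i <- s) 'D_v (fun y => G y 0 i) x * 'D_(delta_mx 0 i) A (G x)).
      elim: s => [|i s IH].
        under eq_fun do rewrite big_nil.
        by apply: smooth_alg_base; exact: smooth_on_cst.
      under eq_fun do rewrite big_cons.
      apply: smooth_alg_add IH; apply: smooth_alg_mul.
        by apply: smooth_alg_base; apply: smooth_on_derive; exact: smooth_on_entry.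
      apply: (@smooth_alg_pull _ _ U V G ('D_(delta_mx 0 i) A)).
      exact: smooth_on_derive.
    exact: H.
  move=> x Ux; rewrite derive_comp; [|exact: Gd|exact: Ad].
  rewrite derive_sum_row; last exact: Ad.
  apply: eq_bigr => i _; rewrite derive_entry //.
  exact: diff_derivable (Gd _ Ux).
- split=> [x|v]; first exact: smooth_on_differentiable1.
  by exists ('D_v B) => //; apply: smooth_alg_base; exact: smooth_on_derive.
- split=> [x Ux|v]; first by apply: differentiableD; [exact: Ad|exact: Bd].
  have [A' A's EA] := IHA v; have [B' B's EB] := IHB v.
  exists (A' \+ B'); first exact: smooth_alg_add.
  move=> x Ux; rewrite /= -EA // -EB // deriveD //.
    exact: diff_derivable (Ad _ Ux).
  exact: diff_derivable (Bd _ Ux).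
- split=> [x Ux|v]; first by apply: differentiableM; [exact: Ad|exact: Bd].
  have [A' A's EA] := IHA v; have [B' B's EB] := IHB v.
  exists ((A \* B') \+ (B \* A')).
    by apply: smooth_alg_add; apply: smooth_alg_mul.
  move=> x Ux; rewrite /= -EA // -EB // deriveM //.
    exact: diff_derivable (Ad _ Ux).
  exact: diff_derivable (Bd _ Ux).
Qed.

Lemma smooth_alg_smooth {a b} (U : set 'rV[R]_a) (V : set 'rV[R]_b) G F :
  open U -> open V -> smooth_on U G -> (forall x, U x -> V (G x)) ->
  smooth_alg U V G F -> smooth_on U F.
Proof.
move=> Uo Vo Gs GUV Fa.
have H vs : exists2 F', smooth_alg U V G F' & forall x, U x -> Defs.iterD vs F x = F' x.
  elim: vs => [|v vs [F' F'a E]]; first by exists F.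
  have [_ /(_ v)[F'' F''a E']] := smooth_alg_derive Uo Vo Gs GUV F'a.
  exists F'' => // x Ux; rewrite -E' //=.
  by apply: near_eq_derive; exact: (near_open _ _ E).
move=> vs x Ux; have [F' F'a E] := H vs.
have [F'd _] := smooth_alg_derive Uo Vo Gs GUV F'a.
have E' : {near x, F' =1 Defs.iterD vs F} by apply: (near_open Uo Ux) => y /E ->.
split; first exact: continuous_near_eq E' (differentiable_continuous (F'd _ Ux)).
by move=> v; apply: near_eq_derivable E' _; exact: diff_derivable (F'd _ Ux).
Qed.

Lemma smooth_on_comp {a b} (U : set 'rV[R]_a) (V : set 'rV[R]_b) G
    (A : 'rV[R]_b -> R) :
  open U -> open V -> smooth_on U G -> (forall x, U x -> V (G x)) ->
  smooth_on V A -> smooth_on U (A \o G).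
Proof.
move=> Uo Vo Gs GUV As; apply: smooth_alg_smooth Uo Vo Gs GUV _.
exact: smooth_alg_pull.
Qed.

Lemma smooth_on_id {d} (U : set 'rV[R]_d) : smooth_on U id.
Proof.
move=> [|u vs] x Ux; first by split=> [|v]; [exact: cvg_id|exact: derivable_id].
have -> : Defs.iterD (u :: vs) id = (fun=> if vs is [::] then u else 0).
  apply/funext => y /=; elim: vs u y => [|w vs IH] u y /=; first exact: derive_id.
  rewrite (_ : 'D_w (Defs.iterD vs id) = fun=> if vs is [::] then w else 0) ?derive_cst //.
  by apply/funext => z; exact: IH.
by split=> [|v]; [exact: cst_continuous|exact: derivable_cst].
Qed.

(** The algebra [smooth_alg] with G the identity yields closure under sums and, below, under
    products, without an induction on iterated Leibniz formulas. *)
Lemma smooth_on_add {d} (U : set 'rV[R]_d) (A B : 'rV[R]_d -> R) : open U ->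
  smooth_on U A -> smooth_on U B -> smooth_on U (A \+ B).
Proof.
move=> Uo As Bs; apply: (@smooth_alg_smooth _ _ U U id) => //.
  exact: smooth_on_id.
by apply: smooth_alg_add; exact: smooth_alg_base.
Qed.

Lemma smooth_on_mul {d} (U : set 'rV[R]_d) (A B : 'rV[R]_d -> R) : open U ->
  smooth_on U A -> smooth_on U B -> smooth_on U (A \* B).
Proof.
move=> Uo As Bs; apply: (@smooth_alg_smooth _ _ U U id) => //.
  exact: smooth_on_id.
by apply: smooth_alg_mul; exact: smooth_alg_base.
Qed.

Lemma smooth_on_sum {d} (U : set 'rV[R]_d) {I : Type} (s : seq I)
    (F : I -> 'rV[R]_d -> R) : open U -> (forall i, smooth_on U (F i)) ->
  smooth_on U (fun x => \sum_(i <- s) F i x).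
Proof.
move=> Uo Fs; elim: s => [|i s IH].
  by under eq_fun do rewrite big_nil; exact: smooth_on_cst.
by under eq_fun do rewrite big_cons; exact: smooth_on_add.
Qed.

Lemma smooth_on_prod {d} (U : set 'rV[R]_d) {I : Type} (s : seq I)
    (F : I -> 'rV[R]_d -> R) : open U -> (forall i, smooth_on U (F i)) ->
  smooth_on U (fun x => \prod_(i <- s) F i x).
Proof.
move=> Uo Fs; elim: s => [|i s IH].
  by under eq_fun do rewrite big_nil; exact: smooth_on_cst.
by under eq_fun do rewrite big_cons; exact: smooth_on_mul.
Qed.

Lemma smooth_on_mulmx {d m n p} (U : set 'rV[R]_d) (A : 'rV[R]_d -> 'M[R]_(m, n))
    (B : 'rV[R]_d -> 'M[R]_(n, p)) : open U ->
  smooth_on U A -> smooth_on U B -> smooth_on U (fun x => A x *m B x).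
Proof.
move=> Uo As Bs; apply: smooth_on_mx => // i k.
under eq_fun do rewrite mxE.
apply: smooth_on_sum => // j; apply: (smooth_on_mul Uo); exact: smooth_on_entry.
Qed.

Lemma smooth_on_det {d n} (U : set 'rV[R]_d) (A : 'rV[R]_d -> 'M[R]_n) : open U ->
  smooth_on U A -> smooth_on U (fun x => \det (A x)).
Proof.
move=> Uo As; rewrite /determinant; apply: smooth_on_sum => // s.
apply: (smooth_on_mul Uo); first exact: smooth_on_cst.
by apply: smooth_on_prod => // i; exact: smooth_on_entry.
Qed.

Lemma smooth_on_cofactor {d n} (U : set 'rV[R]_d) (A : 'rV[R]_d -> 'M[R]_n) i j :
  open U -> smooth_on U A -> smooth_on U (fun x => cofactor (A x) i j).
Proof.
move=> Uo As; apply: (smooth_on_mul Uo); first exact: smooth_on_cst.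
apply: smooth_on_det => //; apply: smooth_on_mx => // k l.
by under eq_fun do rewrite !mxE; exact: smooth_on_entry.
Qed.

End SmoothOn.

(** * Traces of bilinear maps and Christoffel symbols *)

Local Opaque smooth_on.

Lemma addmxE {R : pzRingType} {m n} (A B : 'M[R]_(m, n)) i j :
  (A + B) i j = A i j + B i j.
Proof. by rewrite mxE. Qed.

Lemma oppmxE {R : pzRingType} {m n} (A : 'M[R]_(m, n)) i j : (- A) i j = - A i j.
Proof. by rewrite mxE. Qed.

Lemma scalemxE {R : pzRingType} {m n} k (A : 'M[R]_(m, n)) i j :
  (k *: A) i j = k * A i j.
Proof. by rewrite mxE. Qed.

Lemma zeromxE {R : pzRingType} {m n} i j : (0 : 'M[R]_(m, n)) i j = 0.
Proof. by rewrite mxE. Qed.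

(* [ring] for linear combinations of matrices, products being atoms *)
Ltac mx_entries := rewrite ?(addmxE, oppmxE, scalemxE, zeromxE).
Ltac mx_ring := apply/matrixP => ? ?; mx_entries; ring.

Section Contraction.
Context {R : realFieldType}.

(** The contraction of [T] with the bivector [P] in the standard basis. For [P] the inverse metric
    it is the metric trace, obtained without choosing an orthonormal frame. *)
Definition gtr {a b} {V : lmodType R} (P : 'M[R]_(a, b))
    (T : 'rV[R]_a -> 'rV[R]_b -> V) : V :=
  \sum_i \sum_j P i j *: T (delta_mx 0 i) (delta_mx 0 j).

(** Bilinearity is stated as determination by the values on basis vectors, the form in which a
    contraction can be pushed through [T]. *)
Definition bilin {a b} {V : lmodType R} (T : 'rV[R]_a -> 'rV[R]_b -> V) : Prop :=
  forall v w, T v w = gtr (v^T *m w) T.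

Definition lin {a} {V : lmodType R} (F : 'rV[R]_a -> V) : Prop :=
  forall v, F v = \sum_i v 0 i *: F (delta_mx 0 i).

Lemma lin_linear {a} {V : lmodType R} (F : {linear 'rV[R]_a -> V}) : lin F.
Proof.
move=> v; rewrite {1}(row_sum_delta v) linear_sum.
by apply: eq_bigr => i _; rewrite linearZ.
Qed.

Lemma lin_linearP {a} {V : lmodType R} (F : 'rV[R]_a -> V) : lin F <-> linear F.
Proof.
split=> [FL k u v|FL].
  rewrite FL (FL u) (FL v) scaler_sumr -big_split; apply: eq_bigr => i _ /=.
  by rewrite !mxE scalerDl scalerA.
pose lM := GRing.isLinear.Build _ _ _ _ _ FL.
pose L : {linear 'rV[R]_a -> V} := HB.pack F lM.
exact: (lin_linear L).
Qed.

Lemma lin_comp {a b} {V : lmodType R} (F : 'rV[R]_b -> V) (A : 'M[R]_(a, b)) :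
  lin F -> lin (fun v => F (v *m A)).
Proof.
move=> /lin_linearP FL; apply/lin_linearP => k u v.
by rewrite mulmxDl -scalemxAl FL.
Qed.

Lemma bilinP {a b} {V : lmodType R} (T : 'rV[R]_a -> 'rV[R]_b -> V) :
  (forall w, lin (T^~ w)) -> (forall v, lin (T v)) -> bilin T.
Proof.
move=> T1 T2 v w; rewrite (T1 w v); apply: eq_bigr => i _.
rewrite (T2 _ w) scaler_sumr; apply: eq_bigr => j _.
by rewrite scalerA !mxE big_ord1 !mxE.
Qed.

Lemma bilin_mul {a b c} (F : 'rV[R]_a -> 'M[R]_(b, c)) :
  lin F -> bilin (fun v w => w *m F v).
Proof.
move=> FL; apply: bilinP => [w|v].
  move=> v; rewrite FL mulmx_sumr; apply: eq_bigr => i _.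
  by rewrite -scalemxAr.
by apply/lin_linearP => k u w; rewrite mulmxDl -scalemxAl.
Qed.

Lemma gtrDl {a b} {V : lmodType R} (P Q : 'M[R]_(a, b))
    (T : 'rV[R]_a -> 'rV[R]_b -> V) : gtr (P + Q) T = gtr P T + gtr Q T.
Proof.
rewrite -big_split; apply: eq_bigr => i _; rewrite -big_split.
by apply: eq_bigr => j _; rewrite mxE scalerDl.
Qed.

Lemma gtrZl {a b} {V : lmodType R} k (P : 'M[R]_(a, b))
    (T : 'rV[R]_a -> 'rV[R]_b -> V) : gtr (k *: P) T = k *: gtr P T.
Proof.
rewrite scaler_sumr; apply: eq_bigr => i _; rewrite scaler_sumr.
by apply: eq_bigr => j _; rewrite mxE scalerA.
Qed.

Lemma gtrNl {a b} {V : lmodType R} (P : 'M[R]_(a, b))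
    (T : 'rV[R]_a -> 'rV[R]_b -> V) : gtr (- P) T = - gtr P T.
Proof. by rewrite -[- P]scaleN1r gtrZl scaleN1r. Qed.

Lemma gtr_suml {a b} {V : lmodType R} {I : Type} (s : seq I) (P : I -> 'M[R]_(a, b))
    (T : 'rV[R]_a -> 'rV[R]_b -> V) :
  gtr (\sum_(i <- s) P i) T = \sum_(i <- s) gtr (P i) T.
Proof.
elim: s => [|i s IH]; last by rewrite !big_cons gtrDl IH.
by rewrite !big_nil -(scale0r 0) gtrZl scale0r.
Qed.

Lemma gtrDr {a b} {V : lmodType R} (P : 'M[R]_(a, b))
    (T S : 'rV[R]_a -> 'rV[R]_b -> V) :
  gtr P (fun v w => T v w + S v w) = gtr P T + gtr P S.
Proof.
rewrite -big_split; apply: eq_bigr => i _; rewrite -big_split.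
by apply: eq_bigr => j _; rewrite scalerDr.
Qed.

Lemma gtrZr {a b} {V : lmodType R} k (P : 'M[R]_(a, b))
    (T : 'rV[R]_a -> 'rV[R]_b -> V) : gtr P (fun v w => k *: T v w) = k *: gtr P T.
Proof.
rewrite scaler_sumr; apply: eq_bigr => i _; rewrite scaler_sumr.
by apply: eq_bigr => j _; rewrite !scalerA mulrC.
Qed.

Lemma gtrNr {a b} {V : lmodType R} (P : 'M[R]_(a, b))
    (T : 'rV[R]_a -> 'rV[R]_b -> V) : gtr P (fun v w => - T v w) = - gtr P T.
Proof.
rewrite -scaleN1r -gtrZr; apply: eq_bigr => i _; apply: eq_bigr => j _.
by rewrite scaleN1r.
Qed.

Lemma eq_gtr {a b} {V : lmodType R} (P : 'M[R]_(a, b))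
    (T S : 'rV[R]_a -> 'rV[R]_b -> V) : (forall v w, T v w = S v w) ->
  gtr P T = gtr P S.
Proof.
by move=> TS; apply: eq_bigr => i _; apply: eq_bigr => j _; rewrite TS.
Qed.

Lemma gtr_mulmx {a b c e} (P : 'M[R]_(a, b)) (C : 'M[R]_(c, e))
    (T : 'rV[R]_a -> 'rV[R]_b -> 'rV[R]_c) :
  gtr P (fun v w => T v w *m C) = gtr P T *m C.
Proof.
rewrite mulmx_suml; apply: eq_bigr => i _; rewrite mulmx_suml.
by apply: eq_bigr => j _; rewrite scalemxAl.
Qed.

Lemma gtr_tr {a b} {V : lmodType R} (P : 'M[R]_(a, b))
    (T : 'rV[R]_b -> 'rV[R]_a -> V) : gtr P (fun v w => T w v) = gtr P^T T.
Proof.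
rewrite [LHS]exchange_big; apply: eq_bigr => j _; apply: eq_bigr => i _.
by rewrite mxE.
Qed.

Lemma gtr_skew {a} {V : lmodType R} (P : 'M[R]_a) (T : 'rV[R]_a -> 'rV[R]_a -> V) :
  P^T = - P -> (forall v w, T v w = T w v) -> gtr P T = 0.
Proof.
move=> PN TS; have H : gtr P T = - gtr P T.
  by rewrite -gtrNl -PN -gtr_tr; apply: eq_gtr.
have : gtr P T + gtr P T = 0 by rewrite {1}H addNr.
rewrite -mulr2n => /eqP; rewrite -scaler_nat scaler_eq0 pnatr_eq0 /=.
by move/eqP.
Qed.

(** Naturality of the contraction: linear substitutions in the arguments act on the bivector. This
    is what moves traces between the domain and the target of a map. *)
Lemma gtr_push {a b c e} {V : lmodType R} (P : 'M[R]_(a, b)) (A : 'M[R]_(a, c))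
    (B : 'M[R]_(b, e)) (T : 'rV[R]_c -> 'rV[R]_e -> V) : bilin T ->
  gtr P (fun v w => T (v *m A) (w *m B)) = gtr (A^T *m P *m B) T.
Proof.
move=> TB; rewrite {1}/gtr.
under eq_bigr => i _ do under eq_bigr => j _ do rewrite TB -gtrZl.
under eq_bigr do rewrite -gtr_suml.
rewrite -gtr_suml; congr gtr; apply/matrixP => k l.
rewrite summxE [RHS]mxE; under eq_bigr do rewrite summxE.
under [RHS]eq_bigr => j _ do rewrite mxE mulr_suml.
rewrite [RHS]exchange_big; apply: eq_bigr => i _; apply: eq_bigr => j _.
by rewrite -!rowE !mxE big_ord1 !mxE; ring.
Qed.

Lemma gtr_push1 {a b c} {V : lmodType R} (P : 'M[R]_(a, b)) (A : 'M[R]_(a, c))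
    (T : 'rV[R]_c -> 'rV[R]_b -> V) : bilin T ->
  gtr P (fun v w => T (v *m A) w) = gtr (A^T *m P) T.
Proof.
move=> TB; rewrite -[in RHS](mulmx1 (A^T *m P)) -gtr_push //.
by apply: eq_gtr => v w; rewrite mulmx1.
Qed.

Lemma gtr_push2 {a b e} {V : lmodType R} (P : 'M[R]_(a, b)) (B : 'M[R]_(b, e))
    (T : 'rV[R]_a -> 'rV[R]_e -> V) : bilin T ->
  gtr P (fun v w => T v (w *m B)) = gtr (P *m B) T.
Proof.
move=> TB; rewrite -[in RHS](mul1mx P) -[X in X *m P]trmx1 -gtr_push //.
by apply: eq_gtr => v w; rewrite mulmx1.
Qed.

Lemma form_entry {a b} (A : 'M[R]_(a, b)) i j :
  ((delta_mx 0 i : 'rV_a) *m A *m (delta_mx 0 j : 'rV_b)^T) 0 0 = A i j :> R.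
Proof. by rewrite trmx_delta -colE -rowE !mxE. Qed.

Lemma gtr_bil {a b} {V : lmodType R} (P : 'M[R]_(a, b)) (A : 'M[R]_(a, b)) (Z : V) :
  gtr P (fun v w => (v *m A *m w^T) 0 0 *: Z) = \tr (P *m A^T) *: Z.
Proof.
rewrite /mxtrace scaler_suml; apply: eq_bigr => i _.
rewrite mxE scaler_suml; apply: eq_bigr => j _.
by rewrite scalerA form_entry [A^T _ _]mxE.
Qed.

(** Contracting with a covector raises its index; for the inverse metric and eta the result is
    evaluation at xi. *)
Lemma gtr_col {a b} {V : lmodType R} (P : 'M[R]_(a, b)) (E : 'cV[R]_a)
    (F : 'rV[R]_b -> V) : lin F ->
  gtr P (fun v w => (v *m E) 0 0 *: F w) = F (E^T *m P).
Proof.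
move=> FL; rewrite FL /gtr exchange_big; apply: eq_bigr => j _.
rewrite mxE scaler_suml; apply: eq_bigr => i _.
by rewrite scalerA -rowE !mxE mulrC.
Qed.

End Contraction.

(* The Christoffel matrices of a metric G with first derivatives dG: the row
   [w *m chr dG G v] is the connection term of nabla_v w. *)
HB.lock Definition chr {R : realFieldType} {d} (dG : 'rV[R]_d -> 'M[R]_d) (G : 'M[R]_d) (v : 'rV[R]_d) : 'M[R]_d :=
  (2^-1 *: \matrix_(i, l) (dG v i l + (v *m dG (delta_mx 0 i)) 0 l
                           - (v *m dG (delta_mx 0 l)) 0 i)) *m invmx G.

(** * Covariant derivatives of matrices and uniqueness of the Levi-Civita connection *)

Section Covariant.
Context {R : realFieldType}.

(** The covariant derivative of a matrix field whose row index is transported by [K1] and column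
    index by [K2]. Vectors are rows with [K1] = 0, covectors are columns with [K2] = 0, and bilinear
    forms take minus the transpose on the column side; so one Leibniz rule serves all tensors. *)
Definition cov {a b} (K1 : 'M[R]_a) (K2 : 'M[R]_b) (dA A : 'M[R]_(a, b)) :
  'M[R]_(a, b) := dA - K1 *m A + A *m K2.

Lemma cov_mul {a b c} (K1 : 'M[R]_a) (K2 : 'M[R]_b) (K3 : 'M[R]_c) dA A dB B :
  cov K1 K3 (dA *m B + A *m dB) (A *m B)
  = cov K1 K2 dA A *m B + A *m cov K2 K3 dB B.
Proof.
rewrite /cov !mulmxDl !mulmxDr mulmxN mulNmx !mulmxA.
mx_ring.
Qed.

Lemma cov_tr {a b} (K1 : 'M[R]_a) (K2 : 'M[R]_b) dA A :
  (cov K1 K2 dA A)^T = cov (- K2^T) (- K1^T) dA^T A^T.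
Proof. by rewrite /cov !linearD /= linearN /= !trmx_mul mulNmx opprK mulmxN addrAC. Qed.

Lemma covD {a b} (K1 : 'M[R]_a) (K2 : 'M[R]_b) dA A dB B :
  cov K1 K2 (dA + dB) (A + B) = cov K1 K2 dA A + cov K1 K2 dB B.
Proof. rewrite /cov mulmxDr mulmxDl; mx_ring. Qed.

Lemma covZ {a b} (K1 : 'M[R]_a) (K2 : 'M[R]_b) k dk dA (A : 'M[R]_(a, b)) :
  cov K1 K2 (dk *: A + k *: dA) (k *: A) = dk *: A + k *: cov K1 K2 dA A.
Proof.
rewrite /cov -scalemxAr -scalemxAl; mx_ring.
Qed.

Lemma cov1 {a} (K : 'M[R]_a) : cov K K 0 1%:M = 0.
Proof. by rewrite /cov mulmx1 mul1mx sub0r addNr. Qed.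

Section Chr.
Context {d : nat} (dG : 'rV[R]_d -> 'M[R]_d) (G : 'M[R]_d).
Context (dG_lin : lin dG) (dG_sym : forall v, (dG v)^T = dG v).
Context (G_sym : G^T = G) (G_unit : G \in unitmx).

Let chrG v : chr dG G v *m G
  = 2^-1 *: \matrix_(i, l) (dG v i l + (v *m dG (delta_mx 0 i)) 0 l
                           - (v *m dG (delta_mx 0 l)) 0 i).
Proof. by rewrite chr.unlock mulmxKV. Qed.

Let dG_l (v w : 'rV[R]_d) l : (w *m dG v) 0 l = \sum_i v 0 i * (w *m dG (delta_mx 0 i)) 0 l.
Proof.
rewrite dG_lin mulmx_sumr summxE; apply: eq_bigr => i _.
by rewrite -scalemxAr mxE.
Qed.

Lemma chr_lin : lin (chr dG G).
Proof.
have dGl := (lin_linearP dG).1 dG_lin.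
apply/lin_linearP => k u v; rewrite chr.unlock scalemxAl -mulmxDl scalerA mulrC -scalerA.
rewrite -scalerDr; congr (_ *: _ *m _); apply/matrixP => i l.
by rewrite addmxE scalemxE ![(\matrix_(_, _) _) _ _]mxE dGl !mulmxDl -!scalemxAl;
  mx_entries; ring.
Qed.

Let chr_form u z : u *m (chr dG G z *m G) = 2^-1 *: \row_l ((u *m dG z) 0 l
    + (z *m dG u) 0 l - (z *m dG (delta_mx 0 l) *m u^T) 0 0).
Proof.
rewrite chrG -scalemxAr; congr (_ *: _); apply/rowP => l; rewrite mxE.
under eq_bigr do rewrite mxE mulrBr mulrDr.
rewrite sumrB big_split /= [RHS]mxE; congr (_ + _ - _).
- by rewrite mxE.
- by rewrite dG_l.
- by rewrite [RHS]mxE; apply: eq_bigr => j _; rewrite [u^T _ _]mxE mulrC.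
Qed.

Lemma chrE v w : w *m chr dG G v = (\row_l (2^-1 * ((w *m dG v) 0 l
    + (v *m dG w) 0 l - (v *m dG (delta_mx 0 l) *m w^T) 0 0))) *m invmx G.
Proof.
apply: (can_inj (mulmxK G_unit)); rewrite mulmxKV // -[LHS]mulmxA chr_form.
by apply/rowP => l; rewrite scalemxE ![(\row_(_ < d) _) _ _]mxE.
Qed.

Lemma chr_sym v w : w *m chr dG G v = v *m chr dG G w.
Proof.
suff H : w *m (chr dG G v *m G) = v *m (chr dG G w *m G).
  by apply: (can_inj (mulmxK G_unit)); rewrite -[LHS]mulmxA -[RHS]mulmxA.
rewrite !chr_form; congr (_ *: _); apply/rowP => l.
rewrite ![(\row_(_ < d) _) _ _]mxE [X in X - _]addrC; congr (_ - _).
have <- : (v *m dG (delta_mx 0 l) *m w^T)^T = v *m dG (delta_mx 0 l) *m w^T.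
  by rewrite [X in X^T]mx11_scalar tr_scalar_mx -mx11_scalar.
by rewrite !trmx_mul dG_sym trmxK mulmxA.
Qed.

Lemma chr_metric v : dG v = chr dG G v *m G + G *m (chr dG G v)^T.
Proof.
have -> : G *m (chr dG G v)^T = (chr dG G v *m G)^T by rewrite [RHS]trmx_mul G_sym.
rewrite chrG; apply/matrixP => i l; rewrite addmxE [in RHS]mxE [X in _ + X]mxE.
rewrite !scalemxE ![(\matrix_(_, _) _) _ _]mxE.
have -> : dG v l i = dG v i l by rewrite -[in LHS]dG_sym mxE.
by field.
Qed.

(** The difference of two symmetric metric families is a trilinear form, symmetric in its first two
    and skew in its last two arguments. Permuting the arguments around gives S = - S. *)
Lemma chr_unique (K : 'rV[R]_d -> 'M[R]_d) :
  (forall v w, w *m K v = v *m K w) ->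
  (forall v, dG v = K v *m G + G *m (K v)^T) -> forall v, K v = chr dG G v.
Proof.
move=> Ks Km v; apply/eqP; rewrite -subr_eq0.
pose A u := K u - chr dG G u.
have As u w : w *m A u = u *m A w by rewrite !mulmxBr Ks chr_sym.
have Am u : A u *m G = - (G *m (A u)^T).
  apply/eqP; rewrite -addr_eq0 linearB /= mulmxBl mulmxBr addrACA -opprD.
  by rewrite -Km -chr_metric subrr.
pose S (u w z : 'rV[R]_d) : R := (w *m A u *m G *m z^T) 0 0.
have S1 u w z : S u w z = S w u z by rewrite /S As.
have S2 u w z : S u w z = - S u z w.
  rewrite /S -!mulmxA (mulmxA (A u)) Am mulNmx mulmxN mxE.
  congr (- _).
  have <- : (w *m (G *m (A u)^T *m z^T))^T = w *m (G *m (A u)^T *m z^T).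
    by rewrite [X in X^T]mx11_scalar tr_scalar_mx -mx11_scalar.
  by rewrite !trmx_mul !trmxK G_sym !mulmxA.
have S0 u w z : S u w z = 0.
  have : S u w z = - S u w z.
    by rewrite {1}S2 S1 S2 opprK S1 S2 S1.
  lra.
rewrite -[K v - _]/(A v) -(inj_eq (can_inj (mulmxK G_unit))) mul0mx.
apply/eqP/matrixP => i l; have := S0 v (delta_mx 0 i) (delta_mx 0 l).
by rewrite /S -(mulmxA _ (A v) G) form_entry zeromxE.
Qed.

End Chr.

End Covariant.

(** * Derivatives of products, transposes, determinants and inverses of matrices *)

Section MatrixCalculus.
Context {R : realType}.

Lemma near_eq_differentiable {V W : normedModType R} (f g : V -> W) x :
  {near x, f =1 g} -> differentiable f x -> differentiable g x.
Proof.
move=> fg fd; apply: (@differentiable_of_approx _ V W g ('d f x)).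
  exact: diff_continuous.
move=> e e0; have := diff_locally fd => /eqaddoP/(_ e e0) H.
have fg' : \forall h \near (0 : V), f (h + x) = g (h + x).
  by move: fg; rewrite (near_shift 0); apply: filterS => h /=; rewrite subr0.
near=> h; rewrite -(nbhs_singleton fg) -(near fg' h) //.
have : `|(f \o shift x - (cst (f x) + 'd f x)) h| <= e * `|h| by near: h.
by rewrite -[(_ - _) h]/(f (h + x) - (f x + 'd f x h)) opprD addrA.
Unshelve. all: by end_near. Qed.

Lemma lin_derive {d} {W : normedModType R} (F : 'rV[R]_d -> W) x :
  differentiable F x -> lin (fun v => 'D_v F x).
Proof. by move=> Fd v; exact: derive_sum_row. Qed.

Lemma differentiable_mulmx {V : normedModType R} {m n p} (A : V -> 'M[R]_(m, n))
    (B : V -> 'M[R]_(n, p)) x : differentiable A x -> differentiable B x ->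
  differentiable (fun y => A y *m B y) x.
Proof.
move=> Ad Bd; apply: differentiable_mx => i k.
have -> : (fun y => (A y *m B y) i k)
    = \sum_j ((fun y => A y i j : R) * (fun y => B y j k : R)).
  by apply/funext => y; rewrite mxE fct_sumE.
apply: differentiable_sum => j.
by apply: differentiableM; exact: differentiable_entry.
Qed.

Lemma derive_mulmx {V : normedModType R} {m n p} (A : V -> 'M[R]_(m, n))
    (B : V -> 'M[R]_(n, p)) x v : differentiable A x -> differentiable B x ->
  'D_v (fun y => A y *m B y) x = 'D_v A x *m B x + A x *m 'D_v B x.
Proof.
move=> Ad Bd; apply/matrixP => i k.
rewrite derive_entry; last exact/diff_derivable/differentiable_mulmx.
have -> : (fun y => (A y *m B y) i k)
    = \sum_j ((fun y => A y i j : R) * (fun y => B y j k : R)).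
  by apply/funext => y; rewrite mxE fct_sumE.
have Ae j : derivable (fun y => A y i j : R) x v.
  exact/diff_derivable/differentiable_entry.
have Be j : derivable (fun y => B y j k : R) x v.
  exact/diff_derivable/differentiable_entry.
rewrite derive_sum; last by move=> j; exact: derivableM.
rewrite addmxE ![(_ *m _) _ _]mxE -big_split; apply: eq_bigr => j _ /=.
rewrite deriveM // (derive_entry i j (diff_derivable Ad)).
rewrite (derive_entry j k (diff_derivable Bd)) addrC; congr (_ + _).
by rewrite mulrC.
Qed.

Lemma differentiable_tr {V : normedModType R} {m n} (A : V -> 'M[R]_(m, n)) x :
  differentiable A x -> differentiable (fun y => (A y)^T) x.
Proof.
move=> Ad; apply: differentiable_mx => i j; under eq_fun do rewrite mxE.
exact: differentiable_entry.
Qed.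

Lemma derive_tr {V : normedModType R} {m n} (A : V -> 'M[R]_(m, n)) x v :
  differentiable A x -> 'D_v (fun y => (A y)^T) x = ('D_v A x)^T.
Proof.
move=> Ad; apply/matrixP => i j.
rewrite derive_entry; last exact/diff_derivable/differentiable_tr.
under eq_fun do rewrite mxE.
by rewrite mxE derive_entry //; exact: diff_derivable.
Qed.

Lemma differentiable_det {V : normedModType R} {n} (A : V -> 'M[R]_n) x :
  differentiable A x -> differentiable (fun y => \det (A y)) x.
Proof.
move=> Ad; have -> : (fun y => \det (A y)) = \sum_(s : 'S_n)
    (fun y => (-1) ^+ s * \prod_i A y i (s i)).
  by apply/funext => y; rewrite fct_sumE.
elim/big_ind : _ => [|f g fd gd|s _]; first exact: differentiable_cst.
  exact: differentiableD.
apply: differentiableM; first exact: differentiable_cst.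
elim: (index_enum _) => [|i r IH].
  by under eq_fun do rewrite big_nil; exact: differentiable_cst.
under eq_fun do rewrite big_cons.
by apply: differentiableM; [exact: differentiable_entry|].
Qed.

Lemma differentiable_invmx {V : normedModType R} {n} (A : V -> 'M[R]_n) x :
  differentiable A x -> (\forall y \near x, A y \in unitmx) ->
  differentiable (fun y => invmx (A y)) x.
Proof.
move=> Ad Au.
have E : {near x, (fun y => (\det (A y))^-1 *: \adj (A y)) =1 (fun y => invmx (A y))}.
  by apply: filterS Au => y; rewrite /invmx => ->.
have detx : \det (A x) != 0 by have := nbhs_singleton Au; rewrite unitmxE unitfE.
have D : differentiable (fun y => (\det (A y))^-1 *: \adj (A y)) x.
  apply: differentiable_mx => i j; under eq_fun do rewrite !mxE.
  apply: differentiableM.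
    by apply: differentiableV => //; exact: differentiable_det.
  apply: differentiableM; first exact: differentiable_cst.
  apply: differentiable_det; apply: differentiable_mx => k l.
  by under eq_fun do rewrite !mxE; exact: differentiable_entry.
exact: near_eq_differentiable E D.
Qed.

Lemma derive_invmx {V : normedModType R} {n} (A : V -> 'M[R]_n) x v :
  differentiable A x -> (\forall y \near x, A y \in unitmx) ->
  'D_v (fun y => invmx (A y)) x = - (invmx (A x) *m 'D_v A x *m invmx (A x)).
Proof.
move=> Ad Au; have Ax := nbhs_singleton Au.
have Id := differentiable_invmx Ad Au.
have E : 'D_v (fun y => A y *m invmx (A y)) x = 0.
  rewrite -(derive_cst (1%:M : 'M[R]_n) x v); apply: near_eq_derive.
  by apply: filterS Au => y Ay; rewrite mulmxV.
rewrite derive_mulmx // in E.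
apply: (can_inj (mulKmx Ax)); rewrite mulmxN !mulmxA mulmxV // mul1mx.
by apply/eqP; rewrite -addr_eq0 addrC; apply/eqP.
Qed.

End MatrixCalculus.

(* Locked versions of the directional derivative and of the Jacobian matrix:
   unfolding limits makes unification diverge. *)
HB.lock Definition der {R : realType} {V W : normedModType R} (F : V -> W)
  (x v : V) : W := 'D_v F x.
HB.lock Definition jac {R : realType} {a b : nat} (F : 'rV[R]_a -> 'rV[R]_b)
  (x : 'rV[R]_a) : 'M[R]_(a, b) := jacobian F x.

Lemma derE {R : realType} {V W : normedModType R} (F : V -> W) x v :
  der F x v = 'D_v F x.
Proof. by rewrite der.unlock. Qed.

Section LockedDerivative.
Context {R : realType} {V : normedModType R}.

Lemma der_near {W : normedModType R} (F G : V -> W) x v :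
  (\forall y \near x, F y = G y) -> der F x v = der G x v.
Proof. by rewrite !derE; exact: near_eq_derive. Qed.

Lemma der_cst {W : normedModType R} (c : W) (x v : V) : der (fun=> c) x v = 0.
Proof. by rewrite derE derive_cst. Qed.

Lemma der_comp {W Z : normedModType R} (F : W -> Z) (G : V -> W) x v :
  differentiable G x -> differentiable F (G x) ->
  der (F \o G) x v = der F (G x) (der G x v).
Proof. by move=> Gd Fd; rewrite !derE derive_comp. Qed.

Lemma der_mulmx {m n p} (A : V -> 'M[R]_(m, n)) (B : V -> 'M[R]_(n, p)) x v :
  differentiable A x -> differentiable B x ->
  der (fun y => A y *m B y) x v = der A x v *m B x + A x *m der B x v.
Proof. by rewrite !derE; exact: derive_mulmx. Qed.

Lemma der_tr {m n} (A : V -> 'M[R]_(m, n)) x v : differentiable A x ->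
  der (fun y => (A y)^T) x v = (der A x v)^T.
Proof. by rewrite !derE; exact: derive_tr. Qed.

Lemma der_invmx {n} (A : V -> 'M[R]_n) x v :
  differentiable A x -> (\forall y \near x, A y \in unitmx) ->
  der (fun y => invmx (A y)) x v = - (invmx (A x) *m der A x v *m invmx (A x)).
Proof. by rewrite !derE; exact: derive_invmx. Qed.

Lemma der_entry {m n} (F : V -> 'M[R]_(m, n)) x v i j :
  differentiable F x -> (der F x v) i j = der (fun y => F y i j) x v.
Proof. by move=> Fd; rewrite !derE; exact/derive_entry/diff_derivable. Qed.

Lemma derD {W : normedModType R} (F G : V -> W) x v : differentiable F x ->
  differentiable G x -> der (fun y => F y + G y) x v = der F x v + der G x v.
Proof.
by move=> Fd Gd; rewrite !derE; apply: deriveD; exact: diff_derivable.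
Qed.

Lemma derN {W : normedModType R} (F : V -> W) x v : differentiable F x ->
  der (fun y => - F y) x v = - der F x v.
Proof. by move=> Fd; rewrite !derE; apply: deriveN; exact: diff_derivable. Qed.

End LockedDerivative.

Lemma lin_der {R : realType} {d} {W : normedModType R} (F : 'rV[R]_d -> W) x :
  differentiable F x -> lin (der F x).
Proof. by move=> /lin_derive H v; rewrite derE H; apply: eq_bigr => i _; rewrite derE. Qed.

(** * Charts and the Levi-Civita connection *)

Section Jacobian.
Context {R : realType}.

Lemma der_jac {a b} (F : 'rV[R]_a -> 'rV[R]_b) x v :
  differentiable F x -> der F x v = v *m jac F x.
Proof. by rewrite derE jac.unlock; exact: deriveEjacobian. Qed.

Lemma jac_entry {a b} (F : 'rV[R]_a -> 'rV[R]_b) x i j :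
  differentiable F x -> jac F x i j = (der F x (delta_mx 0 i)) 0 j.
Proof. by move=> Fd; rewrite der_jac // -rowE mxE. Qed.

Lemma eq_jac {a b} (F : 'rV[R]_a -> 'rV[R]_b) x A : differentiable F x ->
  (forall v, der F x v = v *m A) -> jac F x = A.
Proof.
move=> Fd FA; apply/row_matrixP => i; rewrite [LHS]rowE [RHS]rowE -FA.
by rewrite der_jac.
Qed.

Lemma jac_comp {a b c} (F : 'rV[R]_b -> 'rV[R]_c) (G : 'rV[R]_a -> 'rV[R]_b) x :
  differentiable G x -> differentiable F (G x) ->
  jac (F \o G) x = jac G x *m jac F (G x).
Proof.
move=> Gd Fd; apply: eq_jac => [|v]; first exact: differentiable_comp.
by rewrite der_comp // (der_jac _ Gd) (der_jac _ Fd) mulmxA.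
Qed.

Lemma near_eq_jac {a b} (F G : 'rV[R]_a -> 'rV[R]_b) x :
  {near x, F =1 G} -> differentiable F x -> jac F x = jac G x.
Proof.
move=> FG Fd; apply: eq_jac => // v; rewrite (der_near v FG) der_jac //.
exact: near_eq_differentiable FG Fd.
Qed.

Lemma jac_id {a} (x : 'rV[R]_a) : jac id x = 1%:M.
Proof. by apply: eq_jac => // v; rewrite derE derive_id mulmx1. Qed.

Lemma smooth_on_jac {a b} (U : set 'rV[R]_a) (F : 'rV[R]_a -> 'rV[R]_b) :
  open U -> smooth_on U F -> smooth_on U (jac F).
Proof.
move=> Uo Fs; apply: smooth_on_mx => // i j.
apply: (@smooth_on_ext _ _ _ _ (fun x => ('D_(delta_mx 0 i) F x) 0 j)) => //.
  move=> x Ux; rewrite jac_entry ?derE //.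
  exact: (smooth_on_differentiable Uo Fs Ux).
exact: (@smooth_on_entry _ _ _ _ _ ('D_(delta_mx 0 i) F) 0 j Uo (smooth_on_derive _ Fs)).
Qed.

(** The matrix form of Clairaut's theorem: the derivative of the Jacobian is the Hessian. *)
Lemma der_jac_sym {a b} (U : set 'rV[R]_a) (F : 'rV[R]_a -> 'rV[R]_b) x v w :
  open U -> smooth_on U F -> U x -> w *m der (jac F) x v = v *m der (jac F) x w.
Proof.
move=> Uo Fs Ux.
have Jd := smooth_on_differentiable Uo (smooth_on_jac Uo Fs) Ux.
have H u z : u *m der (jac F) x z = 'D_z ('D_u F) x.
  rewrite -[RHS]derE.
  have -> : der ('D_u F) x z = der (fun y => u *m jac F y) x z.
    apply: der_near; apply: (near_open Uo Ux) => y Uy; rewrite -derE.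
    exact: der_jac (smooth_on_differentiable Uo Fs Uy).
  by rewrite (der_mulmx _ (differentiable_cst u x) Jd) der_cst mul0mx add0r.
by rewrite !H (smooth_on_clairaut _ _ Uo Fs Ux).
Qed.

End Jacobian.

(** * Changes of charts *)

Section Charts.
Context {R : realType} {d : nat} (M : manifold R d).
Implicit Types p q r : M.

Lemma ichart_dom p x : (chart p @` cdom p) x ->
  cdom p (ichart p x) /\ chart p (ichart p x) = x.
Proof. by move=> [q pq <-]; rewrite chartK. Qed.

Lemma chart_image_open p (U : set M) : open U -> open (chart p @` (U `&` cdom p)).
Proof.
move=> Uo; rewrite openE => _ [q [Uq pq] <-]; rewrite /interior.
have Ip : (chart p @` cdom p) (chart p q) by exists q.
have : \forall x \near chart p q, (chart p @` cdom p) x /\ U (ichart p x).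
  apply: filterI; first by apply: open_nbhs_nbhs; split=> //; exact: chart_open.
  apply: (ichart_continuous Ip); rewrite chartK //.
  exact: open_nbhs_nbhs.
apply: filterS => x [Ix Ux]; exists (ichart p x); last by have [] := ichart_dom Ix.
by split=> //; have [] := ichart_dom Ix.
Qed.

Lemma near_chart p q (P : M -> Prop) : cdom p q ->
  (\forall r \near q, P r) -> \forall x \near chart p q, P (ichart p x).
Proof.
move=> pq Pq; have Ip : (chart p @` cdom p) (chart p q) by exists q.
by apply: (ichart_continuous Ip); rewrite chartK.
Qed.

Lemma near_ichart p q (P : 'rV[R]_d -> Prop) : cdom p q ->
  (\forall x \near chart p q, P x) -> \forall r \near q, P (chart p r).
Proof. by move=> pq Pq; exact: (chart_continuous pq). Qed.

Lemma near_cdom p q : cdom p q -> \forall r \near q, cdom p r.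
Proof. by move=> pq; apply: open_nbhs_nbhs; split=> //; exact: cdom_open. Qed.

Lemma near_chart_im p q : cdom p q ->
  \forall x \near chart p q, cdom p (ichart p x) /\ chart p (ichart p x) = x.
Proof.
move=> pq; have : open_nbhs (chart p q) (chart p @` cdom p).
  by split; [exact: chart_open|exists q].
by move/open_nbhs_nbhs; apply: filterS => x /ichart_dom.
Qed.

Lemma trans_open p q : open (chart p @` (cdom q `&` cdom p)).
Proof. by apply: chart_image_open; exact: cdom_open. Qed.

Lemma trans_smooth p q :
  smooth_on (chart p @` (cdom q `&` cdom p)) (chart q \o ichart p).
Proof. exact: manifold_smooth. Qed.

Lemma trans_differentiable p q r : cdom p r -> cdom q r ->
  differentiable (chart q \o ichart p) (chart p r).
Proof.
move=> pr qr; apply: (smooth_on_differentiable (@trans_open p q) (@trans_smooth p q)).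
by exists r.
Qed.

(** The Jacobian at r of the change from the chart of p to the chart of q: components [v] in the
    first chart become [v *m tmx p q r] in the second. *)
Definition tmx p q r : 'M[R]_d := jac (chart q \o ichart p) (chart p r).

Lemma jac_trans p q r : jac (chart q \o ichart p) (chart p r) = tmx p q r.
Proof. by []. Qed.

Lemma tmxE p q r v : cdom p r -> cdom q r ->
  der (chart q \o ichart p) (chart p r) v = v *m tmx p q r.
Proof. by move=> pr qr; exact: der_jac (trans_differentiable pr qr). Qed.

Lemma tmx_trans p q s r : cdom p r -> cdom q r -> cdom s r ->
  tmx p q r *m tmx q s r = tmx p s r.
Proof.
move=> pr qr sr; have E : (chart q \o ichart p) (chart p r) = chart q r.
  by rewrite /= chartK.
have := @jac_comp _ _ _ _ (chart s \o ichart q) (chart q \o ichart p) (chart p r).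
rewrite E => /(_ (trans_differentiable pr qr) (trans_differentiable qr sr)) <-.
apply: near_eq_jac.
  have : \forall x \near chart p r, cdom q (ichart p x).
    exact: (near_chart pr (near_cdom qr)).
  by apply: filterS => x qx /=; rewrite chartK.
apply: differentiable_comp; first exact: trans_differentiable.
by rewrite E; exact: trans_differentiable.
Qed.

Lemma tmx_id p r : cdom p r -> tmx p p r = 1%:M.
Proof.
move=> pr; rewrite -(jac_id (chart p r)); apply: near_eq_jac.
  by apply: filterS (near_chart_im pr) => x [].
exact: trans_differentiable.
Qed.

Lemma tmxK p q r : cdom p r -> cdom q r -> tmx p q r *m tmx q p r = 1%:M.
Proof. by move=> pr qr; rewrite tmx_trans // tmx_id. Qed.

Lemma cst_extE p v q : cdom p q -> cst_ext p v q = v *m tmx p q q.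
Proof. by move=> pq; rewrite /cst_ext -derE tmxE //; exact: cdom_refl. Qed.

Lemma cst_ext_id p v : cst_ext p v p = v.
Proof. by rewrite cst_extE; [rewrite tmx_id ?mulmx1 //|]; exact: cdom_refl. Qed.

Lemma coord_fieldE p (X : vfield M) q : cdom p q ->
  coord_field p X q = X q *m tmx q p q.
Proof. by move=> pq; rewrite /coord_field /dfun -derE tmxE //; exact: cdom_refl. Qed.

Lemma near_trans {W : Type} (F : M -> W) p q r : cdom p r -> cdom q r ->
  {near chart q r, (F \o ichart p) \o (chart p \o ichart q) =1 F \o ichart q}.
Proof.
move=> pr qr; have := near_chart qr (near_cdom pr).
by apply: filterS => x px /=; rewrite chartK.
Qed.

Lemma chart_derive {W : normedModType R} (F : M -> W) p q r v :
  cdom p r -> cdom q r -> differentiable (F \o ichart p) (chart p r) ->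
  der (F \o ichart q) (chart q r) v = der (F \o ichart p) (chart p r) (v *m tmx q p r).
Proof.
move=> pr qr Fd; rewrite -(der_near v (near_trans F pr qr)).
rewrite der_comp; [|exact: trans_differentiable|by rewrite /= chartK].
by rewrite tmxE //= chartK.
Qed.

Lemma dfunE {W : normedModType R} (F : M -> W) p q v :
  cdom p q -> differentiable (F \o ichart p) (chart p q) ->
  dfun F q v = der (F \o ichart p) (chart p q) (v *m tmx q p q).
Proof. by move=> pq Fd; rewrite /dfun -derE; apply: chart_derive => //; exact: cdom_refl. Qed.

Lemma dfun_der {W : normedModType R} (F : M -> W) p v :
  dfun F p v = der (F \o ichart p) (chart p p) v.
Proof. by rewrite derE. Qed.

Lemma near_dfun {W : normedModType R} (F G : M -> W) p v :
  (\forall q \near p, F q = G q) -> dfun F p v = dfun G p v.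
Proof. by move=> FG; rewrite !dfun_der; apply/der_near/(near_chart (cdom_refl p) FG). Qed.

End Charts.

Lemma posdef_unit {R : realType} {d} (G : 'M[R]_d) :
  (forall v, v != 0 -> 0 < bil G v v) -> G \in unitmx.
Proof.
move=> Gp; rewrite -row_free_unit -kermx_eq0; apply/eqP/row_matrixP => i.
rewrite row0; apply/eqP/negPn/negP => ki.
have := Gp _ ki; rewrite /bil -row_mul mulmx_ker row0 mul0mx zeromxE.
by rewrite ltxx.
Qed.

Lemma gmetE {R : realType} {d} (M : riemannian R d) (p : M) v w :
  gmet p v w = (v *m met p *m w^T) 0 0.
Proof. by []. Qed.

Lemma met_unit {R : realType} {d} (M : riemannian R d) (p : M) : met p \in unitmx.
Proof. by apply: posdef_unit; exact: met_pos. Qed.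

(** * Tensor fields in a fixed chart *)

Section LocalTensors.
Context {R : realType} {d : nat} (M : manifold R d).
Implicit Types (p q r : M) (A : M -> 'M[R]_d) (X : vfield M).

(* Components in the fixed chart [chart p] of an endomorphism field (hate), of
   covectors (columns, hatc), of vectors (rows, hatv) and of a bilinear form (hatb). *)
Definition hate A p x := let q := ichart p x in tmx p q q *m A q *m tmx q p q.
Definition hatc {n} (E : M -> 'M[R]_(d, n)) p x :=
  let q := ichart p x in tmx p q q *m E q.
Definition hatv {n} (X : M -> 'M[R]_(n, d)) p x :=
  let q := ichart p x in X q *m tmx q p q.
Definition hatb A p x := let q := ichart p x in tmx p q q *m A q *m (tmx p q q)^T.

Lemma hateE A p q : cdom p q -> hate A p (chart p q) = tmx p q q *m A q *m tmx q p q.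
Proof. by move=> pq; rewrite /hate chartK. Qed.

Lemma hatcE {n} (E : M -> 'M[R]_(d, n)) p q : cdom p q ->
  hatc E p (chart p q) = tmx p q q *m E q.
Proof. by move=> pq; rewrite /hatc chartK. Qed.

Lemma hatvE {n} (X : M -> 'M[R]_(n, d)) p q : cdom p q ->
  hatv X p (chart p q) = X q *m tmx q p q.
Proof. by move=> pq; rewrite /hatv chartK. Qed.

Lemma hatbE A p q : cdom p q -> hatb A p (chart p q) = tmx p q q *m A q *m (tmx p q q)^T.
Proof. by move=> pq; rewrite /hatb chartK. Qed.

Lemma hate_id A p : hate A p (chart p p) = A p.
Proof. by rewrite hateE ?tmx_id ?mul1mx ?mulmx1 //; exact: cdom_refl. Qed.

Lemma hatc_id {n} (E : M -> 'M[R]_(d, n)) p : hatc E p (chart p p) = E p.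
Proof. by rewrite hatcE ?tmx_id ?mul1mx //; exact: cdom_refl. Qed.

Lemma hatv_id {n} (X : M -> 'M[R]_(n, d)) p : hatv X p (chart p p) = X p.
Proof. by rewrite hatvE ?tmx_id ?mulmx1 //; exact: cdom_refl. Qed.

Lemma hatb_id A p : hatb A p (chart p p) = A p.
Proof. by rewrite hatbE ?tmx_id ?trmx1 ?mul1mx ?mulmx1 //; exact: cdom_refl. Qed.

Lemma hate_trans A p q r : cdom p r -> cdom q r ->
  hate A q (chart q r) *m tmx q p r = tmx q p r *m hate A p (chart p r).
Proof.
move=> pr qr; have rr := cdom_refl r.
rewrite hateE // hateE // -[LHS]mulmxA (tmx_trans rr qr pr).
by rewrite !mulmxA (tmx_trans qr pr rr).
Qed.

Lemma hatc_trans {n} (E : M -> 'M[R]_(d, n)) p q r : cdom p r -> cdom q r ->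
  hatc E q (chart q r) = tmx q p r *m hatc E p (chart p r).
Proof.
move=> pr qr; have rr := cdom_refl r.
by rewrite hatcE // hatcE // mulmxA (tmx_trans qr pr rr).
Qed.

Lemma hatb_trans A p q r : cdom p r -> cdom q r ->
  hatb A q (chart q r) = tmx q p r *m hatb A p (chart p r) *m (tmx q p r)^T.
Proof.
move=> pr qr; have rr := cdom_refl r.
rewrite hatbE // hatbE // -[in LHS](tmx_trans qr pr rr) trmx_mul.
by rewrite !mulmxA.
Qed.

Lemma near_hat p r (P : M -> Prop) (Q : 'rV[R]_d -> Prop) : cdom p r ->
  (\forall q \near r, P q) ->
  (forall q, cdom p q -> P q -> Q (chart p q)) -> \forall x \near chart p r, Q x.
Proof.
move=> pr Pr PQ; apply: filterS2 (near_chart pr Pr) (near_chart_im pr) => x Px [xp <-].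
exact: PQ.
Qed.

Lemma near_hat_all p (Q : 'rV[R]_d -> Prop) :
  (forall q, cdom p q -> Q (chart p q)) -> \forall x \near chart p p, Q x.
Proof.
move=> H; apply: filterS (near_chart_im (cdom_refl p)) => x [px <-].
exact: H.
Qed.

Lemma chart_dom_open p : open (chart p @` cdom p).
Proof. exact: chart_open. Qed.

Lemma hate_smooth A p : smooth_endo A -> smooth_on (chart p @` cdom p) (hate A p).
Proof.
move=> As; apply: smooth_on_mx => [|i j]; first exact: chart_open.
have := As p (delta_mx 0 i) p p; rewrite !setIid => H.
apply: (@smooth_on_ext _ _ _ _ (fun x =>
  (coord_field p (app_endo A (cst_ext p (delta_mx 0 i))) \o ichart p) x 0 j)).
- exact: chart_open.
- move=> _ [q pq <-]; rewrite /= chartK // coord_fieldE // hateE //.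
  by rewrite /app_endo cst_extE // -!mulmxA -rowE mxE.
- exact: (smooth_on_entry 0 j (@chart_open _ _ _ p) H).
Qed.

Lemma hatv_smooth X p : smooth_field setT X -> smooth_on (chart p @` cdom p) (hatv X p).
Proof.
move=> Xs; have := Xs p p; rewrite setTI setIid; apply: smooth_on_ext.
  exact: chart_open.
by move=> _ [q pq <-]; rewrite /= chartK // coord_fieldE // hatvE.
Qed.

Lemma hatc_smooth (E : M -> 'cV[R]_d) p :
  (forall (p : M) v, smoothM (cdom p) (fun q => (cst_ext p v q *m E q) 0 0)) ->
  smooth_on (chart p @` cdom p) (hatc E p).
Proof.
move=> Es; apply: smooth_on_mx => [|i j]; first exact: chart_open.
have := Es p (delta_mx 0 i) p; rewrite setIid; apply: smooth_on_ext.
  exact: chart_open.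
move=> _ [q pq <-]; rewrite /= chartK // hatcE // cst_extE //.
by rewrite -mulmxA -rowE mxE ord1.
Qed.

End LocalTensors.

HB.lock Definition hatg {R : realType} {d} {M : riemannian R d} (p : M)
  (x : 'rV[R]_d) : 'M[R]_d := hatb (@met R d M) p x.

(** The Christoffel matrices of the chart of p at the coordinate point x. Unlike [christoffel],
    which uses at each point the preferred chart of that point, they vary over the domain of one
    chart and can be differentiated. *)
HB.lock Definition conn {R : realType} {d} {M : riemannian R d} (p : M)
  (x v : 'rV[R]_d) : 'M[R]_d := chr (der (hatg p) x) (hatg p x) v.

(** * The connection of a chart and its transformation law *)

Section LocalMetric.
Context {R : realType} {d : nat} (M : riemannian R d).
Implicit Types (p q r : M) (A : M -> 'M[R]_d) (X : vfield M).

Lemma hatgE p q : cdom p q ->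
  hatg p (chart p q) = tmx p q q *m met q *m (tmx p q q)^T.
Proof. by move=> pq; rewrite hatg.unlock hatbE. Qed.

Lemma hatg_trans p q r : cdom p r -> cdom q r ->
  hatg q (chart q r) = tmx q p r *m hatg p (chart p r) *m (tmx q p r)^T.
Proof. by move=> pr qr; rewrite hatg.unlock; exact: hatb_trans. Qed.

Lemma hatg_id p : hatg p (chart p p) = met p.
Proof. by rewrite hatg.unlock hatb_id. Qed.

Lemma hatg_smooth p : smooth_on (chart p @` cdom p) (hatg p).
Proof.
apply: smooth_on_mx => [|i j]; first exact: chart_open.
have := @met_smooth _ _ M p (delta_mx 0 i) (delta_mx 0 j) p.
rewrite setIid; apply: smooth_on_ext.
  exact: chart_open.
move=> _ [q pq <-]; rewrite /= chartK // hatgE // !cst_extE //.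
by rewrite /bil trmx_mul -[RHS]form_entry !mulmxA.
Qed.

Lemma hatg_sym p x : (hatg p x)^T = hatg p x.
Proof. by rewrite hatg.unlock /hatb !trmx_mul trmxK met_sym mulmxA. Qed.

Lemma hatg_unit p q : cdom p q -> hatg p (chart p q) \in unitmx.
Proof.
move=> pq; rewrite hatgE //.
have /mulmx1_unit[U1 U2] := tmxK pq (cdom_refl q).
by rewrite !unitmx_mul U1 met_unit unitmx_tr U1.
Qed.

Lemma hatg_differentiable p q : cdom p q -> differentiable (hatg p) (chart p q).
Proof.
move=> pq; apply: (smooth_on_differentiable (@chart_open _ _ _ p) (@hatg_smooth p)).
by exists q.
Qed.

Lemma der_hatg_sym p q v : cdom p q ->
  (der (hatg p) (chart p q) v)^T = der (hatg p) (chart p q) v.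
Proof.
move=> pq; rewrite -der_tr; last exact: hatg_differentiable.
by congr (der _ _ v); apply/funext => x; rewrite hatg_sym.
Qed.

Lemma conn_lin p q : cdom p q -> lin (conn p (chart p q)).
Proof. move=> pq; have H := chr_lin (hatg p (chart p q)) (lin_der (hatg_differentiable pq)).
by move=> v; rewrite conn.unlock H. Qed.

Lemma conn_sym p q v w : cdom p q ->
  w *m conn p (chart p q) v = v *m conn p (chart p q) w.
Proof.
move=> pq; rewrite conn.unlock; apply: chr_sym.
- exact/lin_der/hatg_differentiable.
- by move=> u; exact: der_hatg_sym.
- exact: hatg_unit.
Qed.

Lemma conn_metric p q v : cdom p q ->
  der (hatg p) (chart p q) v = conn p (chart p q) v *m hatg p (chart p q)
     + hatg p (chart p q) *m (conn p (chart p q) v)^T.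
Proof.
move=> pq; rewrite conn.unlock; apply: (@chr_metric _ _ (fun v => der (hatg p) (chart p q) v)).
- by move=> u; exact: der_hatg_sym.
- exact: hatg_sym.
- exact: hatg_unit.
Qed.

(* The Jacobian of a change of coordinates is parallel: this is the
   transformation law of the Christoffel symbols. *)
Lemma conn_trans p q r v : cdom p r -> cdom q r ->
  cov (conn q (chart q r) v) (conn p (chart p r) (v *m tmx q p r))
    (der (jac (chart p \o ichart q)) (chart q r) v) (tmx q p r) = 0.
Proof.
move=> pr qr; set T := chart p \o ichart q; set y := chart q r.
have To := @trans_open _ _ M q p; have Ts := @trans_smooth _ _ M q p.
have Ty : (chart q @` (cdom p `&` cdom q)) y by exists r.
have Td := smooth_on_differentiable To Ts Ty.
have Jd := smooth_on_differentiable To (smooth_on_jac To Ts) Ty.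
have TyE : T y = chart p r by rewrite /T /y /= chartK.
have gd : differentiable (hatg p) (T y) by rewrite TyE; exact: hatg_differentiable.
have gTd : differentiable (hatg p \o T) y by exact: differentiable_comp.
pose L := tmx p q r; pose J := tmx q p r.
have JL : J *m L = 1%:M by exact: tmxK.
have LJ : L *m J = 1%:M by exact: tmxK.
pose dJ v := der (jac T) y v.
(* The value dictated by the transformation law. That it is the connection of the chart of q follows
   from uniqueness, so only symmetry and metric compatibility of [K] have to be checked. *)
pose K v := (dJ v + J *m conn p (chart p r) (v *m J)) *m L.
have dg u : der (hatg q) y u = (dJ u *m hatg p (T y)
      + J *m der (hatg p) (T y) (u *m J)) *m J^T + J *m hatg p (T y) *m (dJ u)^T.
  have -> : der (hatg q) y u
      = der (fun z => (jac T z *m (hatg p \o T) z) *m (jac T z)^T) y u.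
    apply: der_near; apply: (near_open To Ty) => _ [s [ps qs] <-].
    by rewrite /comp /T /= chartK //; exact: hatg_trans.
  have JGd := differentiable_mulmx Jd gTd.
  rewrite (der_mulmx _ JGd (differentiable_tr Jd)) (der_mulmx _ Jd gTd).
  by rewrite (der_tr _ Jd) (der_comp _ Td gd) (der_jac _ Td).
suff E u : K u = conn q y u.
  rewrite /cov -E /K -/J -mulmxA LJ mulmx1 -/(dJ v).
  by rewrite opprD addrA subrr sub0r addNr.
rewrite [in RHS]conn.unlock; apply: (@chr_unique _ _ (der (hatg q) y)).
- exact/lin_der/hatg_differentiable.
- by move=> w; exact: der_hatg_sym.
- exact: hatg_sym.
- exact: hatg_unit.
- move=> {}v w; rewrite /K !mulmxA; congr (_ *m L); rewrite !mulmxDr.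
  rewrite (der_jac_sym _ _ To Ts Ty) !mulmxA; congr (_ + _).
  exact: conn_sym.
- move=> {}v; rewrite dg TyE conn_metric // (hatg_trans pr qr) -/J.
  set G := hatg _ _; set C := conn _ _ _; rewrite /K -/C [(_ *m L)^T]trmx_mul [(dJ v + _)^T]linearD /=.
  rewrite [(J *m C)^T]trmx_mul.
  have E1 B : B *m L *m (J *m G *m J^T) = B *m G *m J^T.
    by rewrite !mulmxA -(mulmxA B) LJ mulmx1.
  have E2 B : J *m G *m J^T *m (L^T *m B) = J *m G *m B.
    by rewrite -!mulmxA (mulmxA J^T) -trmx_mul LJ trmx1 mul1mx.
  rewrite E1 E2 !mulmxDl !mulmxDr !mulmxDl !mulmxA; mx_ring.
Qed.

Definition cendo A p x v := cov (conn p x v) (conn p x v) (der (hate A p) x v) (hate A p x).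
Definition ccov (E : M -> 'cV[R]_d) p x v :=
  cov (conn p x v) 0 (der (hatc E p) x v) (hatc E p x).
Definition cvec X p x v := cov 0 (conn p x v) (der (hatv X p) x v) (hatv X p x).

Lemma hate_differentiable A p q : smooth_endo A -> cdom p q ->
  differentiable (hate A p) (chart p q).
Proof.
move=> As pq; apply: (smooth_on_differentiable (@chart_open _ _ _ p) (@hate_smooth _ _ M A p As)).
by exists q.
Qed.

(** Differentiate the relation between the components of [A] in the two charts, A_q J = J A_p: the
    Jacobian J is parallel, so only the derivatives of [A] survive. *)
Lemma cendo_trans A p q r v : smooth_endo A -> cdom p r -> cdom q r ->
  cendo A q (chart q r) v *m tmx q p r
  = tmx q p r *m cendo A p (chart p r) (v *m tmx q p r).
Proof.
move=> As pr qr.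
have To := @trans_open _ _ M q p; have Ts := @trans_smooth _ _ M q p.
have Ty : (chart q @` (cdom p `&` cdom q)) (chart q r) by exists r.
have Td := smooth_on_differentiable To Ts Ty.
have Jd := smooth_on_differentiable To (smooth_on_jac To Ts) Ty.
have TyE : (chart p \o ichart q) (chart q r) = chart p r by rewrite /= chartK.
have Ad : differentiable (hate A p) (((chart p \o ichart q) (chart q r))) by rewrite TyE; exact: hate_differentiable.
have ATd : differentiable (hate A p \o (chart p \o ichart q)) (chart q r) by exact: differentiable_comp.
have Aqd : differentiable (hate A q) (chart q r) by exact: hate_differentiable.
have E : der (fun z => hate A q z *m jac (chart p \o ichart q) z) (chart q r) v
    = der (fun z => jac (chart p \o ichart q) z *m (hate A p \o (chart p \o ichart q)) z) (chart q r) v.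
  apply: der_near; apply: (near_open To Ty) => _ [s [ps qs] <-].
  by rewrite /comp /= chartK //; exact: hate_trans.
rewrite (der_mulmx _ Aqd Jd) (der_mulmx _ Jd ATd) (der_comp _ Td Ad) in E.
rewrite (der_jac _ Td) jac_trans (TyE) in E.
have := cov_mul (conn q (chart q r) v) (conn q (chart q r) v) (conn p (chart p r) (v *m tmx q p r))
  (der (hate A q) (chart q r) v) (hate A q (chart q r)) (der (jac (chart p \o ichart q)) (chart q r) v) (tmx q p r).
rewrite conn_trans // mulmx0 addr0 -/(cendo A q (chart q r) v) => <-.
have E0 : (hate A p \o (chart p \o ichart q)) (chart q r) = hate A p (chart p r).
  by rewrite /= chartK.
rewrite E E0 hate_trans // (cov_mul _ (conn p (chart p r) (v *m tmx q p r))).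
by rewrite conn_trans // mul0mx add0r.
Qed.

Lemma hatc_differentiable (E : M -> 'cV[R]_d) p q :
  (forall (p : M) v, smoothM (cdom p) (fun q => (cst_ext p v q *m E q) 0 0)) ->
  cdom p q -> differentiable (hatc E p) (chart p q).
Proof.
move=> Es pq; apply: (smooth_on_differentiable (@chart_open _ _ _ p) (@hatc_smooth _ _ M E p Es)).
by exists q.
Qed.

Lemma ccov_trans (E : M -> 'cV[R]_d) p q r v :
  (forall (p : M) v, smoothM (cdom p) (fun q => (cst_ext p v q *m E q) 0 0)) ->
  cdom p r -> cdom q r ->
  ccov E q (chart q r) v = tmx q p r *m ccov E p (chart p r) (v *m tmx q p r).
Proof.
move=> Es pr qr.
have To := @trans_open _ _ M q p; have Ts := @trans_smooth _ _ M q p.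
have Ty : (chart q @` (cdom p `&` cdom q)) (chart q r) by exists r.
have Td := smooth_on_differentiable To Ts Ty.
have Jd := smooth_on_differentiable To (smooth_on_jac To Ts) Ty.
have TyE : (chart p \o ichart q) (chart q r) = chart p r by rewrite /= chartK.
have Ed : differentiable (hatc E p) (((chart p \o ichart q) (chart q r))) by rewrite TyE; exact: hatc_differentiable.
have ETd : differentiable (hatc E p \o (chart p \o ichart q)) (chart q r) by exact: differentiable_comp.
have EE : der (hatc E q) (chart q r) v = der (fun z => jac (chart p \o ichart q) z *m (hatc E p \o (chart p \o ichart q)) z) (chart q r) v.
  apply: der_near; apply: (near_open To Ty) => _ [s [ps qs] <-].
  by rewrite /comp /= chartK //; exact: hatc_trans.
rewrite (der_mulmx _ Jd ETd) (der_comp _ Td Ed) in EE.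
rewrite (der_jac _ Td) jac_trans TyE in EE.
have E0 : (hatc E p \o (chart p \o ichart q)) (chart q r) = hatc E p (chart p r).
  by rewrite /= chartK.
rewrite /ccov EE E0 (hatc_trans _ pr qr) (cov_mul _ (conn p (chart p r) (v *m tmx q p r))).
by rewrite conn_trans // mul0mx add0r.
Qed.

End LocalMetric.

(** * A calculus of covariant derivatives at a point *)

Section CovariantDerivative.
Context {R : realType}.

(* F has the value A and the covariant derivative dA at x, with respect to the
   connection matrices K1 (rows) and K2 (columns). *)
Definition isD {d a b} (x : 'rV[R]_d) (K1 : 'rV[R]_d -> 'M[R]_a)
    (K2 : 'rV[R]_d -> 'M[R]_b) (F : 'rV[R]_d -> 'M[R]_(a, b)) (A : 'M[R]_(a, b))
    (dA : 'rV[R]_d -> 'M[R]_(a, b)) : Prop :=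
  [/\ differentiable F x, F x = A &
      forall v, cov (K1 v) (K2 v) (der F x v) A = dA v].

Context {d : nat} (x : 'rV[R]_d).

Lemma isD_mul {a b c} (K1 : 'rV[R]_d -> 'M[R]_a) (K2 : 'rV[R]_d -> 'M[R]_b)
    (K3 : 'rV[R]_d -> 'M[R]_c) F G A B dA dB :
  isD x K1 K2 F A dA -> isD x K2 K3 G B dB ->
  isD x K1 K3 (fun y => F y *m G y) (A *m B) (fun v => dA v *m B + A *m dB v).
Proof.
move=> [Fd FA FdA] [Gd GB GdB]; split; first exact: differentiable_mulmx.
  by rewrite FA GB.
by move=> v; rewrite der_mulmx // FA GB (cov_mul _ (K2 v)) FdA GdB.
Qed.

Lemma isD_add {a b} (K1 : 'rV[R]_d -> 'M[R]_a) (K2 : 'rV[R]_d -> 'M[R]_b)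
    F G A B dA dB :
  isD x K1 K2 F A dA -> isD x K1 K2 G B dB ->
  isD x K1 K2 (fun y => F y + G y) (A + B) (fun v => dA v + dB v).
Proof.
move=> [Fd FA FdA] [Gd GB GdB]; split; first exact: differentiableD.
  by rewrite FA GB.
by move=> v; rewrite derD // covD FdA GdB.
Qed.

Lemma isD_opp {a b} (K1 : 'rV[R]_d -> 'M[R]_a) (K2 : 'rV[R]_d -> 'M[R]_b) F A dA :
  isD x K1 K2 F A dA -> isD x K1 K2 (fun y => - F y) (- A) (fun v => - dA v).
Proof.
move=> [Fd FA FdA]; split; first exact: differentiableN.
  by rewrite FA.
by move=> v; rewrite derN // -FdA /cov mulmxN mulNmx; mx_ring.
Qed.

Lemma isD_scale {a b} (K1 : 'rV[R]_d -> 'M[R]_a) (K2 : 'rV[R]_d -> 'M[R]_b)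
    (k : 'rV[R]_d -> R) F A dA : differentiable k x ->
  isD x K1 K2 F A dA ->
  isD x K1 K2 (fun y => k y *: F y) (k x *: A) (fun v => der k x v *: A + k x *: dA v).
Proof.
move=> kd [Fd FA FdA].
have kFd : differentiable (fun y => k y *: F y) x.
  apply: differentiable_mx => i j; under eq_fun do rewrite mxE.
  by apply: differentiableM => //; exact: differentiable_entry.
split; [exact: kFd|by rewrite FA|move=> v].
have -> : der (fun y => k y *: F y) x v = der k x v *: A + k x *: der F x v.
  apply/matrixP => i j; rewrite der_entry // addmxE !scalemxE der_entry // -FA.
  under eq_fun do rewrite mxE.
  rewrite !derE deriveM; [|exact: diff_derivable
    |exact/diff_derivable/differentiable_entry].
  by rewrite addrC; congr (_ + _); exact: mulrC.
by rewrite covZ FdA.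
Qed.

Lemma isD_tr {a b} (K1 : 'rV[R]_d -> 'M[R]_a) (K2 : 'rV[R]_d -> 'M[R]_b)
    (L2 : 'rV[R]_d -> 'M[R]_a) (L1 : 'rV[R]_d -> 'M[R]_b) F A dA :
  (forall v, L1 v = - (K2 v)^T) -> (forall v, L2 v = - (K1 v)^T) ->
  isD x K1 K2 F A dA -> isD x L1 L2 (fun y => (F y)^T) A^T (fun v => (dA v)^T).
Proof.
move=> L1E L2E [Fd FA FdA]; split; first exact: differentiable_tr.
  by rewrite FA.
by move=> v; rewrite der_tr // -FdA cov_tr L1E L2E.
Qed.

Lemma isD_1 {a} (K : 'rV[R]_d -> 'M[R]_a) :
  isD x K K (fun=> 1%:M) 1%:M (fun=> 0).
Proof.
split=> [||v]; [exact: differentiable_cst|by []|].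
by rewrite der_cst cov1.
Qed.

(** The tool for differentiating an identity between fields: two expressions of the same germ have
    the same covariant derivative. The structure equations below are obtained in this way. *)
Lemma isD_eq {a b} (K1 : 'rV[R]_d -> 'M[R]_a) (K2 : 'rV[R]_d -> 'M[R]_b)
    F G A B dA dB : (\forall y \near x, F y = G y) ->
  isD x K1 K2 F A dA -> isD x K1 K2 G B dB -> forall v, dA v = dB v.
Proof.
move=> FG [Fd FA FdA] [Gd GB GdB] v.
by rewrite -FdA -GdB (der_near v FG) -FA -GB (nbhs_singleton FG).
Qed.

Lemma isD_lin {a b} (K1 : 'rV[R]_d -> 'M[R]_a) (K2 : 'rV[R]_d -> 'M[R]_b) F A dA :
  lin K1 -> lin K2 -> isD x K1 K2 F A dA -> lin dA.
Proof.
move=> /lin_linearP K1L /lin_linearP K2L [Fd FA FdA].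
have /lin_linearP FL := lin_der Fd.
apply/lin_linearP => k u v; rewrite -!FdA /cov K1L K2L FL.
by rewrite !mulmxDl !mulmxDr -!scalemxAl -!scalemxAr; mx_ring.
Qed.

(** Chain rule for the pullback connection: the connection matrices over the target are evaluated on
    the image of the direction. *)
Lemma isD_pull {e a b} (y : 'rV[R]_e) (L1 : 'rV[R]_e -> 'M[R]_a)
    (L2 : 'rV[R]_e -> 'M[R]_b) F A dA (f : 'rV[R]_d -> 'rV[R]_e) :
  differentiable f x -> f x = y -> isD y L1 L2 F A dA ->
  isD x (fun v => L1 (v *m jac f x)) (fun v => L2 (v *m jac f x)) (F \o f) A
    (fun v => dA (v *m jac f x)).
Proof.
move=> fd fxy [Fd FA FdA]; rewrite -fxy in Fd FA FdA; split.
- exact: differentiable_comp.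
- exact: FA.
- by move=> v; rewrite der_comp // (der_jac _ fd) FdA.
Qed.

End CovariantDerivative.

Lemma lin0 {R : realType} {a} {V : lmodType R} : lin (fun _ : 'rV[R]_a => 0 : V).
Proof. by move=> v; rewrite big1 // => i _; rewrite scaler0. Qed.

Lemma bil_der {R : realType} {V : normedModType R} {a b} (F : V -> 'M[R]_(a, b))
    (x u : V) (v : 'rV[R]_a) (w : 'rV[R]_b) : differentiable F x ->
  der (fun y => (v *m F y *m w^T) 0 0) x u = (v *m der F x u *m w^T) 0 0.
Proof.
move=> Fd; have vFd := differentiable_mulmx (differentiable_cst v x) Fd.
have wd := differentiable_cst w^T x.
rewrite -der_entry; last exact: differentiable_mulmx.
by rewrite (der_mulmx _ vFd wd) (der_mulmx _ (differentiable_cst v x) Fd) !der_cst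
  mul0mx mulmx0 add0r addr0.
Qed.

(** * The connection and the covariant derivatives of the statement in matrix form *)

Section Links.
Context {R : realType} {d : nat} (M : riemannian R d).
Implicit Types (p q r : M) (A : M -> 'M[R]_d) (X : vfield M).
Local Notation x0 p := (chart p p).

Lemma dfun_met p u v w :
  dfun (fun q => gmet q (cst_ext p v q) (cst_ext p w q)) p u
  = (v *m der (hatg p) (x0 p) u *m w^T) 0 0.
Proof.
rewrite dfun_der -bil_der; last exact/hatg_differentiable/cdom_refl.
apply: der_near; apply: (near_hat (cdom_refl p) (P := fun=> True)).
  by near=> q.
move=> q pq _; rewrite /= chartK // hatgE // gmetE !cst_extE // trmx_mul.
by rewrite !mulmxA.
Unshelve. all: by end_near. Qed.

Lemma christoffelE p v w : christoffel p v w = w *m conn p (x0 p) v.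
Proof.
rewrite /christoffel conn.unlock chrE.
- rewrite hatg_id; congr (_ *m _); apply/rowP => l.
  have E (F : 'M[R]_d) (z : 'rV_d) :
      (z *m F *m (delta_mx 0 l : 'rV_d)^T) 0 0 = (z *m F) 0 l.
    by rewrite trmx_delta -colE mxE.
  rewrite [LHS]mxE [RHS]mxE; congr (_ * (_ + _ - _)).
  - exact: etrans (dfun_met p v w (delta_mx 0 l)) (E _ _).
  - exact: etrans (dfun_met p w v (delta_mx 0 l)) (E _ _).
  - exact: dfun_met.
- exact/lin_der/hatg_differentiable/cdom_refl.
- by rewrite hatg_id met_unit.
Qed.

Lemma der_chart {W : normedModType R} (F : M -> W) (Fh : 'rV[R]_d -> W) p v :
  (forall q, cdom p q -> F q = Fh (chart p q)) ->
  der (F \o ichart p) (x0 p) v = der Fh (x0 p) v.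
Proof.
move=> FFh; apply: der_near; apply: filterS (near_chart_im (cdom_refl p)) => x [px xE].
by rewrite -[in RHS]xE -FFh.
Qed.

Lemma dfun_chart {W : normedModType R} (F : M -> W) (Fh : 'rV[R]_d -> W) p v :
  (forall q, cdom p q -> F q = Fh (chart p q)) -> dfun F p v = der Fh (x0 p) v.
Proof. by move=> FFh; rewrite dfun_der; exact: der_chart. Qed.

Lemma dfun_coord p X v : dfun (coord_field p X) p v = der (hatv X p) (x0 p) v.
Proof. by apply: dfun_chart => q pq; rewrite coord_fieldE // hatvE. Qed.

Lemma dfun_cst_ext p w v : dfun (coord_field p (cst_ext p w)) p v = 0.
Proof.
rewrite -(der_cst w (x0 p) v); apply: dfun_chart => q pq.
by rewrite coord_fieldE // cst_extE // -mulmxA tmxK ?mulmx1 //; exact: cdom_refl.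
Qed.

Lemma dfun_endo_ext A p w v : smooth_endo A ->
  dfun (coord_field p (app_endo A (cst_ext p w))) p v = w *m der (hate A p) (x0 p) v.
Proof.
move=> As; have Ad := hate_differentiable As (cdom_refl p).
have -> : w *m der (hate A p) (x0 p) v = der (fun y => w *m hate A p y) (x0 p) v.
  by rewrite (der_mulmx _ (differentiable_cst w _) Ad) der_cst mul0mx add0r.
apply: dfun_chart => q pq.
by rewrite coord_fieldE // /app_endo cst_extE // hateE // !mulmxA.
Qed.

Lemma dfun_cov_ext (E : M -> 'cV[R]_d) p w v :
  (forall (p : M) v, smoothM (cdom p) (fun q => (cst_ext p v q *m E q) 0 0)) ->
  dfun (fun q => (cst_ext p w q *m E q) 0 0) p v
  = (w *m der (hatc E p) (x0 p) v) 0 0.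
Proof.
move=> Es; have Ed := hatc_differentiable Es (cdom_refl p).
have -> : w *m der (hatc E p) (x0 p) v = der (fun y => w *m hatc E p y) (x0 p) v.
  by rewrite (der_mulmx _ (differentiable_cst w _) Ed) der_cst mul0mx add0r.
rewrite der_entry; last by apply: differentiable_mulmx; [exact: differentiable_cst|].
apply: dfun_chart => q pq.
by rewrite cst_extE // hatcE // mulmxA.
Qed.

Lemma nablaE p v X : nabla p v X = der (hatv X p) (x0 p) v + X p *m conn p (x0 p) v.
Proof. by rewrite /nabla dfun_coord christoffelE. Qed.

Lemma nabla_cst p v w : nabla p v (cst_ext p w) = w *m conn p (x0 p) v.
Proof. by rewrite /nabla dfun_cst_ext christoffelE cst_ext_id add0r. Qed.

Lemma nabla_endoE A p v w : smooth_endo A ->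
  nabla_endo A p v w = w *m cendo A p (x0 p) v.
Proof.
move=> As; rewrite /nabla_endo nabla_cst /nabla dfun_endo_ext // christoffelE.
rewrite /app_endo cst_ext_id /cendo /cov hate_id !mulmxDr mulmxN !mulmxA.
by rewrite addrAC.
Qed.

Lemma hatv_differentiable X p q : smooth_field setT X -> cdom p q ->
  differentiable (hatv X p) (chart p q).
Proof.
move=> Xs pq; apply: (smooth_on_differentiable (@chart_open _ _ _ p)
  (@hatv_smooth _ _ M X p Xs)).
by exists q.
Qed.

Lemma nabla_vecE X p v : nabla p v X = cvec X p (x0 p) v.
Proof. by rewrite nablaE /cvec /cov mul0mx subr0 hatv_id. Qed.

Lemma isD_met p q : cdom p q -> isD (chart p q) (conn p (chart p q))
  (fun v => - (conn p (chart p q) v)^T) (hatg p) (hatg p (chart p q)) (fun=> 0).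
Proof.
move=> pq; split; [exact: hatg_differentiable|by []|move=> v].
by rewrite /cov conn_metric // mulmxN; mx_ring.
Qed.

Lemma near_hatg_unit p q : cdom p q -> \forall x \near chart p q, hatg p x \in unitmx.
Proof.
move=> pq; apply: filterS (near_chart_im pq) => x [px <-].
exact: hatg_unit.
Qed.

Lemma isD_meti p q : cdom p q -> isD (chart p q)
  (fun v => - (conn p (chart p q) v)^T) (conn p (chart p q))
  (fun x => invmx (hatg p x)) (invmx (hatg p (chart p q))) (fun=> 0).
Proof.
move=> pq; have gd := hatg_differentiable pq; have gu := near_hatg_unit pq.
split; [exact: differentiable_invmx|by []|move=> v].
rewrite /cov der_invmx // conn_metric // mulmxDr mulmxDl !mulmxA mulVmx ?hatg_unit //.
rewrite mul1mx -!mulmxA mulmxV ?hatg_unit // mulmx1 mulNmx.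
by mx_ring.
Qed.

Lemma isD_endo A p q : smooth_endo A -> cdom p q ->
  isD (chart p q) (conn p (chart p q)) (conn p (chart p q)) (hate A p)
    (hate A p (chart p q)) (cendo A p (chart p q)).
Proof. by move=> As pq; split=> //; exact: hate_differentiable. Qed.

Lemma isD_cov (E : M -> 'cV[R]_d) p q :
  (forall (p : M) v, smoothM (cdom p) (fun q => (cst_ext p v q *m E q) 0 0)) ->
  cdom p q -> isD (chart p q) (conn p (chart p q)) (fun=> 0) (hatc E p)
    (hatc E p (chart p q)) (ccov E p (chart p q)).
Proof. by move=> Es pq; split=> //; exact: hatc_differentiable. Qed.

Lemma isD_vec X p q : smooth_field setT X -> cdom p q ->
  isD (chart p q) (fun=> 0) (conn p (chart p q)) (hatv X p)
    (hatv X p (chart p q)) (cvec X p (chart p q)).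
Proof. by move=> Xs pq; split=> //; exact: hatv_differentiable. Qed.

Lemma divergenceE X p : divergence X p = \sum_i (cvec X p (x0 p) (delta_mx 0 i)) 0 i.
Proof. by apply: eq_bigr => i _; rewrite nabla_vecE. Qed.

End Links.

(** * Second fundamental form and tension field *)

Definition hatf {R : realType} {a b} {M : riemannian R a} {N : riemannian R b}
  (f : M -> N) (p : M) : 'rV[R]_a -> 'rV[R]_b := (chart (f p) \o f) \o ichart p.

HB.lock Definition dmx {R : realType} {a b} {M : riemannian R a}
  {N : riemannian R b} (f : M -> N) (p : M) : 'M[R]_(a, b) :=
  jac (hatf f p) (chart p p).

(** The covariant derivative of the differential in direction [v]; the row [w *m sff f p v] is the
    second fundamental form of f at (v, w). *)
HB.lock Definition sff {R : realType} {a b} {M : riemannian R a}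
  {N : riemannian R b} (f : M -> N) (p : M) (v : 'rV[R]_a) : 'M[R]_(a, b) :=
  cov (conn p (chart p p) v) (conn (f p) (chart (f p) (f p)) (v *m dmx f p))
    (der (jac (hatf f p)) (chart p p) v) (dmx f p).

Section Maps.
Context {R : realType} {a b : nat} (M : riemannian R a) (N : riemannian R b).
Context (f : M -> N) (fs : smooth_map f).
Implicit Types (p q : M).
Local Notation x0 p := (chart p p).

Definition fdom p := chart p @` (f @^-1` cdom (f p) `&` cdom p).

Let fc : continuous f. Proof. by case: fs. Qed.

Lemma fdom_open p : open (fdom p).
Proof. by apply: chart_image_open; move/continuousP: fc; apply; exact: cdom_open. Qed.

Lemma fdom_refl p : fdom p (x0 p).
Proof. by exists p => //; split; exact: cdom_refl. Qed.

Lemma hatf_smooth p : smooth_on (fdom p) (hatf f p).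
Proof. by case: fs => _ /(_ (f p) p). Qed.

Lemma hatf_differentiable p q : cdom p q -> cdom (f p) (f q) ->
  differentiable (hatf f p) (chart p q).
Proof.
move=> pq fpq; apply: (smooth_on_differentiable (@fdom_open p) (@hatf_smooth p)).
by exists q.
Qed.

Lemma hatf_diff p : differentiable (hatf f p) (x0 p).
Proof. by apply: hatf_differentiable; exact: cdom_refl. Qed.

Lemma hatfE p q : cdom p q -> hatf f p (chart p q) = chart (f p) (f q).
Proof. by move=> pq; rewrite /hatf /= chartK. Qed.

Lemma hatf_id p : hatf f p (x0 p) = chart (f p) (f p).
Proof. by rewrite hatfE //; exact: cdom_refl. Qed.

Lemma jac_hatf_id p : jac (hatf f p) (x0 p) = dmx f p.
Proof. by rewrite dmx.unlock. Qed.

Lemma dmapE p v : dmap f p v = v *m dmx f p.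
Proof. by rewrite /dmap dfun_der der_jac ?jac_hatf_id //; exact: hatf_diff. Qed.

Lemma near_fdom p : \forall q \near p, cdom p q /\ cdom (f p) (f q).
Proof.
apply: filterI; first exact: near_cdom (cdom_refl p).
exact: (fc (near_cdom (cdom_refl (f p)))).
Qed.

Lemma jac_hatf p q : cdom p q -> cdom (f p) (f q) ->
  jac (hatf f p) (chart p q) = tmx p q q *m dmx f q *m tmx (f q) (f p) (f q).
Proof.
move=> pq fpq; have qq := cdom_refl q; have fqq := cdom_refl (f q).
have E1 : (chart q \o ichart p) (chart p q) = x0 q by rewrite /= chartK.
have E2 : (hatf f q \o (chart q \o ichart p)) (chart p q) = x0 (f q).
  by rewrite /= chartK // hatf_id.
have d1 := trans_differentiable pq qq.
have d2 : differentiable (hatf f q) ((chart q \o ichart p) (chart p q)).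
  by rewrite E1; exact: hatf_diff.
have d12 := differentiable_comp d1 d2.
have d3 : differentiable (chart (f p) \o ichart (f q))
    ((hatf f q \o (chart q \o ichart p)) (chart p q)).
  by rewrite E2; exact: trans_differentiable.
rewrite -(@near_eq_jac _ _ _ ((chart (f p) \o ichart (f q)) \o
   (hatf f q \o (chart q \o ichart p)))).
- by rewrite (jac_comp d12 d3) (jac_comp d1 d2) E1 E2 jac_hatf_id.
- apply: filterS (near_chart pq (near_fdom q)) => x [qx fqx].
  by rewrite /hatf /= !chartK.
- exact: differentiable_comp.
Qed.

Lemma jac_hatf_differentiable p : differentiable (jac (hatf f p)) (x0 p).
Proof.
apply: (smooth_on_differentiable (@fdom_open p) (smooth_on_jac (@fdom_open p) (@hatf_smooth p))).
exact: fdom_refl.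
Qed.

Lemma isD_jac p : isD (x0 p) (conn p (x0 p))
  (fun v => conn (f p) (x0 (f p)) (v *m dmx f p)) (jac (hatf f p)) (dmx f p) (sff f p).
Proof.
split=> [||v]; [exact: jac_hatf_differentiable|exact: jac_hatf_id|].
by rewrite sff.unlock.
Qed.

Lemma isD_along p {c e} (L1 : 'rV[R]_b -> 'M[R]_c) (L2 : 'rV[R]_b -> 'M[R]_e) F A dA :
  isD (x0 (f p)) L1 L2 F A dA ->
  isD (x0 p) (fun v => L1 (v *m dmx f p)) (fun v => L2 (v *m dmx f p)) (F \o hatf f p) A
    (fun v => dA (v *m dmx f p)).
Proof. by move=> H; have := isD_pull (hatf_diff p) (hatf_id p) H; rewrite jac_hatf_id. Qed.

Lemma sff_lin p : lin (sff f p).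
Proof.
apply: isD_lin (isD_jac p); first exact/conn_lin/cdom_refl.
by apply: lin_comp; exact/conn_lin/cdom_refl.
Qed.

(** The Hessian of f in charts is symmetric, and so are the two Christoffel terms, as both
    connections are torsion free. *)
Lemma sff_sym p v w : w *m sff f p v = v *m sff f p w.
Proof.
rewrite sff.unlock /cov !mulmxDr !mulmxN !mulmxA.
rewrite (der_jac_sym v w (@fdom_open p) (@hatf_smooth p) (fdom_refl p)).
rewrite (@conn_sym _ _ M p p v w (cdom_refl p)); congr (_ + _).
exact: (@conn_sym _ _ N (f p) (f p) _ _ (cdom_refl (f p))).
Qed.

Lemma second_fund_formE p v w : second_fund_form f p v w = w *m sff f p v.
Proof.
rewrite /second_fund_form /nabla_pull christoffelE !dmapE nabla_cst cst_ext_id.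
rewrite sff.unlock /cov !mulmxDr mulmxN !mulmxA [RHS]addrAC; congr (_ + _ - _).
have Jd := jac_hatf_differentiable p.
have -> : w *m der (jac (hatf f p)) (x0 p) v = der (fun y => w *m jac (hatf f p) y) (x0 p) v.
  by rewrite (der_mulmx _ (differentiable_cst w _) Jd) der_cst mul0mx add0r.
rewrite dfun_der; apply: der_near.
apply: (near_hat (cdom_refl p) (near_fdom p)) => q pq [_ fpq].
rewrite /= chartK // dmapE cst_extE // jac_hatf // !mulmxA.
have := @coord_fieldE _ _ N (f p) (fun=> w *m tmx p q q *m dmx f q) (f q) fpq.
by [].
Qed.

Lemma tensionE p : tension f p = gtr (invmx (met p)) (fun v w => w *m sff f p v).
Proof.
apply: eq_bigr => i _; apply: eq_bigr => j _.
by rewrite second_fund_formE.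
Qed.

Lemma horizontalP p X : horizontal f p X <->
  forall V : 'rV[R]_a, V *m dmx f p = 0 -> X *m met p *m V^T = 0.
Proof.
split=> H V V0.
  by rewrite [LHS]mx11_scalar -gmetE H ?dmapE // raddf0.
by rewrite gmetE H ?mxE // -dmapE.
Qed.

(** The adjoint of the differential with respect to the two metrics. *)
Definition lift p (z : 'rV[R]_b) : 'rV[R]_a :=
  z *m met (f p) *m (dmx f p)^T *m invmx (met p).

Lemma lift_horizontal p z : horizontal f p (lift p z).
Proof.
apply/horizontalP => V V0; rewrite /lift mulmxKV ?met_unit //.
by rewrite -mulmxA -trmx_mul V0 trmx0 mulmx0.
Qed.

(** Weak conformality says that the differential composed with its adjoint is mu^2 times the
    identity. Where mu = 0, the image of a lift has length 0; where mu > 0, surjectivity provides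
    horizontal preimages of the basis vectors to test against. *)
Lemma hwc_mx mu p : hwc f mu ->
  (dmx f p)^T *m invmx (met p) *m dmx f p = mu p ^+ 2 *: invmx (met (f p)).
Proof.
move=> /(_ p)[mu0 conf surj]; set J := dmx f p; set Hm := met (f p).
have HU : Hm \in unitmx := met_unit (f p).
have key z : lift p z *m J = mu p ^+ 2 *: z.
  have hz := @lift_horizontal p z.
  move: mu0; rewrite le_eqVlt => /predU1P[m0|mpos].
    apply/eqP; rewrite -m0 expr0n scale0r; apply/negPn/negP => nz.
    have := @met_pos _ _ N (f p) _ nz; have := conf _ _ hz hz.
    by rewrite !dmapE -m0 expr0n mul0r /gmet => ->; rewrite ltxx.
  apply/eqP; rewrite -subr_eq0 -[_ - _](mulmxK HU).
  suff -> : (lift p z *m J - mu p ^+ 2 *: z) *m Hm = 0 by rewrite mul0mx.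
  apply/rowP => j; have [Y hY YE] := surj mpos (delta_mx 0 j).
  have := conf _ _ hz hY; rewrite YE dmapE -/J !gmetE.
  have -> : lift p z *m met p *m Y^T = z *m Hm *m (delta_mx 0 j)^T.
    rewrite /lift mulmxKV ?met_unit // -[LHS]mulmxA -trmx_mul.
    by rewrite -YE dmapE.
  have E (F : 'rV[R]_b) : (F *m (delta_mx 0 j : 'rV_b)^T) 0 0 = F 0 j.
    by rewrite trmx_delta -colE mxE.
  rewrite -/Hm !E => H; rewrite mulmxBl -scalemxAl; mx_entries.
  by rewrite H subrr.
apply: (can_inj (mulKmx HU)); rewrite -scalemxAr mulmxV // !mulmxA.
apply/row_matrixP => i; rewrite ![row i _]rowE.
by have := key (delta_mx 0 i); rewrite /lift -!mulmxA => ->; rewrite scalemx1 mul_mx_scalar.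
Qed.

Lemma gtr_along mu p {V : lmodType R} (T : 'rV[R]_b -> 'rV[R]_b -> V) :
  hwc f mu -> bilin T ->
  gtr (invmx (met p)) (fun v w => T (v *m dmx f p) (w *m dmx f p))
  = mu p ^+ 2 *: gtr (invmx (met (f p))) T.
Proof. by move=> fh TB; rewrite gtr_push // (hwc_mx p fh) gtrZl. Qed.

(** Each column of the differential has length 0 for the inverse metric, which is positive
    definite. *)
Lemma dmx_eq0 mu p : hwc f mu -> mu p = 0 -> dmx f p = 0.
Proof.
move=> /hwc_mx => /(_ p) H m0; rewrite m0 expr0n scale0r in H.
apply: trmx_inj; rewrite trmx0; apply/row_matrixP => i; rewrite row0.
apply/eqP/negPn/negP => nz; pose w := row i (dmx f p)^T *m invmx (met p).
have wnz : w != 0.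
  apply: contraNneq nz => w0.
  by rewrite -(mulmxKV (met_unit p) (row i _)) -/w w0 mul0mx.
have := @met_pos _ _ M p _ wnz; rewrite /bil {1}/w mulmxKV ?met_unit //.
have -> : row i (dmx f p)^T *m w^T = row i ((dmx f p)^T *m invmx (met p) *m dmx f p) *m delta_mx i 0.
  rewrite /w trmx_mul trmx_inv met_sym tr_row trmxK !row_mul.
  by rewrite colE !mulmxA.
by rewrite H row0 mul0mx zeromxE ltxx.
Qed.

Lemma mu_regular mu p : (0 < b)%N -> hwc f mu ->
  (forall Z, exists X, dmap f p X = Z) -> mu p != 0.
Proof.
move=> b0 fh fsurj; apply/eqP => m0; have [X] := fsurj (delta_mx 0 (Ordinal b0)).
rewrite dmapE (dmx_eq0 fh m0) mulmx0 => /matrixP/(_ 0 (Ordinal b0)).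
by rewrite !mxE !eqxx => /esym/eqP; rewrite oner_eq0.
Qed.

End Maps.

(** * Almost contact metric structures *)

Section StructureAlgebra.
Context {R : realFieldType} {d : nat} (G F : 'M[R]_d) (X : 'rV[R]_d) (E : 'cV[R]_d).
Context (GT : G^T = G) (GU : G \in unitmx).
Context (FF : F *m F = - 1%:M + E *m X) (FG : F *m G *m F^T = G - E *m E^T).

(** phi xi = 0 has to be derived from the axioms. The vector w = phi xi satisfies phi w = phi^2 xi =
    0, hence w = eta(w) xi; applying phi again gives eta(w) w = 0, so eta(w)^2 = 0. *)
Lemma structure_xi : X *m E = 1%:M -> X *m F = 0.
Proof.
move=> XE; pose w := X *m F.
have wF : w *m F = 0 by rewrite -mulmxA FF mulmxDr mulmxN mulmx1 mulmxA XE mul1mx addNr.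
have wE : w = (w *m E) *m X.
  apply/eqP; rewrite -subr_eq0 -opprB oppr_eq0; apply/eqP.
  have : w *m (F *m F) = 0 by rewrite mulmxA wF mul0mx.
  by rewrite FF mulmxDr mulmxN mulmx1 mulmxA addrC.
have c0 : w *m E *m (w *m E) = 0.
  have : w *m E *m w = 0 by rewrite {2}/w mulmxA -wE.
  by rewrite mulmxA => ->; rewrite mul0mx.
have : w *m E = 0.
  move: c0; rewrite [w *m E]mx11_scalar -scalar_mxM => /matrixP/(_ 0 0).
  by rewrite !mxE !eqxx !mulr1n => /eqP; rewrite mulf_eq0 orbb => /eqP ->; rewrite raddf0.
by move=> wE0; rewrite -/w wE wE0 mul0mx.
Qed.

Lemma structure_eta : X *m E = 1%:M -> F *m E = 0.
Proof.
move=> XE; have XF := structure_xi XE.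
have : F *m (F *m F) = F *m F *m F by rewrite mulmxA.
rewrite FF mulmxDr mulmxDl mulmxN mulNmx mulmx1 mul1mx => /addrI.
rewrite -[E *m X *m F]mulmxA XF mulmx0 => H.
by rewrite -[F *m E]mulmx1 -XE mulmxA -(mulmxA F) H mul0mx.
Qed.

Lemma structure_flat : X *m E = 1%:M -> E = G *m X^T.
Proof.
move=> XE; have XF := structure_xi XE.
have : F *m G *m F^T *m X^T = 0 by rewrite -mulmxA -trmx_mul XF trmx0 mulmx0.
rewrite FG mulmxBl -mulmxA -trmx_mul XE trmx1 mulmx1 => /eqP.
by rewrite subr_eq0 => /eqP.
Qed.

Context (XF : X *m F = 0) (FE : F *m E = 0) (EX : E = G *m X^T).

Lemma structure_skew : F *m G = - (G *m F^T).
Proof.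
have : F *m G *m F^T *m F^T = (G - E *m E^T) *m F^T by rewrite FG.
rewrite -mulmxA -trmx_mul FF linearD /= linearN /= trmx1 trmx_mul mulmxDr mulmxN mulmx1.
rewrite -(mulmxA F G) (mulmxA G) -EX mulmxA FE mul0mx addr0 mulmxBl.
by rewrite -(mulmxA E) -trmx_mul FE trmx0 mulmx0 subr0 => <-; rewrite opprK.
Qed.

Lemma structure_flati : invmx G *m E = X^T.
Proof. by rewrite EX mulmxA mulVmx // mul1mx. Qed.

Lemma structure_flati_tr : E^T *m invmx G = X.
Proof. by rewrite -[X]trmxK -structure_flati trmx_mul trmx_inv GT. Qed.

Lemma structure_skewi : invmx G *m F = - (F^T *m invmx G).
Proof.
apply: (can_inj (mulmxK GU)); rewrite -mulmxA structure_skew mulmxN mulmxA mulVmx //.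
by rewrite mul1mx mulNmx mulmxKV.
Qed.

Lemma structure_skewi_tr : (invmx G *m F)^T = - (invmx G *m F).
Proof. by rewrite trmx_mul trmx_inv GT structure_skewi opprK. Qed.

(** phi is an isometry of the orthogonal complement of xi; in this dual form it allows the second
    term of P to be traced. *)
Lemma structure_isom : F^T *m invmx G *m F = invmx G - X^T *m X.
Proof.
rewrite -[F^T *m _]opprK -structure_skewi mulNmx -mulmxA FF mulmxDr mulmxN mulmx1.
by rewrite mulmxA structure_flati opprD opprK.
Qed.

End StructureAlgebra.

Lemma tr_mx11 {R : realFieldType} (A : 'M[R]_1) : A^T = A.
Proof. by rewrite [A]mx11_scalar tr_scalar_mx. Qed.

(** This and the next two definitions are the covariant derivatives at [p], in direction [v], of
    phi, eta and xi. *)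
HB.lock Definition nP {R : realType} {m} {M : acm R m} (p : M) (v : 'rV[R]_(m.*2.+1)) :=
  cendo (@phi R m M) p (chart p p) v.
HB.lock Definition nE {R : realType} {m} {M : acm R m} (p : M) (v : 'rV[R]_(m.*2.+1)) :=
  ccov (@eta_vec R m M) p (chart p p) v.
HB.lock Definition nX {R : realType} {m} {M : acm R m} (p : M) (v : 'rV[R]_(m.*2.+1)) :=
  cvec (@xi R m M) p (chart p p) v.

(** * First-order identities of an almost contact metric structure *)

Section AcmFields.
Context {R : realType} {m : nat} (M : acm R m).
Local Notation d := (m.*2.+1).
Implicit Types (p q : M) (v w : 'rV[R]_d).
Local Notation x0 p := (chart p p).
Local Notation F p := (@phi R m M p).
Local Notation X p := (@xi R m M p).
Local Notation E p := (@eta_vec R m M p).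
Local Notation G p := (@met R d M p).

Lemma phi_phi p : F p *m F p = - 1%:M + E p *m X p.
Proof.
apply/row_matrixP => i; rewrite rowE mulmxA phi_sq rowE mulmxDr mulmxN mulmx1.
by rewrite mulmxA [in RHS](mx11_scalar (_ *m E p)) mul_scalar_mx.
Qed.

Lemma phi_met p : F p *m G p *m (F p)^T = G p - E p *m (E p)^T.
Proof.
apply/matrixP => i j; have := @phi_metric _ _ M p (delta_mx 0 i) (delta_mx 0 j).
rewrite /gmet /bil trmx_mul !mulmxA -2!(mulmxA (delta_mx 0 i)) !form_entry.
by rewrite -!rowE addmxE oppmxE => ->; rewrite [(E p *m _) _ _]mxE big_ord1 !mxE.
Qed.

Lemma xi_eta p : X p *m E p = 1%:M.
Proof. by rewrite [LHS]mx11_scalar eta_xi. Qed.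

Lemma xi_phi p : X p *m F p = 0.
Proof. exact: structure_xi (phi_phi p) (xi_eta p). Qed.

Lemma phi_eta p : F p *m E p = 0.
Proof. exact: structure_eta (phi_phi p) (xi_eta p). Qed.

Lemma eta_flat p : E p = G p *m (X p)^T.
Proof. exact: structure_flat (phi_phi p) (phi_met p) (xi_eta p). Qed.

Lemma phi_skew p : F p *m G p = - (G p *m (F p)^T).
Proof. exact: structure_skew (phi_phi p) (phi_met p) (phi_eta p) (eta_flat p). Qed.

Lemma phi_skewi p : (invmx (G p) *m F p)^T = - (invmx (G p) *m F p).
Proof.
exact: structure_skewi_tr (met_sym p) (met_unit p) (phi_phi p) (phi_met p)
  (phi_eta p) (eta_flat p).
Qed.

Lemma phi_isom p : (F p)^T *m invmx (G p) *m F p = invmx (G p) - (X p)^T *m X p.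
Proof.
exact: structure_isom (met_unit p) (phi_phi p) (phi_met p) (phi_eta p) (eta_flat p).
Qed.

Lemma eta_flati p : invmx (G p) *m E p = (X p)^T.
Proof. exact: structure_flati (met_unit p) (eta_flat p). Qed.

Lemma eta_flati_tr p : (E p)^T *m invmx (G p) = X p.
Proof. exact: structure_flati_tr (met_sym p) (met_unit p) (eta_flat p). Qed.

Lemma isD_F p : isD (x0 p) (conn p (x0 p)) (conn p (x0 p)) (hate (@phi R m M) p)
  (F p) (nP p).
Proof.
rewrite nP.unlock; have := isD_endo (@phi_smooth _ _ M) (cdom_refl p); by rewrite hate_id.
Qed.

Lemma isD_E p : isD (x0 p) (conn p (x0 p)) (fun=> 0) (hatc (@eta_vec R m M) p)
  (E p) (nE p).
Proof.
rewrite nE.unlock; have := isD_cov (@eta_smooth _ _ M) (cdom_refl p); by rewrite hatc_id.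
Qed.

Lemma isD_X p : isD (x0 p) (fun=> 0) (conn p (x0 p)) (hatv (@xi R m M) p)
  (X p) (nX p).
Proof.
rewrite nX.unlock; have := isD_vec (@xi_smooth _ _ M) (cdom_refl p); by rewrite hatv_id.
Qed.

Lemma isD_G p : isD (x0 p) (conn p (x0 p)) (fun v => - (conn p (x0 p) v)^T) (hatg p)
  (G p) (fun=> 0).
Proof. by have := isD_met (cdom_refl p); rewrite hatg_id. Qed.

Lemma isD_Xt p : isD (x0 p) (fun v => - (conn p (x0 p) v)^T) (fun=> 0)
  (fun x => (hatv (@xi R m M) p x)^T) (X p)^T (fun v => (nX p v)^T).
Proof.
by apply: isD_tr (isD_X p) => v //; rewrite trmx0 oppr0.
Qed.

Lemma nP_lin p : lin (nP p).
Proof. by apply: isD_lin (isD_F p); exact/conn_lin/cdom_refl. Qed.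

Lemma nE_lin p : lin (nE p).
Proof. by apply: isD_lin (isD_E p); [exact/conn_lin/cdom_refl|exact: lin0]. Qed.

Lemma nX_lin p : lin (nX p).
Proof. by apply: isD_lin (isD_X p); [exact: lin0|exact/conn_lin/cdom_refl]. Qed.

(** The covariant derivative of phi^2 = -1 + eta tensor xi. Most identities that follow arise
    likewise from an algebraic one: eta dual to xi, eta(xi) = 1, phi xi = 0, eta phi = 0, and the
    skewness of phi. *)
Lemma nP_phi p v : nP p v *m F p + F p *m nP p v = nE p v *m X p + E p *m nX p v.
Proof.
have := isD_eq _ (isD_mul (isD_F p) (isD_F p)) (isD_add (isD_opp (isD_1 _ _))
  (isD_mul (isD_E p) (isD_X p))); rewrite oppr0.
move=> H; rewrite H ?add0r //; apply: near_hat_all => q pq.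
rewrite !hateE // hatcE // hatvE // -!mulmxA (mulmxA (tmx q p q)) tmxK //; last exact: cdom_refl.
rewrite mul1mx (mulmxA (F q)) phi_phi mulmxDl mulmxDr mulNmx mul1mx mulmxN.
by rewrite tmxK //; [rewrite !mulmxA|exact: cdom_refl].
Qed.

Lemma nE_flat p v : nE p v = G p *m (nX p v)^T.
Proof.
rewrite (isD_eq _ (isD_E p) (isD_mul (isD_G p) (isD_Xt p))) ?mul0mx ?add0r //.
apply: near_hat_all => q pq; rewrite hatcE // hatvE // hatgE // trmx_mul eta_flat.
rewrite -!mulmxA (mulmxA (tmx p q q)^T) -trmx_mul tmxK ?trmx1 ?mul1mx //.
exact: cdom_refl.
Qed.

Lemma nX_eta p v : nX p v *m E p = 0.
Proof.
have H : nX p v *m E p + X p *m nE p v = 0.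
  rewrite (isD_eq _ (isD_mul (isD_X p) (isD_E p)) (isD_1 _ (fun=> 0))) //.
  apply: near_hat_all => q pq; rewrite hatcE // hatvE // -mulmxA (mulmxA (tmx q p q)).
  by rewrite tmxK ?mul1mx ?xi_eta //; exact: cdom_refl.
have H2 : X p *m nE p v = nX p v *m E p.
  by rewrite nE_flat eta_flat -[RHS]tr_mx11 !trmx_mul trmxK met_sym mulmxA.
rewrite H2 in H; move: H; rewrite [nX p v *m E p]mx11_scalar -raddfD => /matrixP/(_ 0 0).
rewrite !mxE !eqxx !mulr1n => H; apply/matrixP => i j; rewrite !mxE !ord1 eqxx mulr1n.
have := H; lra.
Qed.

Lemma xi_nE p v : X p *m nE p v = 0.
Proof.
by rewrite nE_flat mulmxA -(trmxK (X p)) -{1}(met_sym p) -trmx_mul -eta_flat -trmx_mul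
  nX_eta trmx0.
Qed.

Lemma xi_nP p v : X p *m nP p v = - (nX p v *m F p).
Proof.
apply/eqP; rewrite -addr_eq0 addrC; apply/eqP.
have Z : isD (x0 p) (fun=> 0) (conn p (x0 p)) (fun=> 0) (0 : 'rV[R]_d) (fun=> 0).
  split=> [||v'//]; [exact: differentiable_cst|by []|].
  by rewrite der_cst /cov mulmx0 mul0mx subr0 addr0.
rewrite (isD_eq _ (isD_mul (isD_X p) (isD_F p)) Z) //.
apply: near_hat_all => q pq; rewrite hateE // hatvE // -!mulmxA (mulmxA (tmx q p q)).
by rewrite tmxK ?mul1mx ?mulmxA ?xi_phi ?mul0mx //; exact: cdom_refl.
Qed.

Lemma nP_eta p v : nP p v *m E p = - (F p *m nE p v).
Proof.
apply/eqP; rewrite -addr_eq0; apply/eqP.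
have Z : isD (x0 p) (conn p (x0 p)) (fun=> 0) (fun=> 0) (0 : 'cV[R]_d) (fun=> 0).
  split=> [||v'//]; [exact: differentiable_cst|by []|].
  by rewrite der_cst /cov mulmx0 mul0mx subr0 addr0.
rewrite (isD_eq _ (isD_mul (isD_F p) (isD_E p)) Z) //.
apply: near_hat_all => q pq; rewrite hateE // hatcE // -!mulmxA (mulmxA (tmx q p q)).
by rewrite tmxK ?mul1mx ?phi_eta ?mulmx0 //; exact: cdom_refl.
Qed.

Lemma nP_skew p v : nP p v *m G p = - (G p *m (nP p v)^T).
Proof.
have Ft : isD (x0 p) (fun v => - (conn p (x0 p) v)^T) (fun v => - (conn p (x0 p) v)^T)
    (fun x => (hate (@phi R m M) p x)^T) (F p)^T (fun v => (nP p v)^T).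
  by apply: isD_tr (isD_F p) => v'.
have := isD_eq _ (isD_mul (isD_F p) (isD_G p)) (isD_opp (isD_mul (isD_G p) Ft)).
move=> H; have := H _ v; rewrite mulmx0 addr0 mul0mx add0r; apply.
apply: near_hat_all => q pq; have qq := cdom_refl q.
rewrite hateE // hatgE // !trmx_mul -!mulmxA (mulmxA (tmx q p q)) tmxK // mul1mx.
rewrite (mulmxA (tmx p q q)^T) -(trmx_mul (tmx q p q)) tmxK // trmx1 mul1mx.
by rewrite (mulmxA (F q)) phi_skew mulNmx mulmxN !mulmxA.
Qed.

Lemma tr_phi_nP p v : \tr (F p *m nP p v) = 0.
Proof.
have : \tr (nP p v *m F p + F p *m nP p v) = 0.
  rewrite nP_phi linearD /= mxtrace_mulC xi_nE mxtrace_mulC nX_eta.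
  by rewrite linear0 addr0.
rewrite linearD /= mxtrace_mulC => H; lra.
Qed.

End AcmFields.

(** * Traces of nabla phi and nabla xi *)

Section AcmTraces.
Context {R : realType} {m : nat} (M : acm R m).
Local Notation d := (m.*2.+1).
Implicit Types (p q : M) (v w Y Z : 'rV[R]_d).
Local Notation x0 p := (chart p p).
Local Notation F p := (@phi R m M p).
Local Notation X p := (@xi R m M p).
Local Notation E p := (@eta_vec R m M p).
Local Notation G p := (@met R d M p).
Local Notation Gi p := (invmx (@met R d M p)).

Definition nXm p : 'M[R]_d := \matrix_i nX p (delta_mx 0 i).
(* the trace of [nabla phi]; as a 1-form it is [delta Omega] *)
Definition Dphi p : 'rV[R]_d := gtr (Gi p) (fun v w => w *m nP p v).

Lemma nXE p v : nX p v = v *m nXm p.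
Proof.
rewrite nX_lin [in RHS](row_sum_delta v) mulmx_suml; apply: eq_bigr => i _.
by rewrite -scalemxAl -rowE rowK.
Qed.

Lemma nXm_eta p : nXm p *m E p = 0.
Proof. by apply/row_matrixP => i; rewrite row0 rowE mulmxA -nXE nX_eta. Qed.

Lemma nP_bilin p : bilin (fun v w => w *m nP p v).
Proof. exact: bilin_mul (nP_lin p). Qed.

Lemma nE_bilin p : bilin (fun v w => w *m nE p v).
Proof. exact: bilin_mul (nE_lin p). Qed.

Lemma divergence_xi p : divergence (@xi R m M) p = \tr (nXm p).
Proof. by rewrite divergenceE; apply: eq_bigr => i _; rewrite [RHS]mxE nX.unlock. Qed.

Lemma gtr_nE p : gtr (Gi p) (fun v w => w *m nE p v) = (\tr (nXm p))%:M.
Proof.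
have -> : gtr (Gi p) (fun v w => w *m nE p v)
    = gtr (Gi p) (fun v w => (v *m (nXm p *m G p) *m w^T) 0 0 *: 1%:M).
  apply: eq_gtr => v w; rewrite nE_flat nXE -[LHS]tr_mx11 !trmx_mul !trmxK met_sym.
  by rewrite [LHS]mx11_scalar !mulmxA scalemx1.
by rewrite gtr_bil trmx_mul met_sym mulmxA mulVmx ?met_unit // mul1mx mxtrace_tr scalemx1.
Qed.

Lemma tr_phi p : \tr (F p) = 0.
Proof.
have H : \tr (F p) = - \tr (F p).
  have -> : F p = G p *m (Gi p *m F p) by rewrite mulmxA mulmxV ?met_unit // mul1mx.
  rewrite -{1}mxtrace_tr trmx_mul phi_skewi met_sym mulNmx mxtrace_mulC.
  by rewrite linearN.
by move: H; lra.
Qed.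

Lemma tr_phi2 p : \tr (F p *m F p) = - (2 * m)%:R.
Proof.
rewrite phi_phi linearD linearN /= mxtrace1 mxtrace_mulC xi_eta mxtrace1.
by rewrite -muln2 mulnC -natr1; ring.
Qed.

Lemma phi_inj p Y : Y *m F p = 0 -> Y *m E p = 0 -> Y = 0.
Proof.
move=> YF YE; have : Y *m F p *m F p = 0 by rewrite YF mul0mx.
rewrite -mulmxA phi_phi mulmxDr mulmxN mulmx1 mulmxA YE mul0mx addr0 => /eqP.
by rewrite oppr_eq0 => /eqP.
Qed.

Lemma phi_ker p Y : Y *m F p = 0 -> Y = (Y *m E p) 0 0 *: X p.
Proof.
move=> YF; have : Y *m F p *m F p = 0 by rewrite YF mul0mx.
rewrite -mulmxA phi_phi mulmxDr mulmxN mulmx1 mulmxA => H.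
have {1}-> : Y = Y *m E p *m X p by apply/eqP; rewrite eq_sym -subr_eq0 addrC; apply/eqP.
by rewrite [Y *m E p in LHS]mx11_scalar mul_scalar_mx.
Qed.

(** (nabla_xi phi) xi = - phi (nabla_xi xi), and nabla_xi xi has no xi-component on which phi could
    be degenerate. *)
Lemma geodesicP p : X p *m nP p (X p) = 0 -> nX p (X p) = 0.
Proof.
rewrite xi_nP => /eqP; rewrite oppr_eq0 => /eqP H.
by apply: phi_inj H _; exact: nX_eta.
Qed.

(** Interchanging phi and nabla phi by the derivative of phi^2 brings in nabla xi, and with it the
    divergence of xi. *)
Lemma gtr_phi_nP p : gtr (Gi p) (fun v w => (w *m F p) *m nP p v)
  = \tr (nXm p) *: X p + nX p (X p) - Dphi p *m F p.
Proof.
have -> : gtr (Gi p) (fun v w => (w *m F p) *m nP p v)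
   = gtr (Gi p) (fun v w => (w *m nE p v *m X p + (w *m E p) 0 0 *: nX p v)
       - (w *m nP p v) *m F p).
  apply: eq_gtr => v w; apply/eqP; rewrite eq_sym subr_eq; apply/eqP.
  have := congr1 (mulmx w) (nP_phi p v); rewrite !mulmxDr !mulmxA addrC => ->.
  by rewrite [w *m E p in RHS]mx11_scalar mul_scalar_mx.
rewrite gtrDr gtrNr gtrDr gtr_mulmx gtr_mulmx gtr_nE mul_scalar_mx; congr (_ + _ - _).
rewrite (gtr_tr _ (fun w v => (w *m E p) 0 0 *: nX p v)) gtr_col; last exact: nX_lin.
by rewrite trmx_inv met_sym eta_flati_tr.
Qed.

Lemma Dphi_eta p : Dphi p *m E p = - gtr (Gi p) (fun v w => (w *m F p) *m nE p v).
Proof.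
rewrite -gtr_mulmx -gtrNr; apply: eq_gtr => v w.
by rewrite -[LHS]mulmxA nP_eta mulmxN mulmxA.
Qed.

(** As phi is an isometry off xi, both terms of P have the same trace up to the contribution of the
    xi-direction. *)
Lemma gtr_P p : gtr (Gi p) (fun v w => w *m nP p v + (w *m F p) *m nP p (v *m F p))
  = Dphi p *+ 2 - X p *m nP p (X p).
Proof.
rewrite gtrDr (gtr_push _ _ _ (nP_bilin p)) phi_isom gtrDl gtrNl.
by rewrite -(nP_bilin p (X p) (X p)) addrA mulr2n.
Qed.

Lemma gtr_met p Z : gtr (Gi p) (fun v w => (v *m G p *m w^T) 0 0 *: Z) = d%:R *: Z.
Proof. by rewrite gtr_bil met_sym mulVmx ?met_unit // mxtrace1. Qed.

Lemma gtr_eta p (H : 'rV[R]_d -> 'rV[R]_d) : lin H ->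
  gtr (Gi p) (fun v w => (w *m E p) 0 0 *: H v) = H (X p).
Proof.
move=> HL; rewrite (gtr_tr _ (fun w v => (w *m E p) 0 0 *: H v)) gtr_col //.
by rewrite trmx_inv met_sym eta_flati_tr.
Qed.

Lemma nabla_phiE p v w : nabla_phi p v w = w *m nP p v.
Proof. by rewrite /nabla_phi nabla_endoE ?nP.unlock //; exact: phi_smooth. Qed.

Lemma nabla_xiE p v : nabla_xi p v = nX p v.
Proof. by rewrite nX.unlock; exact: nabla_vecE. Qed.

Lemma PtenE p v w : Pten p v w = w *m nP p v + (w *m F p) *m nP p (v *m F p).
Proof. by rewrite /Pten !nabla_phiE. Qed.

Lemma QtenE p v w : Qten p v w = w *m nP p v + v *m nP p w.
Proof. by rewrite /Qten !nabla_phiE. Qed.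

Let sym p v w : w *m conn p (x0 p) v = v *m conn p (x0 p) w.
Proof. exact: (@conn_sym _ _ M p p v w (cdom_refl p)). Qed.

Lemma bracket_cst p v w : bracket (cst_ext p v) (cst_ext p w) p = 0.
Proof. by rewrite /bracket [U in U - _]dfun_cst_ext [U in _ - U]dfun_cst_ext subrr. Qed.

(** The Lie derivative is written with the torsion-free connection; all Christoffel terms cancel. *)
Lemma htenE p v : hten p v
  = 2^-1 *: (v *m nP p (X p) - (v *m F p) *m nXm p + v *m nXm p *m F p).
Proof.
rewrite /hten /bracket; congr (_ *: _).
rewrite [U in U - _ - _](dfun_endo_ext _ _ _ (@phi_smooth _ _ M)).
rewrite [U in _ - U - _]dfun_coord [U in (U - _) *m _]dfun_cst_ext.
rewrite [U in (_ - U) *m _]dfun_coord /app_endo !cst_ext_id sub0r -!nXE.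
have XE u : der (hatv (@xi R m M) p) (x0 p) u = nX p u - X p *m conn p (x0 p) u.
  have [_ _ /(_ u) <-] := isD_X p; rewrite /cov mul0mx; mx_ring.
have FE : der (hate (@phi R m M) p) (x0 p) (X p) = nP p (X p)
    + conn p (x0 p) (X p) *m F p - F p *m conn p (x0 p) (X p).
  have [_ _ /(_ (X p)) <-] := isD_F p; rewrite /cov; mx_ring.
rewrite !XE FE !mulmxBr mulmxDr !mulmxA mulNmx mulmxBl -(sym p (X p) v).
rewrite (sym p (v *m F p) (X p)); mx_ring.
Qed.

Lemma detaE p v w : deta p v w = 2^-1 * ((w *m nE p v) 0 0 - (v *m nE p w) 0 0).
Proof.
have e0 : Defs.eta p (bracket (cst_ext p v) (cst_ext p w) p) = 0.
  by rewrite /Defs.eta bracket_cst mul0mx zeromxE.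
rewrite /deta; cbv zeta; rewrite e0 subr0.
congr (_ * _).
rewrite [U in U - _](dfun_cov_ext _ _ _ (@eta_smooth _ _ M)).
rewrite [U in _ - U](dfun_cov_ext _ _ _ (@eta_smooth _ _ M)).
have EE u : der (hatc (@eta_vec R m M) p) (x0 p) u = nE p u + conn p (x0 p) u *m E p.
  have [_ _ /(_ u) <-] := isD_E p; rewrite /cov mulmx0; mx_ring.
by rewrite !EE !mulmxDr !mulmxA (sym p v w); mx_entries; ring.
Qed.

Lemma OmegaE p v w : Omega p v w = (v *m G p *m (w *m F p)^T) 0 0.
Proof. by []. Qed.

Lemma nabla_OmegaE p v w Z : nabla_Omega p v w Z = (w *m G p *m (Z *m nP p v)^T) 0 0.
Proof.
rewrite /nabla_Omega !OmegaE !nabla_cst.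
pose O x := hatg p x *m (hate (@phi R m M) p x)^T.
have Od := isD_mul (isD_G p) (isD_tr (fun v => erefl) (fun v => erefl) (isD_F p)).
have [Odf O0 /(_ v) OD] := Od.
have -> : dfun (fun q => Omega q (cst_ext p w q) (cst_ext p Z q)) p v
    = (w *m der O (x0 p) v *m Z^T) 0 0.
  rewrite -bil_der //; apply: dfun_chart => q pq.
  rewrite OmegaE !cst_extE // /O hatgE // hateE // !trmx_mul -!mulmxA.
  rewrite (mulmxA (tmx p q q)^T) -(trmx_mul (tmx q p q)) tmxK ?trmx1 ?mul1mx //.
  exact: cdom_refl.
have -> : der O (x0 p) v = G p *m (nP p v)^T + conn p (x0 p) v *m (G p *m (F p)^T)
    + G p *m (F p)^T *m (conn p (x0 p) v)^T.
  have -> : G p *m (nP p v)^T = 0 *m (F p)^T + G p *m (nP p v)^T by rewrite mul0mx add0r.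
  by rewrite -OD /cov mulmxN; mx_ring.
rewrite !trmx_mul !mulmxDr !mulmxDl !mulmxA.
by mx_entries; ring.
Qed.

Lemma dOmegaE p Y v w : dOmega p Y v w
  = (v *m G p *m (w *m nP p Y)^T) 0 0 + (w *m G p *m (Y *m nP p v)^T) 0 0
    + (Y *m G p *m (v *m nP p w)^T) 0 0.
Proof. by rewrite /dOmega !nabla_OmegaE. Qed.

(** (nabla_Y eta)(xi) = 0 because xi has unit length. So 2 d eta(Y, xi) is minus (nabla_xi eta)(Y),
    and nabla_xi eta is dual to nabla_xi xi. *)
Lemma nX_xi_of_deta p : (forall Y, deta p Y (X p) = 0) -> nX p (X p) = 0.
Proof.
move=> H; have nE0 : nE p (X p) = 0.
  apply/row_matrixP => i; rewrite row0 rowE; apply/matrixP => k l.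
  rewrite !ord1 zeromxE; have := H (delta_mx 0 i).
  by rewrite detaE xi_nE zeromxE; lra.
move: nE0; rewrite nE_flat => nE0.
by apply: trmx_inj; rewrite -(mulKmx (met_unit p) (nX p (X p))^T) nE0 mulmx0 trmx0.
Qed.

(** Take the eta-component of normality at (Y, xi). Three Nijenhuis terms lie in the image of phi,
    which eta annihilates; since phi xi = 0, the remaining bracket reduces to (nabla phi) xi, again
    in that image. Hence d eta(Y, xi) = 0. *)
Lemma normal_nX_xi p : normal_acm M -> nX p (X p) = 0.
Proof.
move=> nrm; apply: nX_xi_of_deta => Y.
have := congr1 (fun U => (U *m E p) 0 0) (nrm p Y (X p)).
rewrite mulmxDl -scalemxAl xi_eta mul0mx; mx_entries; rewrite [1%:M 0 0]mxE eqxx mulr1.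
suff -> : (nijenhuis p Y (X p) *m E p) 0 0 = 0 by lra.
have drop (B0 B1 B2 B3 : 'rV[R]_d) :
    (B0 *m F p *m F p + B1 - B2 *m F p - B3 *m F p) *m E p = B1 *m E p.
  by rewrite !mulmxBl mulmxDl -!(mulmxA _ (F p) (E p)) phi_eta !mulmx0 add0r !subr0.
rewrite [nijenhuis p Y (X p) *m _]drop.
rewrite /bracket [U in U - _](dfun_endo_ext _ _ _ (@phi_smooth _ _ M)).
rewrite [U in _ - U](dfun_endo_ext _ _ _ (@phi_smooth _ _ M)) /app_endo !cst_ext_id xi_phi.
have D0 : der (hate (@phi R m M) p) (x0 p) 0 = 0.
  by rewrite (lin_der (hate_differentiable (@phi_smooth _ _ M) (cdom_refl p)))
    big1 // => i _; rewrite mxE scale0r.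
rewrite D0 mulmx0 subr0.
have FE u : der (hate (@phi R m M) p) (x0 p) u = nP p u
    + conn p (x0 p) u *m F p - F p *m conn p (x0 p) u.
  have [_ _ /(_ u) <-] := isD_F p; rewrite /cov; mx_ring.
rewrite FE mulmxBr mulmxDr !mulmxA xi_phi mul0mx subr0 mulmxDl xi_nP.
by rewrite mulNmx -!mulmxA phi_eta !mulmx0 oppr0 addr0 zeromxE.
Qed.

Lemma gtr_dOmega p (beta : R) :
  (forall Y v w, dOmega p Y v w = 2 * beta * eta_wedge_Omega p Y v w) ->
  gtr (Gi p) (fun v w => (w *m F p) *m nP p v) = ((2 * m)%:R * beta) *: X p.
Proof.
move=> H; set K := gtr _ _.
suff KZ Z : (K *m G p *m Z^T) 0 0 = ((2 * m)%:R * beta) * (X p *m G p *m Z^T) 0 0.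
  apply: (can_inj (mulmxK (met_unit p))); apply/rowP => i.
  have := KZ (delta_mx 0 i); rewrite trmx_delta -!colE ![col _ _ _ _]mxE => ->.
  by rewrite -scalemxAl scalemxE.
have skew v w (u : 'rV[R]_d) :
    (w *m G p *m (u *m nP p v)^T) 0 0 = - (w *m nP p v *m G p *m u^T) 0 0.
  by rewrite trmx_mul -[in RHS](mulmxA w) nP_skew mulmxN mulNmx oppmxE opprK !mulmxA.
have swp (A B : 'rV[R]_d) : (A *m G p *m B^T) 0 0 = (B *m G p *m A^T) 0 0.
  by rewrite -[A *m _ *m _]tr_mx11 !trmx_mul !trmxK met_sym mulmxA.
have L (B : 'rV[R]_d -> 'rV[R]_d -> 'rV[R]_d) (A : 'cV[R]_d) :
    gtr (Gi p) (fun v w => ((B v w *m A) 0 0 : R^o)) = (gtr (Gi p) B *m A) 0 0.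
  rewrite -gtr_mulmx /gtr summxE; apply: eq_bigr => i _; rewrite summxE.
  by apply: eq_bigr => j _; rewrite [RHS]scalemxE.
have KN : gtr (Gi p) (fun v w => v *m nP p (w *m F p)) = - K.
  rewrite (gtr_tr _ (fun w v => v *m nP p (w *m F p))) trmx_inv met_sym.
  rewrite (gtr_push1 _ _ (nP_bilin p)) /K (gtr_push2 _ _ (nP_bilin p)) -gtrNl.
  by rewrite -phi_skewi trmx_mul trmx_inv met_sym.
have E1 : gtr (Gi p) (fun v w => (dOmega p v (w *m F p) Z : R^o))
    = - 2 * (K *m G p *m Z^T) 0 0.
  transitivity (gtr (Gi p) (fun v w => (- (w *m F p *m nP p v *m (G p *m Z^T)) 0 0
      + (v *m nP p (w *m F p) *m (G p *m Z^T)) 0 0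
      + (v *m (G p *m (F p *m nP p Z)^T) *m w^T) 0 0 *: (1 : R^o) : R^o))).
    apply: eq_gtr => v w; rewrite dOmegaE skew (swp Z) !trmx_mul !mulmxA.
    by rewrite [_%:A]mulr1.
  rewrite gtrDr gtrDr gtrNr L L KN gtr_bil -/K.
  have -> : \tr (Gi p *m (G p *m (F p *m nP p Z)^T)^T) = 0.
    rewrite trmx_mul trmxK met_sym mxtrace_mulC -mulmxA mulmxV ?met_unit // mulmx1.
    exact: tr_phi_nP.
  by rewrite scale0r addr0 mulNmx oppmxE !mulmxA; ring.
have E2 : gtr (Gi p) (fun v w => (dOmega p v (w *m F p) Z : R^o))
    = 2 * beta * ((Z *m E p) 0 0 * - (2 * m)%:R).
  transitivity (gtr (Gi p) (fun v w => ((2 * beta) *: ((v *m E p) 0 0 *: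
      ((w *m F p *m G p *m (Z *m F p)^T) 0 0 : R^o) + (Z *m E p) 0 0 *:
      ((v *m (G p *m (F p *m F p)^T) *m w^T) 0 0 *: (1 : R^o))) : R^o))).
    apply: eq_gtr => v w; rewrite H /eta_wedge_Omega /Defs.eta !OmegaE.
    rewrite -(mulmxA w (F p) (E p)) phi_eta mulmx0 zeromxE mul0r addr0.
    congr (_ * (_ + _ * _)); by rewrite [_%:A]mulr1 !trmx_mul !mulmxA.
  rewrite gtrZr gtrDr gtrZr gtr_bil gtr_col; last first.
    apply/lin_linearP => k u v; rewrite !mulmxDl -!scalemxAl; mx_entries.
    by [].
  rewrite eta_flati_tr xi_phi !mul0mx zeromxE add0r trmx_mul trmxK met_sym.
  rewrite mxtrace_mulC -mulmxA mulmxV ?met_unit // mulmx1 tr_phi2.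
  by rewrite [_%:A]mulr1.
have ZE : (Z *m E p) 0 0 = (X p *m G p *m Z^T) 0 0 by rewrite eta_flat mulmxA swp.
by rewrite E1 ZE in E2; move: E2; set KZ := (K *m _ *m _) 0 0; set XZ := (X p *m _ *m _) 0 0; lra.
Qed.

End AcmTraces.

Lemma lin_id {R : realFieldType} {a} : lin (fun v : 'rV[R]_a => v).
Proof. exact: (lin_linear idfun). Qed.

(** * Traces computed from the defining equations of the classes *)

Section AcmClasses.
Context {R : realType} {m : nat} (M : acm R m).
Local Notation d := (m.*2.+1).
Implicit Types (p q : M) (v w Y Z : 'rV[R]_d).
Local Notation F p := (@phi R m M p).
Local Notation X p := (@xi R m M p).
Local Notation E p := (@eta_vec R m M p).
Local Notation G p := (@met R d M p).
Local Notation Gi p := (invmx (@met R d M p)).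

Lemma gtr_eta1 p : gtr (Gi p) (fun v w => (v *m E p) 0 0 *: w) = X p.
Proof. by rewrite gtr_col ?eta_flati_tr //; exact: lin_id. Qed.

Lemma gtr_eta2 p : gtr (Gi p) (fun v w => (w *m E p) 0 0 *: v) = X p.
Proof. by rewrite (@gtr_eta _ _ _ p id) //; exact: lin_id. Qed.

Lemma natr_d : d%:R - 1 = (2 * m)%:R :> R.
Proof. by rewrite -muln2 mulnC -natr1 addrK. Qed.

Lemma double_inj_row (A B : 'rV[R]_d) : A *+ 2 = B *+ 2 -> A = B.
Proof.
move=> AB; apply/rowP => i; have := congr1 (fun C : 'rV[R]_d => C 0 i) AB.
by rewrite !mulr2n; mx_entries; lra.
Qed.

Lemma etaE p v : Defs.eta p v = (v *m E p) 0 0. Proof. by []. Qed.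

Lemma eta_xi1 p : (X p *m E p) 0 0 = 1.
Proof. exact: eta_xi. Qed.

Lemma gmet_xi p : (X p *m G p *m (X p)^T) 0 0 = 1.
Proof. by rewrite -mulmxA -eta_flat eta_xi1. Qed.

Lemma tr_phi_conj p (A : 'M[R]_d) : A *m E p = 0 -> \tr (F p *m A *m F p) = - \tr A.
Proof.
move=> AE; rewrite mxtrace_mulC mulmxA phi_phi mulmxDl linearD /= mulNmx mul1mx linearN /=.
by rewrite -mulmxA mxtrace_mulC -mulmxA AE mulmx0 linear0 addr0.
Qed.

(** Tracing Q yields [Dphi] twice. The terms in [th] vanish as phi xi = 0, and the others leave the
    coefficient 2(2m+1) - 2 = 4m. *)
Lemma trace_Q p (wp th : R) :
  (forall v w, w *m nP p v + v *m nP p w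
     = wp *: ((2 * (v *m G p *m w^T) 0 0) *: X p - (v *m E p) 0 0 *: w
              - (w *m E p) 0 0 *: v)
       - th *: ((v *m E p) 0 0 *: (w *m F p) + (w *m E p) 0 0 *: (v *m F p))) ->
  Dphi p = ((2 * m)%:R * wp) *: X p.
Proof.
move=> H; apply: double_inj_row.
have -> : Dphi p *+ 2 = gtr (Gi p) (fun v w => w *m nP p v + v *m nP p w).
  rewrite gtrDr (gtr_tr _ (fun w v => v *m nP p w)) trmx_inv met_sym.
  by rewrite mulr2n.
rewrite (eq_gtr _ H) gtrDr gtrNr !gtrZr !gtrDr !gtrNr gtr_eta1 gtr_eta2.
have -> : gtr (Gi p) (fun v w => (2 * (v *m G p *m w^T) 0 0) *: X p) = (2 * d%:R) *: X p.
  rewrite -scalerA -(gtr_met p) -gtrZr; apply: eq_gtr => v w; by rewrite scalerA.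
rewrite gtr_col; last by apply: (lin_comp (F := id)); exact: lin_id.
rewrite (@gtr_eta _ _ _ p (fun v => v *m F p)); last by apply: (lin_comp (F := id)); exact: lin_id.
rewrite eta_flati_tr xi_phi addr0 scaler0 subr0 -natr_d mulr2n.
mx_ring.
Qed.

(** At (xi, xi) the right-hand side is 0. At (v, xi), composed with phi, the equation expresses
    nabla xi by (nabla_xi phi) composed with phi and by phi, both of trace 0. *)
Lemma geodesic_Q p (wp : R) :
  (forall v w, w *m nP p v + v *m nP p w
     = wp *: ((2 * (v *m G p *m w^T) 0 0) *: X p - (v *m E p) 0 0 *: w
              - (w *m E p) 0 0 *: v)) ->
  nX p (X p) = 0 /\ \tr (nXm p) = 0.
Proof.
move=> H; split.
  apply: geodesicP; apply: double_inj_row; rewrite mul0rn mulr2n H gmet_xi eta_xi1.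
  by rewrite mulr1 scale1r; mx_ring.
have row_eq v : v *m nXm p = - (v *m (nP p (X p) *m F p)) - wp *: (v *m F p).
  have := congr1 (fun A => A *m F p) (H v (X p)); rewrite xi_nP eta_xi1 scale1r.
  rewrite -(mulmxA v) -eta_flat nXE mulmxDl mulNmx -[v *m nXm p *m F p *m F p]mulmxA phi_phi.
  rewrite mulmxDr mulmxN mulmx1 mulmxA -[v *m nXm p *m E p]mulmxA nXm_eta mulmx0 mul0mx addr0.
  rewrite opprK -scalemxAl !mulmxBl -!scalemxAl xi_phi !scaler0.
  by move=> /(canRL (addrK _)) ->; rewrite mulmxA; mx_ring.
have -> : nXm p = - (nP p (X p) *m F p) - wp *: F p.
  by apply/row_matrixP => i; rewrite !rowE row_eq mulmxBr mulmxN -scalemxAr.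
by rewrite linearB linearN /= mxtraceZ mxtrace_mulC tr_phi_nP tr_phi mulr0 oppr0 addr0.
Qed.

(** The parameter k = 1 is the quasi-K-Sasakian and k = 0 the quasi-K-cosymplectic case. At (v, xi),
    composed with phi, the equation gives nabla xi = - 2k phi + phi (nabla xi) phi; the last term
    has trace - div xi, so div xi = 0. *)
Lemma trace_P p (k : R) :
  (forall v w, w *m nP p v + (w *m F p) *m nP p (v *m F p)
    = (2 * k * (v *m G p *m w^T) 0 0) *: X p - (2 * k * (w *m E p) 0 0) *: v
      + (w *m E p) 0 0 *: nX p (v *m F p)) ->
  [/\ nX p (X p) = 0, \tr (nXm p) = 0 & Dphi p = ((2 * m)%:R * k) *: X p].
Proof.
move=> H.
have nX0 : nX p 0 = 0 by rewrite nXE mul0mx.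
have g0 : X p *m nP p (X p) = 0.
  have := H (X p) (X p); rewrite xi_phi mul0mx addr0 gmet_xi eta_xi1 nX0 scaler0 addr0.
  by rewrite subrr.
split; first exact: geodesicP.
  have row_eq v : v *m nXm p = - (2 * k) *: (v *m F p) + v *m (F p *m nXm p *m F p).
    have := congr1 (fun A => A *m F p) (H v (X p)).
    rewrite xi_phi mul0mx addr0 xi_nP eta_xi1 -(mulmxA v) -eta_flat !nXE.
    rewrite mulNmx -[v *m nXm p *m F p *m F p]mulmxA phi_phi mulmxDr mulmxN mulmx1 mulmxA.
    rewrite -[v *m nXm p *m E p]mulmxA nXm_eta mulmx0 mul0mx addr0 opprK => ->.
    rewrite !mulmxDl mulNmx -!scalemxAl xi_phi scaler0 scale1r !mulmxA.
    by mx_ring.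
  have E1 : nXm p = - (2 * k) *: F p + F p *m nXm p *m F p.
    by apply/row_matrixP => i; rewrite !rowE row_eq mulmxDr -scalemxAr.
  have : \tr (nXm p) = - \tr (nXm p).
    rewrite {1}E1 linearD /= mxtraceZ tr_phi mulr0 add0r.
    by rewrite tr_phi_conj // nXm_eta.
  by lra.
apply: double_inj_row; have := gtr_P p; rewrite g0 subr0 => <-.
rewrite (eq_gtr _ H) !gtrDr gtrNr (@gtr_eta _ _ _ p (fun v => nX p (v *m F p))); last first.
  exact: lin_comp (nX_lin p).
rewrite xi_phi nX0 addr0.
have -> : gtr (Gi p) (fun v w => (2 * k * (v *m G p *m w^T) 0 0) *: X p)
    = (2 * k * d%:R) *: X p.
  rewrite -scalerA -(gtr_met p) -gtrZr; apply: eq_gtr => v w; by rewrite scalerA.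
have -> : gtr (Gi p) (fun v w => (2 * k * (w *m E p) 0 0) *: v) = (2 * k) *: X p.
  rewrite -gtr_eta2 -gtrZr; apply: eq_gtr => v w; by rewrite scalerA.
rewrite -natr_d mulr2n; mx_ring.
Qed.

(** The defining equation at (xi, xi) gives h xi = - (nabla_xi phi) xi, whereas h xi = 0 by the
    formula for h; so xi is geodesic. At (v, xi) it expresses nabla xi by phi and h phi, and
    cyclicity of the trace shows that h phi has trace 0. *)
Lemma quasi_contact_facts p : quasi_contact_metric M ->
  [/\ nX p (X p) = 0, \tr (nXm p) = 0 & Dphi p = (2 * m)%:R *: X p].
Proof.
move=> QC; have H v w : w *m nP p v + (w *m F p) *m nP p (v *m F p)
    = (2 * (v *m G p *m w^T) 0 0) *: X p - (w *m E p) 0 0 *: (v + (v *m E p) 0 0 *: X p + hten p v).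
  by rewrite -PtenE QC.
have hxi : hten p (X p) = - (X p *m nP p (X p)).
  have := H (X p) (X p); rewrite xi_phi mul0mx addr0 gmet_xi eta_xi1 mulr1 !scale1r.
  by move: (hten p (X p)) => h ->; mx_ring.
have hxi2 : hten p (X p) = 0.
  by rewrite htenE xi_phi mul0mx xi_nP -nXE subr0 addNr scaler0.
have g0 : nX p (X p) = 0.
  by apply: geodesicP; rewrite hxi2 in hxi; rewrite -[LHS]opprK -hxi oppr0.
have [hm [hmE hE]] : exists hm : 'M[R]_d,
    hm = 2^-1 *: (nP p (X p) - F p *m nXm p + nXm p *m F p) /\
    forall v, hten p v = v *m hm.
  eexists; split=> [//|v].
  by rewrite htenE -scalemxAr mulmxDr mulmxBr !mulmxA.
split=> //.
  have row_eq v : v *m nXm p = - (v *m F p) - v *m (hm *m F p).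
    have := congr1 (fun A => A *m F p) (H v (X p)).
    rewrite xi_phi mul0mx addr0 xi_nP eta_xi1 -(mulmxA v) -eta_flat !nXE hE scale1r.
    rewrite mulNmx -[v *m nXm p *m F p *m F p]mulmxA phi_phi mulmxDr mulmxN mulmx1 mulmxA.
    rewrite -[v *m nXm p *m E p]mulmxA nXm_eta mulmx0 mul0mx addr0 opprK => ->.
    rewrite [LHS]mulmxBl !mulmxDl -!scalemxAl xi_phi !scaler0 -[v *m hm *m F p]mulmxA.
    by mx_ring.
  have E1 : nXm p = - F p - hm *m F p.
    by apply/row_matrixP => i; rewrite !rowE row_eq mulmxBr mulmxN.
  rewrite E1 linearB linearN /= tr_phi oppr0 sub0r hmE -scalemxAl mulmxDl mulmxBl.
  rewrite mxtraceZ linearD linearB /= [\tr (nP p _ *m _)]mxtrace_mulC tr_phi_nP.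
  rewrite [\tr (F p *m nXm p *m F p)]mxtrace_mulC mulmxA -[nXm p *m F p *m F p]mulmxA.
  by rewrite [\tr (nXm p *m _)]mxtrace_mulC sub0r addNr mulr0 oppr0.
apply: double_inj_row; have := gtr_P p; rewrite xi_nP g0 mul0mx oppr0 subr0 => <-.
rewrite (eq_gtr _ H) gtrDr gtrNr.
have -> : gtr (Gi p) (fun v w => (2 * (v *m G p *m w^T) 0 0) *: X p) = (2 * d%:R) *: X p.
  rewrite -scalerA -(gtr_met p) -gtrZr; apply: eq_gtr => v w; by rewrite scalerA.
rewrite (@gtr_eta _ _ _ p (fun v => v + (v *m E p) 0 0 *: X p + hten p v)).
  rewrite eta_xi1 scale1r hxi2 addr0 -natr_d mulr2n; mx_ring.
apply/lin_linearP => k u v; rewrite !hE !mulmxDl -!scalemxAl; mx_entries.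
by mx_ring.
Qed.

Lemma dOmega0_facts p : (forall Y v w, dOmega p Y v w = 0) -> nX p (X p) = 0 ->
  \tr (nXm p) = 0 /\ Dphi p *m F p = 0.
Proof.
move=> H g0; have K0 := gtr_dOmega (beta := 0) (p := p).
have {K0} := K0 ltac:(by move=> Y v w; rewrite H mulr0 mul0r).
rewrite mulr0 scale0r gtr_phi_nP g0 addr0 => H0.
have t0 : \tr (nXm p) = 0.
  have := congr1 (fun A : 'rV[R]_d => (A *m E p) 0 0) H0.
  rewrite mul0mx zeromxE mulmxBl -scalemxAl -mulmxA phi_eta mulmx0 subr0 scalemxE.
  by rewrite eta_xi1 mulr1.
by split=> //; move: H0; rewrite t0 scale0r sub0r => /eqP; rewrite oppr_eq0 => /eqP.
Qed.

Lemma gtr_nE_phi p : gtr (Gi p) (fun v w => v *m nE p (w *m F p))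
  = - gtr (Gi p) (fun v w => (w *m F p) *m nE p v).
Proof.
rewrite (gtr_tr _ (fun w v => v *m nE p (w *m F p))) trmx_inv met_sym.
rewrite (gtr_push1 _ _ (nE_bilin p)) (gtr_push2 _ _ (nE_bilin p)) -gtrNl.
by rewrite -phi_skewi trmx_mul trmx_inv met_sym.
Qed.

(* the xi-component of the trace of nabla phi is a trace of d eta *)
Lemma Dphi_eta_deta p (alpha : R) : (forall v w, deta p v w = alpha * Omega p v w) ->
  (Dphi p *m E p) 0 0 = (2 * m)%:R * alpha.
Proof.
move=> H; rewrite Dphi_eta oppmxE.
have E1 : gtr (Gi p) (fun v w => (deta p v (w *m F p) : R^o))
    = (gtr (Gi p) (fun v w => (w *m F p) *m nE p v)) 0 0.
  transitivity ((gtr (Gi p) (fun v w => 2^-1 *: ((w *m F p) *m nE p v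
      - v *m nE p (w *m F p)))) 0 0).
    rewrite /gtr summxE; apply: eq_bigr => i _; rewrite summxE.
    by apply: eq_bigr => j _; rewrite detaE; mx_entries.
  rewrite gtrZr gtrDr gtrNr gtr_nE_phi opprK scalemxE addmxE.
  by move: (gtr (Gi p) _) => z; lra.
rewrite -E1.
transitivity (- gtr (Gi p) (fun v w =>
    (v *m (alpha *: (G p *m (F p *m F p)^T)) *m w^T) 0 0 *: (1 : R^o))).
  congr (- _); apply: eq_gtr => v w; rewrite H OmegaE [_%:A]mulr1.
  by rewrite -scalemxAr -scalemxAl scalemxE !trmx_mul !mulmxA.
have TE : (alpha *: (G p *m (F p *m F p)^T))^T = alpha *: (F p *m F p *m G p).
  by rewrite linearZ /= [(G p *m _)^T]trmx_mul trmxK met_sym.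
rewrite gtr_bil TE -scalemxAr mxtraceZ mxtrace_mulC.
by rewrite mulmxK ?met_unit // tr_phi2 [_%:A]mulr1; ring.
Qed.

(** The trace of d Omega yields div xi as its xi-component and phi [Dphi] = 0 as the rest; the
    remaining eta-component of [Dphi] is a trace of d eta. *)
Lemma kenmotsu_facts p (beta : R) :
  (forall Y v w, dOmega p Y v w = 2 * beta * eta_wedge_Omega p Y v w) ->
  (forall v w, deta p v w = 0) ->
  [/\ nX p (X p) = 0, \tr (nXm p) = (2 * m)%:R * beta & Dphi p = 0].
Proof.
move=> H De; have g0 : nX p (X p) = 0 by apply: nX_xi_of_deta => Y.
have := gtr_dOmega H; rewrite gtr_phi_nP g0 addr0 => H0.
have tb : \tr (nXm p) = (2 * m)%:R * beta.
  have := congr1 (fun A : 'rV[R]_d => (A *m E p) 0 0) H0.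
  rewrite mulmxBl -!scalemxAl -mulmxA phi_eta mulmx0 subr0 !scalemxE.
  by rewrite eta_xi1 !mulr1.
split=> //; apply: (@phi_inj _ _ M p).
  by move: H0; rewrite tb -[RHS]subr0 => /addrI/oppr_inj.
rewrite [LHS]mx11_scalar (@Dphi_eta_deta p 0) ?mulr0 ?raddf0 //.
by move=> v w; rewrite De mul0r.
Qed.

End AcmClasses.

(** * Orthonormal frames and the notions defined by them *)

Lemma onb_dual {R : realFieldType} {d k} (G : 'M[R]_d) (B : 'M[R]_(k, d)) :
  k = d -> G \in unitmx -> B *m G *m B^T = 1%:M -> B^T *m B = invmx G.
Proof.
move=> kd GU; case: d / kd in G B GU * => BGB.
have /mulmx1_unit[_ BtU] := BGB.
have e1 : (B *m G) *m B^T = 1%:M by [].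
have e2 := mulmx1C e1.
apply: (can_inj (mulmxK GU)); rewrite mulVmx //.
by rewrite -mulmxA.
Qed.

Lemma onb_sum {R : realFieldType} {d} (I : finType) (G : 'M[R]_d) (u : I -> 'rV[R]_d) :
  #|I| = d -> G \in unitmx ->
  (forall i j, (u i *m G *m (u j)^T) 0 0 = (i == j)%:R) ->
  \sum_i (u i)^T *m u i = invmx G.
Proof.
move=> cI GU ug; pose B : 'M[R]_(#|I|, d) := \matrix_k u (enum_val k).
rewrite -(@onb_dual _ _ _ G B) //.
  apply/matrixP => i j; rewrite summxE [RHS]mxE (reindex (@enum_val I xpredT)) /=.
    by apply: eq_bigr => k _; rewrite !mxE big_ord1 !mxE.
  by apply: onW_bij; exact: enum_val_bij.
apply/matrixP => k l; rewrite [RHS]mxE -(inj_eq enum_val_inj) -ug.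
have rB j : 'e_j *m B = u (enum_val j) by rewrite -rowE rowK.
by rewrite -[LHS]form_entry !mulmxA rB -!mulmxA -trmx_mul rB mulmxA.
Qed.

Section FrameExistence.
Context {R : realType} {d c : nat} (G F : 'M[R]_d) (E : 'M[R]_(d, c)).
Context (GT : G^T = G) (Gpos : forall v, v != 0 -> 0 < bil G v v).
Context (skew : F *m G = - (G *m F^T)) (t : nat) (tF : t = 2 \/ t = 1 /\ F = 0).
Local Notation g v w := ((v *m G *m w^T) 0 0).

Let gC (v w : 'rV[R]_d) : g v w = g w v.
Proof. by rewrite -[v *m _ *m _]tr_mx11 !trmx_mul !trmxK GT mulmxA. Qed.

Let gF (v w : 'rV[R]_d) : g (v *m F) w = - g v (w *m F).
Proof. by rewrite -(mulmxA v) skew trmx_mul mulmxN mulNmx oppmxE !mulmxA. Qed.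

(* t = 1 covers plain orthonormal bases (F = 0) *)
Lemma frame_exists k : (k * t + c <= d)%N -> exists e : 'I_k -> 'rV[R]_d,
  [/\ forall i j, g (e i) (e j) = (i == j)%:R, forall i j, g (e i) (e j *m F) = 0
    & forall i, e i *m E = 0].
Proof.
elim: k => [_|k IH kd]; first by exists (fun=> 0); split=> [[]|[]|[]].
have [|e [e1 e2 e3]] := IH; first lia.
pose A1 : 'M[R]_(k, d) := \matrix_i (e i *m G).
pose A2 : 'M[R]_(k, d) := \matrix_i (e i *m F *m G).
have kerC j (C : 'M[R]_(d, j)) : (j < d)%N -> exists2 x : 'rV[R]_d, x != 0 & x *m C = 0.
  move=> jd; have : (0 < \rank (kermx C))%N.
    by rewrite mxrank_ker subn_gt0 (leq_ltn_trans (rank_leq_col C)).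
  by rewrite lt0n mxrank_eq0 => /rowV0Pn[x /sub_kermxP xC x0]; exists x.
have [x [x0 xe xeF xE]] : exists x : 'rV[R]_d,
    [/\ x != 0, x *m A1^T = 0, x *m A2^T = 0 & x *m E = 0].
  case: tF => [t2|[t1 F0]].
    have [|x x0] := kerC _ (row_mx (row_mx A1^T A2^T) E); first by move: kd; rewrite t2; lia.
    rewrite !mul_mx_row => /eqP; rewrite !row_mx_eq0 => /andP[/andP[/eqP ? /eqP ?] /eqP ?].
    by exists x.
  have [|x x0] := kerC _ (row_mx A1^T E); first by move: kd; rewrite t1; lia.
  rewrite !mul_mx_row => /eqP; rewrite !row_mx_eq0 => /andP[/eqP ? /eqP ?].
  exists x; split=> //; have -> : A2 = 0.
    by apply/row_matrixP => i; rewrite rowK F0 mulmx0 mul0mx row0.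
  by rewrite trmx0 mulmx0.
have gA (A : 'M[R]_(k, d)) i : (x *m A^T) 0 i = (row i A *m x^T) 0 0.
  by rewrite [LHS]mxE [RHS]mxE; apply: eq_bigr => l _; rewrite !mxE mulrC.
have gx i : g (e i) x = 0.
  by have := congr1 (fun A : 'rV[R]_k => A 0 i) xe; rewrite zeromxE gA rowK.
have gxF i : g (e i *m F) x = 0.
  by have := congr1 (fun A : 'rV[R]_k => A 0 i) xeF; rewrite zeromxE gA rowK.
have xx : 0 < g x x := Gpos x0.
pose a := (Num.sqrt (g x x))^-1.
have gZ r s (v w : 'rV[R]_d) : g (r *: v) (s *: w) = r * s * g v w.
  by rewrite linearZ -!scalemxAl -scalemxAr !scalemxE mulrA.
have aa : g (a *: x) (a *: x) = 1.
  by rewrite gZ -expr2 exprVn sqr_sqrtr ?ltW // mulVf // gt_eqF.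
have xFx : g x (x *m F) = 0 by have := gF x x; rewrite gC; lra.
exists (fun i => if unlift ord_max i is Some j then e j else a *: x); split=> i.
- move=> j; case: (unliftP ord_max i) => [i' ->|->]; case: (unliftP ord_max j) => [j' ->|->].
  + by rewrite (inj_eq lift_inj).
  + by rewrite -[e i']scale1r gZ gx mulr0 eq_sym (negPf (neq_lift _ _)).
  + by rewrite gC -[e j']scale1r gZ gx mulr0 (negPf (neq_lift _ _)).
  + by rewrite eqxx.
- move=> j; case: (unlift ord_max i) => [i'|]; case: (unlift ord_max j) => [j'|].
  + exact: e2.
  + rewrite -[_ *: _ *m F]scalemxAl -[e i']scale1r gZ.
    by have := gF (e i') x; rewrite gxF => /esym/eqP; rewrite oppr_eq0 => /eqP->; rewrite mulr0.
  + by rewrite gC -[_ *m F]scale1r gZ gxF mulr0.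
  + by rewrite -[_ *: _ *m F]scalemxAl gZ xFx mulr0.
- by case: (unlift ord_max i) => [i'|]; rewrite ?e3 // -scalemxAl xE scaler0.
Qed.
End FrameExistence.

Lemma form_inj {R : realType} {d} (G : 'M[R]_d) (A B : 'rV[R]_d) : G \in unitmx ->
  (forall Y : 'rV[R]_d, (A *m G *m Y^T) 0 0 = (B *m G *m Y^T) 0 0) -> A = B.
Proof.
move=> GU AB; apply: (can_inj (mulmxK GU)); apply/rowP => i.
have := AB (delta_mx 0 i); rewrite trmx_delta -!colE => h.
by move: h; rewrite [LHS]mxE [X in _ = X]mxE.
Qed.

Lemma gtr_frame {R : realFieldType} {d} {V : lmodType R} {I : finType} (u : I -> 'rV[R]_d)
    (P : 'M[R]_d) (T : 'rV[R]_d -> 'rV[R]_d -> V) :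
  bilin T -> \sum_i (u i)^T *m u i = P -> gtr P T = \sum_i T (u i) (u i).
Proof. by move=> bT <-; rewrite gtr_suml; apply: eq_bigr => i _; rewrite -bT. Qed.

Section AcmFrames.
Context {R : realType} {m : nat} (M : acm R m).
Local Notation d := (m.*2.+1).
Local Notation F p := (@phi R m M p).
Local Notation X p := (@xi R m M p).
Local Notation E p := (@eta_vec R m M p).
Local Notation G p := (@met R d M p).
Local Notation Gi p := (invmx (@met R d M p)).

Lemma acm_frame_exists p : exists e, @acm_frame R m M p e.
Proof.
have [|e [e1 e2 e3]] := @frame_exists R d 1 (G p) (F p) (E p) (met_sym p)
  (@met_pos _ _ M p) (phi_skew p) 2 (or_introl erefl) m; first by rewrite addn1 muln2.
exists e; split; last by rewrite gmetE gmet_xi.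
have exi i : gmet p (e i) (X p) = 0.
  by rewrite gmetE -mulmxA -eta_flat e3 zeromxE.
split=> //.
- move=> i j; have := phi_metric p (e i) (e j).
  by rewrite !e3 zeromxE mulr0 subr0 => ->; rewrite gmetE.
- by move=> i; rewrite gmetE -mulmxA -eta_flat -mulmxA phi_eta mulmx0 zeromxE.
Qed.

Lemma acm_frame_gtr p e {V : lmodType R} (T : 'rV[R]_d -> 'rV[R]_d -> V) :
  @acm_frame R m M p e -> bilin T ->
  gtr (Gi p) T = \sum_i T (e i) (e i) + \sum_i T (e i *m F p) (e i *m F p)
                 + T (X p) (X p).
Proof.
move=> [[e1 e2 e3 e4 e5] _] bT.
pose u (i : ('I_m + 'I_m) + 'I_1) := match i with
  | inl (inl i) => e i | inl (inr i) => e i *m F p | inr _ => X p end.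
rewrite (@gtr_frame _ _ _ _ u (Gi p)) //.
  by rewrite !big_sumType /= big_ord1.
have gC v w : gmet p v w = gmet p w v.
  by rewrite !gmetE -[v *m _ *m _]tr_mx11 !trmx_mul !trmxK met_sym mulmxA.
apply: onb_sum; first by rewrite !card_sum !card_ord addnn addn1.
  exact: met_unit.
move=> [[i|i]|i] [[j|j]|j] /=; rewrite -gmetE ?e1 ?e2 ?e3 ?e4 ?e5 //.
- by rewrite gC e3.
- by rewrite gC e4.
- by rewrite gC e5.
- by rewrite gmetE gmet_xi !ord1 eqxx.
Qed.

(** The term - phi (nabla_xi xi) of the definition is (nabla_xi phi) xi, the xi-part of the trace of
    nabla phi. So delta Omega is dual to [Dphi], whatever the frame. *)
Lemma delta_OmegaE p e Y : @acm_frame R m M p e ->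
  delta_Omega p e Y = (Dphi p *m G p *m Y^T) 0 0.
Proof.
move=> fe; rewrite /delta_Omega gmetE /Dphi (acm_frame_gtr fe (nP_bilin p)).
rewrite nabla_xiE -xi_nP; congr ((_ *m _ *m _) 0 0).
rewrite addrC; congr (_ + _); rewrite -big_split /=.
by apply: eq_bigr => i _; rewrite PtenE.
Qed.

Lemma classA7a_Dphi p : classA7a M -> Dphi p = (2 * m)%:R *: X p.
Proof.
move=> h; have [e fe] := acm_frame_exists p; apply: (form_inj (met_unit p)) => Y.
rewrite -(delta_OmegaE _ fe) h // etaE -!scalemxAl scalemxE; congr (_ * _).
by rewrite eta_flat -[Y *m _]tr_mx11 !trmx_mul trmxK met_sym.
Qed.

Lemma classB2a_facts (p : M) : classB2a M -> \tr (nXm p) = 0 /\ Dphi p = 0.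
Proof.
move=> [h1 h2]; split.
  by have := h1 p; rewrite /delta_eta divergence_xi => /eqP; rewrite oppr_eq0 => /eqP.
have [e fe] := acm_frame_exists p; apply: (form_inj (met_unit p)) => Y.
by rewrite -(delta_OmegaE _ fe) h2 // !mul0mx zeromxE.
Qed.
End AcmFrames.

(** * Almost Hermitian structures *)

HB.lock Definition nJ {R : realType} {n} {H : almost_hermitian R n} (p : H)
    (v : 'rV[R]_(n.*2)) :=
  cendo (@cplx R n H) p (chart p p) v.

Section AlmostHermitianTraces.
Context {R : realType} {n : nat} (H : almost_hermitian R n).
Local Notation d := (n.*2).
Local Notation x0 p := (chart p p).
Local Notation J p := (@cplx R n H p).
Local Notation G p := (@met R d H p).
Local Notation Gi p := (invmx (@met R d H p)).

Lemma cplx_cplx (p : H) : J p *m J p = - 1%:M.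
Proof.
apply/row_matrixP => i; rewrite rowE mulmxA cplx_sq rowE mulmxN mulmx1.
by [].
Qed.

Lemma cplx_met (p : H) : J p *m G p *m (J p)^T = G p.
Proof.
apply/matrixP => i j; have := @cplx_metric _ _ H p (delta_mx 0 i) (delta_mx 0 j).
by rewrite /gmet /bil trmx_mul !mulmxA -2!(mulmxA (delta_mx 0 i)) !form_entry.
Qed.

(** The algebra of almost contact structures applies with xi and eta replaced by 0. *)
Lemma cplx_skew (p : H) : J p *m G p = - (G p *m (J p)^T).
Proof.
apply: (@structure_skew R d (G p) (J p) 0 0) => //.
- by rewrite cplx_cplx mulmx0 addr0.
- by rewrite cplx_met mul0mx subr0.
- by rewrite mulmx0.
- by rewrite trmx0 mulmx0.
Qed.

Lemma isD_J (p : H) : isD (x0 p) (conn p (x0 p)) (conn p (x0 p)) (hate (@cplx R n H) p)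
  (J p) (nJ p).
Proof.
have := isD_endo (@cplx_smooth R n H) (cdom_refl p).
by rewrite hate_id nJ.unlock.
Qed.

Lemma nJ_lin (p : H) : lin (nJ p).
Proof. by apply: isD_lin (isD_J p); apply: conn_lin; exact: cdom_refl. Qed.

Lemma nJ_bilin (p : H) : bilin (fun v w => w *m nJ p v).
Proof. exact: bilin_mul (nJ_lin p). Qed.

Lemma nJ_cplx (p : H) v : nJ p v *m J p + J p *m nJ p v = 0.
Proof.
have h1 := isD_mul (isD_J p) (isD_J p).
have h2 := isD_opp (@isD_1 R d (x0 p) d (conn p (x0 p))).
apply: (etrans (isD_eq _ h1 h2 v)); last by rewrite oppr0.
apply: near_hat_all => q pq; rewrite !hateE //.
have -> : tmx p q q *m J q *m tmx q p q *m (tmx p q q *m J q *m tmx q p q)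
  = tmx p q q *m J q *m (tmx q p q *m tmx p q q) *m J q *m tmx q p q.
  by rewrite !mulmxA.
rewrite tmxK //; last exact: cdom_refl.
rewrite mulmx1 -[_ *m J q *m J q]mulmxA cplx_cplx mulmxN mulmx1 mulNmx tmxK //.
exact: cdom_refl.
Qed.

Definition DJ (p : H) : 'rV[R]_d := gtr (Gi p) (fun v w => w *m nJ p v).

Lemma nabla_cplxE (p : H) v w : nabla_cplx p v w = w *m nJ p v.
Proof. by rewrite /nabla_cplx nabla_endoE ?nJ.unlock //; exact: cplx_smooth. Qed.

Lemma ah_frame_exists (p : H) : exists e, @ah_frame R n H p e.
Proof.
have [|e [e1 e2 e3]] := @frame_exists R d 0 (G p) (J p) 0 (met_sym p)
  (@met_pos _ _ H p) (cplx_skew p) 2 (or_introl erefl) n; first by rewrite addn0 muln2.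
exists e; split=> [i j|i j|i j]; rewrite ?cplx_metric gmetE; first exact: e1.
  exact: e1.
exact: e2.
Qed.

Lemma ah_frame_gtr (p : H) e {V : lmodType R} (T : 'rV[R]_d -> 'rV[R]_d -> V) :
  @ah_frame R n H p e -> bilin T ->
  gtr (Gi p) T = \sum_i T (e i) (e i) + \sum_i T (e i *m J p) (e i *m J p).
Proof.
move=> [e1 e2 e3] bT.
pose u (i : 'I_n + 'I_n) := match i with
  | inl i => e i | inr i => e i *m J p end.
rewrite (@gtr_frame _ _ _ _ u (Gi p)) //; first by rewrite !big_sumType.
have gC v w : gmet p v w = gmet p w v.
  by rewrite !gmetE -[v *m _ *m _]tr_mx11 !trmx_mul !trmxK met_sym mulmxA.
apply: onb_sum; first by rewrite !card_sum !card_ord addnn.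
  exact: met_unit.
move=> [i|i] [j|j] /=; rewrite -gmetE ?e1 ?e2 ?e3 //.
by rewrite gC e3.
Qed.

(** nabla J anticommutes with J, so the frame sum, composed with J, is minus the trace of nabla
    J. *)
Lemma semi_kahler_atP (p : H) : semi_kahler_at p <-> DJ p = 0.
Proof.
have key e : @ah_frame R n H p e ->
    (\sum_i SH p (e i *m J p) (e i)) *m J p = - DJ p.
  move=> fe; rewrite /DJ (ah_frame_gtr fe (nJ_bilin p)) mulmx_suml opprD -!sumrN.
  rewrite -big_split /=; apply: eq_bigr => i _; rewrite /SH !nabla_cplxE.
  have swap v : nJ p v *m J p = - (J p *m nJ p v).
    by apply/eqP; rewrite -addr_eq0 nJ_cplx.
  rewrite mulmxBl -!mulmxA !swap !mulmxN opprK addrC; congr (_ + _).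
  by rewrite !mulmxA -[e i *m _ *m _]mulmxA cplx_cplx mulmxN mulmx1 mulNmx.
split=> [h|D0 e /key].
  have [e fe] := ah_frame_exists p; have := key e fe; rewrite h // mul0mx.
  by move/esym/eqP; rewrite oppr_eq0 => /eqP.
rewrite D0 oppr0 => /(congr1 (fun v => v *m J p)).
by rewrite mul0mx cplx_sq => /eqP; rewrite oppr_eq0 => /eqP.
Qed.

End AlmostHermitianTraces.

(** * Second order identities on the classes *)

Section SecondOrder.
Context {R : realType} {d m n : nat} (U : set 'rV[R]_d) (A : 'rV[R]_d -> 'M[R]_(m, n)).
Context (Uo : open U) (As : smooth_on U A).

Lemma smooth_on_der v : smooth_on U (fun x => der A x v).
Proof.
have -> : (fun x => der A x v) = 'D_v A by apply/funext => x; rewrite derE.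
exact: smooth_on_derive.
Qed.

Lemma smooth_on_der_differentiable v x : U x -> differentiable (fun y => der A y v) x.
Proof. exact: (smooth_on_differentiable Uo (smooth_on_der v)). Qed.

Lemma der2_sym u v x : U x ->
  der (fun y => der A y v) x u = der (fun y => der A y u) x v.
Proof.
move=> Ux; have e w : (fun x => der A x w) = 'D_w A by apply/funext => y; rewrite derE.
by rewrite !e !derE; exact: (smooth_on_clairaut _ _ Uo As Ux).
Qed.
End SecondOrder.

(** * Closedness of Omega on contact metric manifolds *)

Section ContactClosed.
Context {R : realType} {m : nat} (M : acm R m).
Local Notation d := (m.*2.+1).
Local Notation x0 p := (chart p p).
Local Notation F p := (@phi R m M p).
Local Notation X p := (@xi R m M p).
Local Notation G p := (@met R d M p).
Local Notation eh p := (hatc (@eta_vec R m M) p).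
Local Notation oh p := (fun x => hatg p x *m (hate (@phi R m M) p x)^T).

(** The contact condition in one chart, at all points of its domain; in this form it can be
    differentiated. *)
Lemma deta_local (al : R) p q (v w : 'rV[R]_d) :
  (forall q v w, @deta R m M q v w = al * Omega q v w) -> cdom p q ->
  (w *m der (eh p) (chart p q) v) 0 0 - (v *m der (eh p) (chart p q) w) 0 0
  = 2 * al * (v *m oh p (chart p q) *m w^T) 0 0.
Proof.
move=> h pq; have qq := cdom_refl q.
have := h q (v *m tmx p q q) (w *m tmx p q q); rewrite detaE OmegaE.
have nEE u u' : (u *m tmx p q q) *m nE q (u' *m tmx p q q)
    = u *m (der (eh p) (chart p q) u' - conn p (chart p q) u' *m eh p (chart p q)).
  rewrite nE.unlock (ccov_trans (p := p) _ (@eta_smooth R m M) pq qq).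
  rewrite -!mulmxA (mulmxA (tmx p q q)) tmxK // mulmx1 mul1mx /ccov /cov mulmx0 addr0.
  by [].
rewrite !nEE !mulmxBr [v *m (conn _ _ _ *m _)]mulmxA [w *m (conn _ _ _ *m _)]mulmxA.
rewrite (conn_sym v w pq); mx_entries => e.
have -> : v *m (hatg p (chart p q) *m (hate (@phi R m M) p (chart p q))^T) *m w^T
    = v *m tmx p q q *m G q *m (w *m tmx p q q *m F q)^T.
  rewrite hatgE // hateE // !trmx_mul -!mulmxA (mulmxA (tmx p q q)^T) -(trmx_mul (tmx q p q)).
  by rewrite tmxK // trmx1 mul1mx.
by move: e; lra.
Qed.

(** 0 = d(d eta) = alpha d Omega. As alpha is constant, the derivative of the contact condition
    writes alpha times a derivative of Omega as a difference of second derivatives of eta, and their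
    cyclic sum is 0. *)
Lemma contact_dOmega (al : R) (p : M) Y v w : al != 0 ->
  (forall q v w, @deta R m M q v w = al * Omega q v w) -> dOmega p Y v w = 0.
Proof.
move=> al0 h; pose U := chart p @` cdom p.
have Uo : open U by exact: chart_dom_open.
have Ux : U (x0 p) by exists p => //; exact: cdom_refl.
have es : smooth_on U (eh p) by apply: hatc_smooth; exact: eta_smooth.
pose b (a u c : 'rV[R]_d) : R := (u *m der (oh p) (x0 p) a *m c^T) 0 0.
have odiff : differentiable (oh p) (x0 p).
  apply: differentiable_mulmx; first exact/hatg_differentiable/cdom_refl.
  by apply/differentiable_tr/hate_differentiable; [exact: phi_smooth|exact: cdom_refl].
pose H2 (a u : 'rV[R]_d) : 'cV[R]_d := der (fun x => der (eh p) x u) (x0 p) a.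
have HC a u : H2 a u = H2 u a by exact: (der2_sym Uo es).
have key (a u c : 'rV[R]_d) : (c *m H2 a u) 0 0 - (u *m H2 a c) 0 0 = 2 * al * b a u c.
  have dd (z : 'rV[R]_d) : differentiable (fun x => der (eh p) x z) (x0 p).
    exact: (smooth_on_der_differentiable Uo es).
  have e1 : der (fun x => c *m der (eh p) x u - u *m der (eh p) x c) (x0 p) a
     = c *m H2 a u - u *m H2 a c.
    have dm (z t : 'rV[R]_d) : differentiable (fun x => z *m der (eh p) x t) (x0 p).
      by apply: differentiable_mulmx => //; exact: differentiable_cst.
    rewrite (derD a (dm _ _)); last exact: differentiableN.
    rewrite (derN a (dm _ _)) !(der_mulmx a (differentiable_cst _ _) (dd _)).
    by rewrite !der_cst !mul0mx !add0r.
  have e2 : der (fun x => c *m der (eh p) x u - u *m der (eh p) x c) (x0 p) a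
     = (2 * al) *: (u *m der (oh p) (x0 p) a *m c^T).
    transitivity (der (fun x => ((2 * al) *: u) *m oh p x *m c^T) (x0 p) a).
      apply: der_near; apply: near_hat_all => q pq.
      apply/matrixP => i j; rewrite !ord1 -!scalemxAl scalemxE -(deta_local _ _ h pq).
      by mx_entries.
    have d1 : differentiable (fun x => ((2 * al) *: u) *m oh p x) (x0 p).
      by apply: differentiable_mulmx => //; exact: differentiable_cst.
    rewrite (der_mulmx a d1 (differentiable_cst _ _)).
    rewrite (der_mulmx a (differentiable_cst _ _) odiff).
    by rewrite !der_cst mulmx0 mul0mx add0r addr0 -!scalemxAl.
  by have := congr1 (fun A : 'M[R]_1 => A 0 0) (etrans (esym e1) e2); mx_entries.
have cyc : b Y v w + b v w Y + b w Y v = 0.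
  have := key Y v w; have := key v w Y; have := key w Y v.
  rewrite (HC v w) (HC w Y) (HC v Y); move: (_ *m _) => *.
  by apply: (mulfI (x := 2 * al)); [rewrite mulf_neq0 // pnatr_eq0|lra].
(* Coordinate derivatives of Omega are replaced by covariant ones; in the cyclic sum the Christoffel
   terms cancel by their symmetry and the skewness of Omega. *)
have bE (a u c : 'rV[R]_d) : b a u c = (u *m G p *m (c *m nP p a)^T) 0 0
   + ((u *m conn p (x0 p) a) *m G p *m (c *m F p)^T) 0 0
   + (u *m G p *m ((c *m conn p (x0 p) a) *m F p)^T) 0 0.
  have [_ _ hD] := isD_mul (isD_G p)
    (isD_tr (fun=> erefl) (fun=> erefl) (isD_F p)).
  have := hD a; rewrite /cov mul0mx add0r mulmxN => e.
  have -> : b a u c = (u *m (G p *m (nP p a)^T + conn p (x0 p) a *m (G p *m (F p)^T)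
      + (G p *m (F p)^T) *m (conn p (x0 p) a)^T) *m c^T) 0 0.
    by rewrite /b -e; congr ((_ *m _ *m _) 0 0); mx_ring.
  by rewrite !mulmxDr !mulmxDl !trmx_mul !mulmxA; mx_entries.
have bs (u c : 'rV[R]_d) : (u *m G p *m (c *m F p)^T) 0 0 = - (c *m G p *m (u *m F p)^T) 0 0.
  rewrite -[u *m _ *m _]tr_mx11 !trmx_mul !trmxK met_sym mulmxA.
  by rewrite -[c *m F p *m _]mulmxA phi_skew mulmxN mulNmx oppmxE !mulmxA.
have pp := cdom_refl p.
rewrite dOmegaE; move: cyc; rewrite !bE.
rewrite (conn_sym Y v pp) (conn_sym Y w pp) (conn_sym v w pp).
rewrite (bs v) (bs Y) (bs w).
by lra.
Qed.

Lemma contact_facts (al : R) (p : M) : contact_metric M al ->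
  [/\ nX p (X p) = 0, \tr (nXm p) = 0 & Dphi p = ((2 * m)%:R * al) *: X p].
Proof.
move=> [/eqP al0 h].
have g0 : nX p (X p) = 0.
  by apply: nX_xi_of_deta => Y; rewrite h OmegaE xi_phi trmx0 mulmx0 zeromxE mulr0.
have [t0 D0] := dOmega0_facts (fun Y v w => contact_dOmega p Y v w al0 h) g0.
split=> //; rewrite {1}(phi_ker D0); congr (_ *: _).
by apply: Dphi_eta_deta => v w; exact: h.
Qed.
End ContactClosed.

Lemma mx11_eq {R : pzRingType} (A B : 'M[R]_1) : A 0 0 = B 0 0 -> A = B.
Proof. by move=> h; apply/matrixP => i j; rewrite !ord1. Qed.

Lemma sum_skew0 {R : realFieldType} {I : finType} (a : I -> I -> R) :
  (forall i k, a i k = - a k i) -> \sum_i \sum_k a i k = 0.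
Proof.
move=> h; set t := \sum_i _; have : t = - t.
  rewrite {2}/t exchange_big /= -sumrN; apply: eq_bigr => i _.
  by rewrite -sumrN; apply: eq_bigr => k _.
by lra.
Qed.

(* Double divergence of a bivector P: S is its divergence for a connection with
   symmetric Christoffel symbols and contracted Christoffel symbols g, and the
   divergence of S vanishes as the second derivatives of P and dg are symmetric. *)
Lemma div_div_skew {R : realType} {d} (P : 'rV[R]_d -> 'M[R]_d) (g : 'rV[R]_d -> 'rV[R]_d) x :
  differentiable P x -> differentiable g x ->
  (forall v : 'rV[R]_d, differentiable (fun y => der P y v) x) ->
  (\forall y \near x, (P y)^T = - P y) ->
  (\forall y \near x, forall v, (der P y v)^T = - der P y v) ->
  (forall u v : 'rV[R]_d, der (fun y => der P y v) x u = der (fun y => der P y u) x v) ->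
  (forall k l, (der g x 'e_k) 0 l = (der g x 'e_l) 0 k) ->
  let S y := \sum_i 'e_i *m der P y 'e_i + g y *m P y in
  \sum_k (der S x 'e_k) 0 k + (S x *m (g x)^T) 0 0 = 0.
Proof.
move=> Pd gd dPd Pskew dPskew P2 g1 /=.
have tdi i : differentiable (fun y => ('e_i : 'rV[R]_d) *m der P y 'e_i) x.
  by apply: differentiable_mulmx => //; exact: differentiable_cst.
have TE : (fun y => \sum_i ('e_i : 'rV[R]_d) *m der P y 'e_i)
    = \sum_i (fun y => ('e_i : 'rV[R]_d) *m der P y 'e_i).
  by apply/funext => y; rewrite fct_sumE.
have Td : differentiable (fun y => \sum_i ('e_i : 'rV[R]_d) *m der P y 'e_i) x.
  by rewrite TE; exact: differentiable_sum.
have dT (v : 'rV[R]_d) : der (fun y => \sum_i ('e_i : 'rV[R]_d) *m der P y 'e_i) x v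
    = \sum_i ('e_i : 'rV[R]_d) *m der (fun y => der P y 'e_i) x v.
  rewrite TE derE derive_sum; last by move=> i; exact: diff_derivable.
  apply: eq_bigr => i _; rewrite -derE (der_mulmx v (differentiable_cst _ _) (dPd _)).
  by rewrite der_cst mul0mx add0r.
have gPd : differentiable (fun y => g y *m P y) x by exact: differentiable_mulmx.
have Px := nbhs_singleton Pskew; have dPx := nbhs_singleton dPskew.
have skew2 (u v : 'rV[R]_d) :
    (der (fun y => der P y v) x u)^T = - der (fun y => der P y v) x u.
  rewrite -(der_tr u (dPd v)) -(derN u (dPd v)); apply: der_near.
  by apply: filterS dPskew => y ->.
have ee (m : nat) (A : 'M[R]_(m, d)) i k : (row i A) 0 k = A i k by rewrite mxE.
transitivity (\sum_k \sum_i (der (fun y => der P y 'e_i) x 'e_k) i k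
   + \sum_k \sum_l (der g x 'e_k) 0 l * P x l k
   + (\sum_k ((g x *m der P x 'e_k) 0 k + ((('e_k : 'rV[R]_d) *m der P x 'e_k) *m (g x)^T) 0 0))
   + (g x *m P x *m (g x)^T) 0 0).
  rewrite mulmxDl mulmx_suml addmxE summxE big_split /= !addrA; congr (_ + _).
  congr (_ + _); rewrite -!big_split /=; apply: eq_bigr => k _.
  rewrite (derD _ Td gPd) dT (der_mulmx _ gd Pd) !addmxE summxE !addrA.
  congr (_ + _); congr (_ + _); last by rewrite mxE.
  by apply: eq_bigr => i _; rewrite -rowE ee.
rewrite sum_skew0; last first.
  move=> k i; rewrite P2; have := skew2 'e_i 'e_k.
  by move/matrixP/(_ k i); rewrite oppmxE mxE => ->.
rewrite sum_skew0; last first.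
  move=> k l; rewrite g1.
  by have /matrixP/(_ l k) := Px; rewrite oppmxE mxE => ->; rewrite mulrN opprK.
rewrite big1 ?add0r; last first.
  move=> k _; have -> : (g x *m der P x 'e_k) 0 k
      = (g x *m der P x 'e_k *m ('e_k : 'rV[R]_d)^T) 0 0.
    by rewrite trmx_delta -colE [RHS]mxE.
  rewrite -[_ *m ('e_k)^T]tr_mx11 !trmx_mul trmxK dPx mulNmx mulmxN oppmxE.
  by rewrite mulmxA addNr.
have : g x *m P x *m (g x)^T = - (g x *m P x *m (g x)^T).
  by rewrite -[LHS]tr_mx11 !trmx_mul trmxK Px mulNmx mulmxN mulmxA.
by move/matrixP/(_ 0 0); rewrite oppmxE; move: (_ 0 0) => z; lra.
Qed.

Lemma diff_row_trace {R : realType} {V : normedModType R} {m d} (A : 'I_d -> V -> 'M[R]_m)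
    (c : R) x : (forall l, differentiable (A l) x) ->
  differentiable (fun y => \row_l (c * \tr (A l y))) x /\
  forall v l, (der (fun y => \row_l (c * \tr (A l y))) x v) 0 l = c * \tr (der (A l) x v).
Proof.
move=> Ad.
have E i l : (fun y => (\row_l (c * \tr (A l y))) i l)
    = c *: (\sum_k (fun y => A l y k k)).
  by apply/funext => y; rewrite mxE /= fct_sumE.
have dk l k : differentiable (fun y => A l y k k) x by exact: differentiable_entry.
have dd : differentiable (fun y => \row_l (c * \tr (A l y))) x.
  apply: differentiable_mx => i l; rewrite E.
  by apply: differentiableZ; exact: differentiable_sum.
split=> // v l; rewrite (der_entry _ _ _ dd) E derE deriveZ; last first.
  by apply: diff_derivable; exact: differentiable_sum.
rewrite derive_sum; last by move=> k; exact: diff_derivable.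
by congr (_ * _); apply: eq_bigr => k _; rewrite -derE -der_entry.
Qed.

(** The trace of nabla A at q is a row in the chart of q; carried to the chart of p it becomes a sum
    whose dependence on q is explicit, which permits derivatives and continuity in q. *)
Lemma gtr_cendo_trans {R : realType} {d} (M : riemannian R d) (A : M -> 'M[R]_d) (p q : M) :
  smooth_endo A -> cdom p q ->
  gtr (invmx (met q)) (fun v w => w *m cendo A q (chart q q) v) *m tmx q p q
  = \sum_i ('e_i : 'rV[R]_d) *m
      (invmx (hatg p (chart p q)) *m cendo A p (chart p q) 'e_i).
Proof.
move=> As pq; have qq := cdom_refl q.
have bl : bilin (fun v w => w *m cendo A p (chart p q) v).
  apply: bilin_mul; apply: isD_lin (isD_endo As pq); exact: conn_lin.
transitivity (gtr (invmx (hatg p (chart p q)))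
    (fun v w => w *m cendo A p (chart p q) v)).
  rewrite -gtr_mulmx.
  transitivity (gtr (invmx (met q)) (fun v w => (w *m tmx q p q)
      *m cendo A p (chart p q) (v *m tmx q p q))).
    apply: eq_gtr => v w; rewrite -!mulmxA; congr (w *m _).
    by rewrite cendo_trans.
  rewrite (@gtr_push _ _ _ _ _ _ (invmx (met q)) (tmx q p q) (tmx q p q) _ bl).
  congr (gtr _ _); have t1 := tmxK qq pq; have t2 := tmxK pq qq.
  apply: (can_inj (mulmxK (hatg_unit pq))); rewrite mulVmx ?hatg_unit // hatgE //.
  rewrite -!mulmxA (mulmxA (tmx q p q)) t1 mul1mx (mulmxA (invmx (met q))).
  by rewrite mulVmx ?met_unit // mul1mx -trmx_mul t2 trmx1.
rewrite /gtr; apply: eq_bigr => i _.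
rewrite mulmxA [_ *m invmx _]row_sum_delta mulmx_suml; apply: eq_bigr => j _.
by rewrite -scalemxAl; congr (_ *: _); rewrite -rowE mxE.
Qed.

(** * The divergence of xi when the trace of nabla phi is a multiple of xi *)

Section Solenoidal.
Context {R : realType} {m : nat} (M : acm R m).
Local Notation d := (m.*2.+1).
Local Notation x0 p := (chart p p).
Local Notation X p := (@xi R m M p).
Local Notation fh p := (hate (@phi R m M) p).
Local Notation bh p := (fun y => invmx (hatg p y) *m hate (@phi R m M) p y).
Local Notation ga p := (fun y => \row_l (2^-1 * \tr (invmx (hatg p y) *m der (hatg p) y 'e_l))).

Let bh_skew (p q : M) : cdom p q -> (bh p (chart p q))^T = - bh p (chart p q).
Proof.
move=> pq; have qq := cdom_refl q; have GU := hatg_unit pq.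
have e : fh p (chart p q) *m hatg p (chart p q)
   = - (hatg p (chart p q) *m (fh p (chart p q))^T).
  have t1 := tmxK qq pq.
  rewrite hateE // hatgE // !trmx_mul -!mulmxA (mulmxA (tmx q p q)) t1 mul1mx.
  rewrite (mulmxA (tmx p q q)^T) -(trmx_mul (tmx q p q)) t1 trmx1 mul1mx.
  by rewrite (mulmxA (phi q)) phi_skew mulNmx mulmxN !mulmxA.
rewrite /= trmx_mul trmx_inv hatg_sym.
apply: (can_inj (mulmxK GU)); rewrite mulmxKV // mulNmx -mulmxA e mulmxN opprK.
by rewrite mulmxA mulVmx // mul1mx.
Qed.

Let isD_bh (p q : M) : cdom p q -> isD (chart p q)
  (fun v => - (conn p (chart p q) v)^T) (conn p (chart p q)) (bh p) (bh p (chart p q))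
  (fun v => 0 *m fh p (chart p q)
     + invmx (hatg p (chart p q)) *m cendo (@phi R m M) p (chart p q) v).
Proof. by move=> pq; exact: isD_mul (isD_meti pq) (isD_endo (@phi_smooth R m M) pq). Qed.

(** The contracted Christoffel symbols are the differential of the logarithm of the volume density;
    this is why their derivative is symmetric, as the double divergence requires. *)
Let contracted (p q : M) : cdom p q ->
  \sum_i ('e_i : 'rV[R]_d) *m (conn p (chart p q) 'e_i)^T = ga p (chart p q).
Proof.
move=> pq; apply/rowP => l; rewrite summxE [RHS]mxE conn_metric //.
rewrite mulmxDr mxtraceD [\tr (_ *m (_ *m hatg _ _))]mxtrace_mulC mulmxK ?hatg_unit //.
have half (t : R) : 2^-1 * (t + t) = t by lra.
rewrite mulKmx ?hatg_unit // mxtrace_tr half.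
apply: eq_bigr => i _; rewrite -rowE mxE mxE.
by have := conn_sym 'e_i 'e_l pq => /matrixP/(_ 0 i); rewrite -!rowE !mxE.
Qed.

(** The left side is the coordinate divergence of the bivector g^-1 phi. Its third Christoffel term
    drops out, being symmetric symbols contracted with a skew matrix. *)
Let bh_div (p q : M) : cdom p q ->
  \sum_i ('e_i : 'rV[R]_d) *m der (bh p) (chart p q) 'e_i
    + ga p (chart p q) *m bh p (chart p q) = Dphi q *m tmx q p q.
Proof.
move=> pq.
have -> : Dphi q *m tmx q p q = \sum_i ('e_i : 'rV[R]_d) *m
   (invmx (hatg p (chart p q)) *m cendo (@phi R m M) p (chart p q) 'e_i).
  rewrite -gtr_cendo_trans //; last exact: phi_smooth.
  by congr (_ *m _); apply: eq_gtr => v w; rewrite nP.unlock.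
have [_ _ hD] := isD_bh pq.
have sk : \sum_i ('e_i : 'rV[R]_d) *m (bh p (chart p q) *m conn p (chart p q) 'e_i) = 0.
  transitivity (gtr (bh p (chart p q)) (fun v w => w *m conn p (chart p q) v)).
    rewrite /gtr; apply: eq_bigr => i _.
    rewrite mulmxA [_ *m (_ *m _)]row_sum_delta mulmx_suml; apply: eq_bigr => j _.
    by rewrite -scalemxAl; congr (_ *: _); rewrite -rowE mxE.
  apply: gtr_skew; first exact: bh_skew.
  by move=> v w; exact: conn_sym.
apply: esym; transitivity (\sum_i (('e_i : 'rV[R]_d) *m der (bh p) (chart p q) 'e_i
   + ('e_i : 'rV[R]_d) *m (conn p (chart p q) 'e_i)^T *m bh p (chart p q)
   + ('e_i : 'rV[R]_d) *m (bh p (chart p q) *m conn p (chart p q) 'e_i))).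
  apply: eq_bigr => i _; have := hD 'e_i; rewrite mul0mx add0r => <-.
  by rewrite /cov mulNmx opprK !mulmxDr !mulmxA.
by rewrite !big_split /= sk addr0 -mulmx_suml contracted.
Qed.

Let bh_diff (p q : M) : cdom p q -> differentiable (bh p) (chart p q).
Proof. by move=> pq; have [] := isD_bh pq. Qed.

Let U (p : M) := chart p @` cdom p.

Let Gs (p : M) : smooth_on (U p) (hatg p). Proof. exact: hatg_smooth. Qed.
Let Fs (p : M) : smooth_on (U p) (fh p).
Proof. by apply: hate_smooth; exact: phi_smooth. Qed.

Let bh_der (p q : M) v : cdom p q -> der (bh p) (chart p q) v
  = - (invmx (hatg p (chart p q)) *m der (hatg p) (chart p q) v
       *m invmx (hatg p (chart p q))) *m fh p (chart p q)
    + invmx (hatg p (chart p q)) *m der (fh p) (chart p q) v.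
Proof.
move=> pq; have Gd := hatg_differentiable pq; have Gu := near_hatg_unit pq.
rewrite (der_mulmx v (differentiable_invmx Gd Gu)) ?(der_invmx v Gd Gu) //.
exact: hate_differentiable (@phi_smooth R m M) pq.
Qed.

(** c xi is the divergence of the bivector g^-1 phi, so c div xi is a double divergence and
    vanishes. *)
Lemma divergence_coclosed (p : M) (c : R) : c != 0 ->
  (forall q, Dphi q = c *: X q) -> \tr (nXm p) = 0.
Proof.
move=> c0 h; have pp := cdom_refl p.
have Uo : open (U p) by exact: chart_dom_open.
have Ux : U p (x0 p) by exists p.
have Gd := hatg_differentiable pp; have Gu := near_hatg_unit pp.
have Gid := differentiable_invmx Gd Gu.
have Fd : differentiable (fh p) (x0 p) by exact: hate_differentiable (@phi_smooth R m M) pp.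
have dGd (v : 'rV[R]_d) : differentiable (fun y => der (hatg p) y v) (x0 p).
  exact: (smooth_on_der_differentiable Uo (@Gs p)).
have dFd (v : 'rV[R]_d) : differentiable (fun y => der (fh p) y v) (x0 p).
  exact: (smooth_on_der_differentiable Uo (@Fs p)).
have G2 (u v : 'rV[R]_d) := der2_sym Uo (@Gs p) u v Ux.
have F2 (u v : 'rV[R]_d) := der2_sym Uo (@Fs p) u v Ux.
have A1d (v : 'rV[R]_d) : differentiable
    (fun y => invmx (hatg p y) *m der (hatg p) y v) (x0 p).
  exact: differentiable_mulmx.
have A2d (v : 'rV[R]_d) : differentiable
    (fun y => invmx (hatg p y) *m der (hatg p) y v *m invmx (hatg p y)) (x0 p).
  exact: differentiable_mulmx.
have A3d (v : 'rV[R]_d) : differentiable (fun y =>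
    - (invmx (hatg p y) *m der (hatg p) y v *m invmx (hatg p y))) (x0 p).
  exact: differentiableN.
have A4d (v : 'rV[R]_d) : differentiable (fun y =>
    - (invmx (hatg p y) *m der (hatg p) y v *m invmx (hatg p y)) *m fh p y) (x0 p).
  exact: differentiable_mulmx.
have A5d (v : 'rV[R]_d) : differentiable (fun y => invmx (hatg p y) *m der (fh p) y v) (x0 p).
  exact: differentiable_mulmx.
(* An explicit formula for the derivative of the bivector near p. Its differentiability and the
   symmetry of its derivatives come from those of the metric and of phi. *)
pose W (v : 'rV[R]_d) y := - (invmx (hatg p y) *m der (hatg p) y v *m invmx (hatg p y))
  *m fh p y + invmx (hatg p y) *m der (fh p) y v.
have Wd (v : 'rV[R]_d) : differentiable (W v) (x0 p) by exact: differentiableD.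
have nW (v : 'rV[R]_d) : \forall y \near x0 p, W v y = der (bh p) y v.
  by apply: near_hat_all => q pq; rewrite bh_der.
have W2 (u v : 'rV[R]_d) : der (W v) (x0 p) u = der (W u) (x0 p) v.
  have dW (a b : 'rV[R]_d) : der (W b) (x0 p) a = - (
     (- (invmx (hatg p (x0 p)) *m der (hatg p) (x0 p) a *m invmx (hatg p (x0 p)))
        *m der (hatg p) (x0 p) b
      + invmx (hatg p (x0 p)) *m der (fun y => der (hatg p) y b) (x0 p) a)
        *m invmx (hatg p (x0 p))
      + invmx (hatg p (x0 p)) *m der (hatg p) (x0 p) b
        *m - (invmx (hatg p (x0 p)) *m der (hatg p) (x0 p) a *m invmx (hatg p (x0 p))))
      *m fh p (x0 p)
    + - (invmx (hatg p (x0 p)) *m der (hatg p) (x0 p) b *m invmx (hatg p (x0 p)))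
      *m der (fh p) (x0 p) a
    + (- (invmx (hatg p (x0 p)) *m der (hatg p) (x0 p) a *m invmx (hatg p (x0 p)))
        *m der (fh p) (x0 p) b
      + invmx (hatg p (x0 p)) *m der (fun y => der (fh p) y b) (x0 p) a).
    rewrite (derD a (A4d b) (A5d b)) (der_mulmx a (A3d b) Fd) (der_mulmx a Gid (dFd b)).
    rewrite (derN a (A2d b)) (der_mulmx a (A1d b) Gid) (der_mulmx a Gid (dGd b)).
    by rewrite (der_invmx a Gd Gu).
  rewrite !dW (G2 u v) (F2 u v).
  rewrite !(mulmxDl, mulmxDr, mulNmx, mulmxN, opprD, opprK, mulmxA).
  by mx_ring.
have [gad gader] := diff_row_trace 2^-1 (fun l => A1d 'e_l).
have bhs (q : M) v : cdom p q -> (der (bh p) (chart p q) v)^T = - der (bh p) (chart p q) v.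
  move=> pq; rewrite -(der_tr v (bh_diff pq)) -(derN v (bh_diff pq)); apply: der_near.
  by apply: filterS (near_chart_im pq) => y [py <-]; exact: bh_skew.
pose S y := \sum_i ('e_i : 'rV[R]_d) *m der (bh p) y 'e_i + ga p y *m bh p y.
have e : \sum_k (der S (x0 p) 'e_k) 0 k + (S (x0 p) *m (ga p (x0 p))^T) 0 0 = 0.
  apply: (div_div_skew (bh_diff pp) gad).
  - by move=> v; apply: near_eq_differentiable (Wd v); exact: nW.
  - by apply: near_hat_all => q pq; exact: bh_skew.
  - by apply: near_hat_all => q pq v; exact: bhs.
  - move=> u v; rewrite -(der_near u (nW v)) -(der_near v (nW u)); exact: W2.
  - move=> k l; rewrite !gader; congr (_ * _).
    rewrite !(der_mulmx _ Gid (dGd _)) !(der_invmx _ Gd Gu) !mxtraceD (G2 'e_k 'e_l).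
    congr (_ + _); rewrite !mulNmx !linearN /=; congr (- _).
  by rewrite -mulmxA [LHS]mxtrace_mulC !mulmxA [LHS]mxtrace_mulC !mulmxA.
have Xd := hatv_differentiable (@xi_smooth R m M) pp.
have nS : \forall y \near x0 p, \sum_i ('e_i : 'rV[R]_d) *m der (bh p) y 'e_i
     + ga p y *m bh p y = c *: hatv (@xi R m M) p y.
  by apply: near_hat_all => q pq; rewrite bh_div // h hatvE // scalemxAl.
have dS k : der S (x0 p) 'e_k = c *: der (hatv (@xi R m M) p) (x0 p) 'e_k.
  rewrite (der_near _ nS) derE deriveZ -?derE //; exact: diff_derivable.
have S0 : S (x0 p) = c *: hatv (@xi R m M) p (x0 p) := nbhs_singleton nS.
move: e; rewrite S0 -contracted //.
under eq_bigr => k _ do rewrite dS.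
rewrite -divergence_xi divergenceE => e.
apply: (mulfI c0); rewrite mulr0; apply: etrans e; rewrite mulr_sumr linear_sum mulmx_sumr summxE -big_split /=.
apply: eq_bigr => k _; rewrite /cvec /cov mul0mx subr0 addmxE mulrDr scalemxE; congr (_ + _).
by rewrite trmx_mul trmxK trmx_delta mulmxA -colE -!scalemxAl [RHS]mxE scalemxE.
Qed.
End Solenoidal.

(** * Divergence, geodesic property and trace of nabla phi for each class *)

Section ClassSummary.
Context {R : realType} {m : nat} (M : acm R m).
Local Notation d := (m.*2.+1).
Local Notation F p := (@phi R m M p).
Local Notation X p := (@xi R m M p).
Local Notation E p := (@eta_vec R m M p).
Local Notation G p := (@met R d M p).

Lemma natr2_neq0 : (0 < m)%N -> (2 * m)%:R != 0 :> R.
Proof. by move=> m0; rewrite pnatr_eq0 muln_eq0 -lt0n. Qed.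

Lemma vertical_Dphi (p : M) c : Dphi p = c *: X p -> Dphi p *m F p = 0.
Proof. by move=> ->; rewrite -scalemxAl xi_phi scaler0. Qed.

(** The constant c is 2m alpha for the contact members of the class, strongly pseudoconvex
    CR-manifolds having alpha = 1, and 2m for the quasi-contact metric and quasi-K-Sasakian ones. *)
Lemma classA1_facts : (0 < m)%N -> classA1 M -> exists2 c, c != 0 &
  forall p : M, [/\ nX p (X p) = 0, \tr (nXm p) = 0 & Dphi p = c *: X p].
Proof.
move=> /natr2_neq0 m0.
have contact al : contact_metric M al -> exists2 c, c != 0 &
    forall p : M, [/\ nX p (X p) = 0, \tr (nXm p) = 0 & Dphi p = c *: X p].
  move=> h; exists ((2 * m)%:R * al); first by rewrite mulf_neq0 //; case: h => /eqP.
  by move=> p; exact: contact_facts.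
case=> [[al h]|h|h|[[h _]|[[al h] _]]]; try exact: contact h.
- by exists (2 * m)%:R => // p; exact: quasi_contact_facts.
- exists (2 * m)%:R => // p; have [|h1 h2 h3] := @trace_P _ _ M p 1.
    move=> v w; have := h p v w; rewrite PtenE nabla_xiE gmetE etaE => ->.
    by rewrite mulr1.
  by split=> //; rewrite h3 mulr1.
- apply: (contact 1); split; first exact/eqP/oner_neq0.
  by move=> p v w; rewrite h mul1r.
Qed.

Lemma classA6_facts : (0 < m)%N -> classA6 M -> exists2 c, c != 0 &
  forall p : M, [/\ nX p (X p) = 0, \tr (nXm p) = 0 & Dphi p = c *: X p].
Proof.
move=> /natr2_neq0 m0 [al [/eqP al0 h]]; exists ((2 * m)%:R * al); first exact: mulf_neq0.
move=> p; have hQ (v w : 'rV[R]_d) : w *m nP p v + v *m nP p w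
   = al *: ((2 * (v *m G p *m w^T) 0 0) *: X p - (v *m E p) 0 0 *: w
              - (w *m E p) 0 0 *: v).
  by have := h p v w; rewrite QtenE gmetE !etaE => ->; mx_ring.
have [h1 h2] := geodesic_Q hQ; split=> //.
by apply: (@trace_Q _ _ M p al 0) => v w; rewrite hQ scale0r subr0.
Qed.

Lemma classA7a_facts : (0 < m)%N -> classA7a M -> exists2 c, c != 0 &
  forall p : M, \tr (nXm p) = 0 /\ Dphi p = c *: X p.
Proof.
move=> /natr2_neq0 m0 h; have hD q := classA7a_Dphi q h.
by exists (2 * m)%:R => // p; split=> //; exact: divergence_coclosed hD.
Qed.

Lemma classA167_facts : (0 < m)%N -> classA1 M \/ classA6 M \/ classA7 M ->
  exists2 c, c != 0 &
  forall p : M, [/\ nX p (X p) = 0, \tr (nXm p) = 0 & Dphi p = c *: X p].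
Proof.
move=> m0 [h|[h|[h hn]]]; [exact: classA1_facts|exact: classA6_facts|].
have [c c0 hc] := classA7a_facts m0 h; exists c => // p; have [h1 h2] := hc p.
by split=> //; exact: normal_nX_xi.
Qed.

Lemma classA4_facts (p : M) : classA4 M ->
  [/\ nX p (X p) = 0, \tr (nXm p) = 0 & Dphi p *m F p = 0].
Proof.
move=> [h1 h2 _]; have g0 := normal_nX_xi p h1.
by have [h3 h4] := dOmega0_facts (h2 p) g0.
Qed.

Lemma classA_facts (p : M) : (0 < m)%N ->
  classA1 M \/ classA4 M \/ classA6 M \/ classA7a M ->
  \tr (nXm p) = 0 /\ Dphi p *m F p = 0.
Proof.
move=> m0 [/(classA1_facts m0)|[/(classA4_facts p)[]//|[/(classA6_facts m0)|]]].
- by move=> [c _ /(_ p)[_ h1 h2]]; split=> //; exact: vertical_Dphi h2.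
- by move=> [c _ /(_ p)[_ h1 h2]]; split=> //; exact: vertical_Dphi h2.
- move=> /(classA7a_facts m0)[c _ /(_ p)[h1 h2]].
  by split=> //; exact: vertical_Dphi h2.
Qed.

Lemma classA_geodesic (p : M) : (0 < m)%N ->
  classA1 M \/ classA4 M \/ classA6 M \/ classA7 M -> nX p (X p) = 0.
Proof.
move=> m0 [/(classA1_facts m0)|[/(classA4_facts p)[]//|[/(classA6_facts m0)|]]].
- by move=> [c _ /(_ p)[]].
- by move=> [c _ /(_ p)[]].
- by move=> [_ h]; exact: normal_nX_xi.
Qed.

Lemma classB1_facts (p : M) : classB1 M ->
  [/\ nX p (X p) = 0, \tr (nXm p) = 0 & Dphi p = 0].
Proof.
have acos : almost_cosymplectic M -> [/\ nX p (X p) = 0, \tr (nXm p) = 0 & Dphi p = 0].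
  move=> [h1 h2]; have [||a b c] := @kenmotsu_facts _ _ M p 0.
  - by move=> Y v w; rewrite h2 mulr0 mul0r.
  - exact: h1.
  - by split=> //; rewrite b mulr0.
have ncos : nearly_cosymplectic M -> [/\ nX p (X p) = 0, \tr (nXm p) = 0 & Dphi p = 0].
  (* Polarisation of (nabla_X phi) X = 0 gives Q = 0, the case of vanishing parameters. *)
  move=> h; have hQ (v w : 'rV[R]_d) : w *m nP p v + v *m nP p w
     = 0 *: ((2 * (v *m G p *m w^T) 0 0) *: X p - (v *m E p) 0 0 *: w
              - (w *m E p) 0 0 *: v).
    have hv u : u *m nP p u = 0 by have := h p u; rewrite nabla_phiE.
    have /lin_linearP nl := nP_lin p.
    have nD : nP p (v + w) = nP p v + nP p w by have := nl 1 v w; rewrite !scale1r.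
    have := hv (v + w); rewrite nD mulmxDr [_ *m nP p v]mulmxDl [_ *m nP p w]mulmxDl.
    by rewrite (hv v) (hv w) add0r addr0 scale0r.
  have [h1 h2] := geodesic_Q hQ; split=> //.
  rewrite (@trace_Q _ _ M p 0 0) ?mulr0 ?scale0r // => v w.
  by rewrite hQ !scale0r subr0.
case=> [[h _]|h|h|[[h _]|h]]; [exact: acos|exact: acos|exact: ncos|exact: ncos|].
have [|h1 h2 h3] := @trace_P _ _ M p 0.
  move=> v w; have := h p v w; rewrite PtenE nabla_xiE etaE => ->.
  by rewrite mulr0 !mul0r !scale0r subr0 add0r.
by split=> //; rewrite h3 mulr0 scale0r.
Qed.

Lemma classB_facts (p : M) : classB1 M \/ classB2 M ->
  [/\ nX p (X p) = 0, \tr (nXm p) = 0 & Dphi p = 0].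
Proof.
move=> [|[h hn]]; first exact: classB1_facts.
by have [h1 h2] := classB2a_facts p h; split=> //; exact: normal_nX_xi.
Qed.

Lemma almost_kenmotsu_facts (beta : M -> R) (p : M) : almost_kenmotsu beta ->
  [/\ nX p (X p) = 0, \tr (nXm p) = (2 * m)%:R * beta p & Dphi p = 0].
Proof. by move=> [_ _ h1 h2 _]; exact: kenmotsu_facts (h1 p) (h2 p). Qed.

Lemma holomorphic_class_facts (p : M) : (0 < m)%N ->
  classA1 M \/ classA2 M \/ classA3 M \/ classA4 M \/ classA6 M \/
  classA7a M \/ classB2a M \/ classB3 M -> Dphi p *m F p = 0.
Proof.
move=> m0 h.
have hA : classA1 M \/ classA4 M \/ classA6 M \/ classA7a M -> Dphi p *m F p = 0.
  by case/(classA_facts p m0).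
case: h => [h|[h|[h|[h|[h|[h|[h|h]]]]]]]; try by apply: hA; tauto.
- have [wp [th [_ _ _ _ hQ]]] := h; apply: (@vertical_Dphi p ((2 * m)%:R * wp p)).
  apply: (@trace_Q _ _ M p (wp p) (th p)) => v w.
  by have := hQ p v w; rewrite QtenE gmetE !etaE.
(* Symmetrising the trans-Sasakian formula gives the nearly trans-Sasakian one, because g(phi v, w)
   is skew. *)
- have [wp [th [_ [_ hQ _ _]]]] := h; apply: (@vertical_Dphi p ((2 * m)%:R * wp p)).
  apply: (@trace_Q _ _ M p (wp p) (th p)) => v w.
  have := hQ p v w; have := hQ p w v; rewrite !nabla_phiE !gmetE !etaE => -> ->.
  have gC (a b : 'rV[R]_d) : (a *m G p *m b^T) 0 0 = (b *m G p *m a^T) 0 0.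
    by rewrite -[a *m _ *m _]tr_mx11 !trmx_mul !trmxK met_sym mulmxA.
  have gF : (v *m F p *m G p *m w^T) 0 0 = - (w *m F p *m G p *m v^T) 0 0.
    by rewrite (gC (w *m F p)) -(mulmxA v) phi_skew trmx_mul mulmxN mulNmx oppmxE !mulmxA.
  by rewrite gF (gC w v); mx_ring.
- by have [_ ->] := classB2a_facts p h; rewrite mul0mx.
- by have [b /(almost_kenmotsu_facts p)[_ _ ->]] := h; rewrite mul0mx.
Qed.
End ClassSummary.

(** * Holomorphic maps *)

Section HolomorphicTrace.
Context {R : realType} {a b : nat} (M : riemannian R a) (N : riemannian R b).
Context (f : M -> N) (fs : smooth_map f) (A : M -> 'M[R]_a) (B : N -> 'M[R]_b) (s : R).
Context (As : smooth_endo A) (Bs : smooth_endo B).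
Context (AB : forall p, A p *m dmx f p = s *: (dmx f p *m B (f p))).
Local Notation x0 p := (chart p p).
Local Notation Gi p := (invmx (met p)).

Let isD_A p : isD (x0 p) (conn p (x0 p)) (conn p (x0 p)) (hate A p) (A p) (cendo A p (x0 p)).
Proof. by have := isD_endo As (cdom_refl p); rewrite hate_id. Qed.

Let isD_B q : isD (x0 q) (conn q (x0 q)) (conn q (x0 q)) (hate B q) (B q) (cendo B q (x0 q)).
Proof. by have := isD_endo Bs (cdom_refl q); rewrite hate_id. Qed.

Lemma holo_deriv p v : cendo A p (x0 p) v *m dmx f p + A p *m sff f p v
  = s *: (sff f p v *m B (f p) + dmx f p *m cendo B (f p) (x0 (f p)) (v *m dmx f p)).
Proof.
have h1 := isD_mul (isD_A p) (isD_jac fs p).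
have h2 := isD_mul (isD_jac fs p) (isD_along fs (isD_B (f p))).
have h3 := isD_scale (differentiable_cst s (x0 p)) h2.
have := isD_eq _ h1 h3 v; rewrite der_cst scale0r add0r; apply.
apply: (near_hat (cdom_refl p) (near_fdom fs p)) => q pq [_ fq].
have qq := cdom_refl q; have fqq := cdom_refl (f q).
rewrite /= hatfE // (jac_hatf fs) // !hateE //.
rewrite -!mulmxA (mulmxA (tmx q p q)) tmxK // mul1mx (mulmxA (A q)) AB.
by rewrite -!scalemxAl -!scalemxAr -!mulmxA (mulmxA (tmx (f q) (f p) (f q))) tmxK // mul1mx.
Qed.

Context (Askew : forall p, (Gi p *m A p)^T = - (Gi p *m A p)).
Context (mu : M -> R) (hw : hwc f mu).

(** In the trace of the differentiated intertwining relation, the term in which A meets the second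
    fundamental form contracts a skew bivector with a symmetric form. *)
Lemma holo_trace p :
  gtr (Gi p) (fun v w => w *m cendo A p (x0 p) v) *m dmx f p
  = s *: (tension f p *m B (f p)
     + mu p ^+ 2 *: gtr (Gi (f p)) (fun v w => w *m cendo B (f p) (x0 (f p)) v)).
Proof.
have bB : bilin (fun v w => w *m cendo B (f p) (x0 (f p)) v).
  by apply: bilin_mul; apply: isD_lin (isD_B _); apply: conn_lin; exact: cdom_refl.
have bS : bilin (fun v w => w *m sff f p v) by apply: bilin_mul; exact: sff_lin.
rewrite -(gtr_along fs p hw bB) tensionE // -!gtr_mulmx -gtrDr -gtrZr.
transitivity (gtr (Gi p) (fun v w => w *m cendo A p (x0 p) v *m dmx f p
    + w *m A p *m sff f p v)).
  rewrite gtrDr (gtr_push2 _ _ bS) [X in _ + X]gtr_skew ?addr0 //.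
  by move=> v w; exact: sff_sym.
apply: eq_gtr => v w; rewrite -!mulmxA -mulmxDr holo_deriv -scalemxAr mulmxDr !mulmxA.
by [].
Qed.
End HolomorphicTrace.

(** * The function lambda and the tension field *)

Section ContactMaps.
Context {R : realType} {m n : nat} (M : acm R m) (N : acm R n).
Context (f : M -> N) (fs : smooth_map f) (s : R) (s0 : s != 0).
Context (mu : M -> R) (hw : hwc f mu).
Context (hol : forall p X, dmap f p (X *m phi p) = s *: (dmap f p X *m phi (f p))).
Local Notation d := (m.*2.+1).
Local Notation x0 p := (chart p p).
Local Notation F p := (@phi R m M p).
Local Notation X p := (@xi R m M p).
Local Notation E p := (@eta_vec R m M p).
Local Notation Gi p := (invmx (@met R d M p)).
Local Notation F' p := (@phi R n N p).
Local Notation X' p := (@xi R n N p).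
Local Notation E' p := (@eta_vec R n N p).
Local Notation J p := (dmx f p).

Lemma hol_mx p : F p *m J p = s *: (J p *m F' (f p)).
Proof.
apply/row_matrixP => i; have := hol p 'e_i; rewrite !dmapE // -!mulmxA -!rowE => ->.
by rewrite linearZ.
Qed.

Lemma reeb_image p : X p *m J p = (X p *m J p *m E' (f p)) 0 0 *: X' (f p).
Proof.
apply: phi_ker; have : s *: (X p *m J p *m F' (f p)) = 0.
  by rewrite -mulmxA scalemxAr -hol_mx mulmxA xi_phi mul0mx.
by move/eqP; rewrite scaler_eq0 (negPf s0) => /eqP.
Qed.

Context (lam : M -> R) (lamP : forall p, dmap f p (X p) = lam p *: X' (f p)).

Lemma lam_mx p : X p *m J p = lam p *: X' (f p).
Proof. by rewrite -dmapE. Qed.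

Lemma dmx_eta p : J p *m E' (f p) = lam p *: E p.
Proof.
have h : F p *m (J p *m E' (f p)) = 0.
  by rewrite mulmxA hol_mx -scalemxAl -mulmxA phi_eta mulmx0 scaler0.
have : F p *m (F p *m (J p *m E' (f p))) = 0 by rewrite h mulmx0.
rewrite mulmxA phi_phi mulmxDl mulNmx mul1mx -[E p *m X p *m _]mulmxA (mulmxA (X p)).
rewrite lam_mx -scalemxAl xi_eta -scalemxAr mulmx1 => /eqP.
by rewrite addrC subr_eq0 => /eqP.
Qed.

(** The conformality relation evaluated twice on sigma, whose pullback is lam eta; both eta and
    sigma have unit length. *)
Lemma dilation_lam p : mu p ^+ 2 = lam p ^+ 2.
Proof.
have := congr1 (fun A => ((E' (f p))^T *m A *m E' (f p)) 0 0) (hwc_mx fs p hw).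
rewrite -scalemxAr -scalemxAl -[_ *m invmx (met (f p)) *m _]mulmxA eta_flati -trmx_mul.
rewrite xi_eta trmx1 scalemxE [1%:M 0 0]mxE mulr1 => <-.
rewrite !mulmxA -[_ *m _ *m J p *m _]mulmxA dmx_eta -trmx_mul dmx_eta.
rewrite [(_ *: _)^T]linearZ /= -!scalemxAl -scalemxAr scalerA eta_flati_tr xi_eta scalemxE mxE mulr1.
by rewrite -expr2.
Qed.

Context (lams : smooth_fun lam).

Lemma lam_smooth p : smooth_on (chart p @` cdom p) (lam \o ichart p).
Proof.
by move: (lams : forall p, smooth_on _ _) => /(_ p); rewrite setTI.
Qed.

Lemma lam_diff p : differentiable (lam \o ichart p) (x0 p).
Proof.
apply: (@smooth_on_differentiable1 R d (chart p @` cdom p)); [exact: chart_dom_open|exact: lam_smooth|].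
by exists p => //; exact: cdom_refl.
Qed.

Lemma dlam_lin p : lin (dfun lam p : _ -> R^o).
Proof. by apply: lin_derive; exact: lam_diff. Qed.

Lemma eta_deriv p v :
  sff f p v *m E' (f p) + J p *m nE (f p) (v *m J p)
  = dfun lam p v *: E p + lam p *: nE p v.
Proof.
have h1 := isD_mul (isD_jac fs p) (isD_along fs (isD_E (f p))).
have h2 := isD_scale (lam_diff p) (isD_E p).
have lp : (lam \o ichart p) (x0 p) = lam p by rewrite /= chartK //; exact: cdom_refl.
rewrite lp in h2; rewrite dfun_der; apply: isD_eq h1 h2 v.
apply: (near_hat (cdom_refl p) (near_fdom fs p)) => q pq [_ fq].
rewrite /= chartK // hatfE // (jac_hatf fs) // !hatcE // -!mulmxA.
by rewrite (mulmxA (tmx (f q) (f p) (f q))) tmxK ?mul1mx ?dmx_eta ?scalemxAr //; exact: cdom_refl.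
Qed.

Lemma tension_eta p : (tension f p *m E' (f p)) 0 0
  = dfun lam p (X p) + lam p * \tr (nXm p) - lam p ^+ 2 * \tr (nXm (f p)).
Proof.
have bN : bilin (fun v w => w *m @nE R n N (f p) v) by exact: nE_bilin.
have e1 : gtr (Gi p) (fun v w => w *m (sff f p v *m E' (f p) + J p *m nE (f p) (v *m J p)))
   = tension f p *m E' (f p) + (lam p ^+ 2 * \tr (nXm (f p)))%:M.
  rewrite tensionE // -gtr_mulmx -dilation_lam -[U in _ + U]scale_scalar_mx -gtr_nE.
  rewrite -(gtr_along fs p hw bN) -gtrDr.
  by apply: eq_gtr => v w; rewrite mulmxDr !mulmxA.
have e2 : gtr (Gi p) (fun v w => w *m (dfun lam p v *: E p + lam p *: nE p v))
   = (dfun lam p (X p) + lam p * \tr (nXm p))%:M.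
  rewrite raddfD /= -[U in _ + U]scale_scalar_mx -gtr_nE -gtrZr.
  transitivity (gtr (Gi p) (fun v w => (w *m E p) 0 0 *: (dfun lam p v)%:M
     + lam p *: (w *m nE p v))).
    apply: eq_gtr => v w; rewrite mulmxDr -!scalemxAr [in LHS](mx11_scalar (w *m E p)).
    by rewrite !scale_scalar_mx mulrC.
  rewrite gtrDr; congr (_ + _).
  rewrite (gtr_tr _ (fun w v => (w *m E p) 0 0 *: (dfun lam p v)%:M)) gtr_col.
    by rewrite trmx_inv met_sym eta_flati_tr.
  apply/lin_linearP => k u w; have /lin_linearP -> := dlam_lin p.
  by rewrite raddfD /= scale_scalar_mx.
have : tension f p *m E' (f p) + (lam p ^+ 2 * \tr (nXm (f p)))%:M
   = (dfun lam p (X p) + lam p * \tr (nXm p))%:M.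
  by rewrite -e1 -e2; apply: eq_gtr => v w; rewrite eta_deriv.
move/(congr1 (fun A : 'M[R]_1 => A 0 0)); rewrite addmxE.
rewrite [_%:M 0 0]mxE [in RHS]mxE !mulr1n => <-; by rewrite addrK.
Qed.

(** The trace on the domain is a multiple of xi, so its image is a multiple of gamma and is
    annihilated by the target's phi. Hence phi^2 of the tension is 0, then phi of it as well, and
    the kernel of phi is spanned by gamma. *)
Lemma tension_vertical p : Dphi p *m F p = 0 -> Dphi (f p) *m F' (f p) = 0 ->
  tension f p = (tension f p *m E' (f p)) 0 0 *: X' (f p).
Proof.
move=> D1 D2; apply: phi_ker.
have := holo_trace fs (@phi_smooth R m M) (@phi_smooth R n N) hol_mx
  (@phi_skewi R m M) hw p.
have DE (q : M) : gtr (Gi q) (fun v w => w *m cendo (@phi R m M) q (x0 q) v) = Dphi q.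
  by apply: eq_gtr => v w; rewrite nP.unlock.
have DE' (q : N) : gtr (invmx (met q)) (fun v w => w *m cendo (@phi R n N) q (x0 q) v)
    = Dphi q by apply: eq_gtr => v w; rewrite nP.unlock.
rewrite DE DE' {1}(phi_ker D1) -scalemxAl lam_mx => h.
have : s *: (tension f p *m F' (f p) *m F' (f p)) = 0.
  move/(congr1 (mulmx^~ (F' (f p)))): h.
  by rewrite -!scalemxAl xi_phi !scaler0 mulmxDl -scalemxAl D2 scaler0 addr0 => <-.
move/eqP; rewrite scaler_eq0 (negPf s0) /= => /eqP h2.
by apply: phi_inj h2 _; rewrite -mulmxA phi_eta mulmx0.
Qed.

Lemma harmonic_lam : (forall p : M, Dphi p *m F p = 0) ->
  (forall q : N, Dphi q *m F' q = 0) -> harmonic_map f <->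
  forall p, dfun lam p (X p) + lam p * \tr (nXm p) - lam p ^+ 2 * \tr (nXm (f p)) = 0.
Proof.
move=> D1 D2; split=> h p; first by rewrite -tension_eta h mul0mx zeromxE.
by rewrite (tension_vertical (D1 p) (D2 _)) tension_eta h scale0r.
Qed.

(** d lam(v) is the sigma-component of the second fundamental form at (v, xi). By symmetry it can be
    computed in direction xi, where nabla eta and nabla sigma vanish as both Reeb fields are
    geodesic. *)
Lemma dlam_eta p v : nX p (X p) = 0 -> nX (f p) (X' (f p)) = 0 ->
  dfun lam p v = dfun lam p (X p) * (v *m E p) 0 0.
Proof.
move=> g1 g2.
have h1 := congr1 (fun A => X p *m A) (eta_deriv p v).
have h2 := congr1 (fun A => v *m A) (eta_deriv p (X p)).
have nE0 : nE p (X p) = 0 by rewrite nE_flat g1 trmx0 mulmx0.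
have nE'0 : nE (f p) (lam p *: X' (f p)) = 0.
  by rewrite nE_flat nXE -scalemxAl -nXE g2 scaler0 trmx0 mulmx0.
move: h1; rewrite !mulmxDr [X p *m (J p *m _)]mulmxA lam_mx -scalemxAl xi_nE scaler0 addr0.
rewrite -!scalemxAr xi_nE scaler0 addr0 xi_eta => h1.
move: h2; rewrite !mulmxDr lam_mx nE'0 !mulmx0 addr0 nE0 scaler0 mulmx0 addr0.
rewrite -scalemxAr mulmxA (sff_sym fs) -mulmxA h1 => /(congr1 (fun A : 'M[R]_1 => A 0 0)).
by rewrite !scalemxE [1%:M 0 0]mxE mulr1.
Qed.
End ContactMaps.

(** * Local nature of smoothness and existence of a smooth lambda *)

Section LocalSmoothness.
Context {R : realType} {d : nat} (M : manifold R d).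

Lemma chart_smooth (F : M -> R) p q (V : set M) : open V -> V `<=` cdom q ->
  smooth_on (chart q @` V) (F \o ichart q) ->
  smooth_on (chart p @` (V `&` cdom p)) (F \o ichart p).
Proof.
move=> Vo Vq Fs.
have Uo := @chart_image_open R d M p V Vo.
have qo : open (chart q @` V).
  by have := @chart_image_open R d M q V Vo; rewrite (proj2 (setIidPl _ _) Vq).
have pull x : (chart p @` (V `&` cdom p)) x ->
    exists2 r, V r /\ cdom p r & x = chart p r by case=> r ? <-; exists r.
apply: (@smooth_on_ext _ _ _ _ ((F \o ichart q) \o (chart q \o ichart p))) => //.
  by move=> x /pull[r [Vr pr] ->]; rewrite /= !chartK //; exact: Vq.
apply: (smooth_on_comp Uo qo _ _ Fs).
  apply: (@smooth_on_sub _ _ _ (chart p @` (cdom q `&` cdom p))); last exact: trans_smooth.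
  move=> x [r [Vr pr] <-].
  by exists r => //; split=> //; exact: Vq.
by move=> x /pull[r [Vr pr] ->]; exists r; rewrite //= chartK.
Qed.

Lemma smoothM_local (F : M -> R) (U : set M) :
  (forall q, U q -> exists (V : set M) (r : M), [/\ open V, V q,
     V `<=` cdom r & smooth_on (chart r @` V) (F \o ichart r)]) -> smoothM U F.
Proof.
move=> h p vs x [q [Uq pq] <-].
have [V [r [Vo Vq Vd Fs]]] := h q Uq.
have H : smooth_on _ (F \o ichart p) := chart_smooth (p := p) Vo Vd Fs.
by apply: (H vs (chart p q)); exists q.
Qed.
End LocalSmoothness.

Lemma smooth_on_fdom_comp {R : realType} {a b} (M' : riemannian R a) (N' : riemannian R b)
    (g : M' -> N') (gs : smooth_map g) q {c c'} (B : 'rV[R]_b -> 'M[R]_(c, c')) :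
  smooth_on (chart (g q) @` cdom (g q)) B -> smooth_on (fdom g q) (B \o hatf g q).
Proof.
move=> Bs; have Uo := @fdom_open _ _ _ _ _ g gs q; have Vo := @chart_dom_open _ _ N' (g q).
apply: smooth_on_mx => // i j.
apply: (@smooth_on_comp _ _ _ _ _ _ (fun y => B y i j) Uo Vo).
- exact: hatf_smooth.
- by move=> x [r [fr qr] <-]; rewrite hatfE //; exists (g r).
- exact: smooth_on_entry.
Qed.

Section LamSmooth.
Context {R : realType} {m n : nat} (M : acm R m) (N : acm R n).
Context (f : M -> N) (fs : smooth_map f).

(** Provides lambda = sigma(f_* xi) where the conclusion does not mention lambda but the argument
    needs it. *)
Lemma lam_exists_smooth :
  smooth_fun (fun p => (@xi R m M p *m dmx f p *m @eta_vec R n N (f p)) 0 0).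
Proof.
apply: smoothM_local => q _; exists (f @^-1` cdom (f q) `&` cdom q), q.
have fc : continuous f by case: fs.
have Uo := @fdom_open _ _ _ _ _ f fs q.
split; [|by split; exact: cdom_refl|by move=> r []|].
  apply: openI; last exact: cdom_open.
  by apply: open_comp (cdom_open _) => r _; exact: fc.
pose H x := hatv (@xi R m M) q x *m jac (hatf f q) x
   *m hatc (@eta_vec R n N) (f q) (hatf f q x).
apply: (@smooth_on_ext _ _ _ _ (fun x => H x 0 0)) => //.
  move=> x [r [fr qr] <-]; have rr := cdom_refl r; have frr := cdom_refl (f r).
  rewrite /= chartK // /H hatfE // hatvE // hatcE // (jac_hatf fs) //.
  rewrite -!mulmxA (mulmxA (tmx (f r) (f q) (f r))) tmxK // mul1mx.
  by rewrite (mulmxA (tmx r q r)) tmxK // mul1mx.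
apply: smooth_on_entry => //; apply: smooth_on_mulmx => //.
  apply: smooth_on_mulmx => //.
    apply: (@smooth_on_sub _ _ _ (chart q @` cdom q)); last exact/hatv_smooth/xi_smooth.
    by move=> x [r [_ qr] <-]; exists r.
  by apply: smooth_on_jac => //; exact: hatf_smooth.
by apply: smooth_on_fdom_comp => //; apply: hatc_smooth; exact: eta_smooth.
Qed.
End LamSmooth.

(** * Closedness of d lam when it is a multiple of eta *)

Section ClosedReeb.
Context {R : realType} {m : nat} (M : acm R m).
Local Notation d := (m.*2.+1).
Local Notation x0 p := (chart p p).
Local Notation F p := (@phi R m M p).
Local Notation X p := (@xi R m M p).
Local Notation E p := (@eta_vec R m M p).
Local Notation Gi p := (invmx (@met R d M p)).

(* 0 = d(d lam) = d(xi lam) /\ eta + (xi lam) d eta, and the trace of d eta against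
   Omega does not vanish *)
Lemma closed_multiple_eta (lam : M -> R) (p : M) : smooth_fun lam ->
  (forall q v, dfun lam q v = dfun lam q (X q) * (v *m E q) 0 0) ->
  (Dphi p *m E p) 0 0 != 0 -> dfun lam p (X p) = 0.
Proof.
move=> lams h Dne; have pp := cdom_refl p.
pose U := chart p @` cdom p.
have Uo : open U by exact: chart_dom_open.
have Ux : U (x0 p) by exists p.
pose L x : 'rV[R]_1 := (lam (ichart p x))%:M.
have lh : smooth_on U (lam \o ichart p).
  by move: (lams : forall p, smooth_on _ _) => /(_ p); rewrite setTI.
have Ls : smooth_on U L.
  apply: smooth_on_mx => // i j.
  have -> : (fun y => L y i j) = lam \o ichart p; last exact: lh.
  by apply/funext => x; rewrite /L mxE !ord1 eqxx mulr1n.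
have Ld x : U x -> differentiable L x by move=> Ux'; exact: smooth_on_differentiable Ls Ux'.
have LE (q : M) v : cdom p q -> (v *m jac L (chart p q)) 0 0 = dfun lam q (v *m tmx p q q).
  move=> pq; have Uq : U (chart p q) by exists q.
  rewrite -(der_jac v (Ld _ Uq)) (der_entry _ _ _ (Ld _ Uq)).
  rewrite (dfunE _ pq); last exact: smooth_on_differentiable1 lh Uq.
  rewrite -mulmxA tmxK ?mulmx1 //; last exact: cdom_refl.
  by congr (der _ _ _); apply/funext => y; rewrite /L mxE !eqxx mulr1n.
pose XK x := hatv (@xi R m M) p x *m jac L x.
(* d lam = xi(lam) eta near p, read in one chart so that it can be differentiated. *)
have nK : \forall x \near x0 p, jac L x = hatc (@eta_vec R m M) p x *m XK x.
  apply: near_hat_all => q pq; have qq := cdom_refl q.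
  apply/row_matrixP => i; rewrite !rowE; apply: mx11_eq.
  rewrite LE // h mulmxA [RHS]mxE big_ord1 mulrC hatcE // mulmxA /XK hatvE //.
  congr (_ * _); have := LE q (X q *m tmx q p q) pq.
  by rewrite -[X q *m tmx q p q *m tmx p q q]mulmxA tmxK // mulmx1 => <-.
have Js := smooth_on_jac Uo Ls.
have Jd : differentiable (jac L) (x0 p) by exact: smooth_on_differentiable Js Ux.
have Xd := hatv_differentiable (@xi_smooth R m M) pp.
have Ed := hatc_differentiable (@eta_smooth R m M) pp.
have XKd : differentiable XK (x0 p) by exact: differentiable_mulmx.
have dK v : der (jac L) (x0 p) v = der (hatc (@eta_vec R m M) p) (x0 p) v *m XK (x0 p)
    + E p *m der XK (x0 p) v.
  by rewrite (der_near v nK) (der_mulmx v Ed XKd) hatc_id.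
(* This is d(d lam) = 0: the Hessian of lam is symmetric, and the Christoffel terms cancel. *)
have key (v w : 'rV[R]_d) : (w *m nE p v - v *m nE p w) *m XK (x0 p)
    = (v *m E p) 0 0 *: der XK (x0 p) w - (w *m E p) 0 0 *: der XK (x0 p) v.
  have nEE u u' : u *m nE p u' = u *m der (hatc (@eta_vec R m M) p) (x0 p) u'
      - u *m conn p (x0 p) u' *m E p.
    by rewrite nE.unlock /ccov /cov mulmx0 addr0 hatc_id mulmxBr mulmxA.
  have sc (u : 'rV[R]_d) (A : 'M[R]_1) : (u *m E p) 0 0 *: A = u *m (E p *m A).
    by rewrite mulmxA [u *m E p in RHS]mx11_scalar mul_scalar_mx.
  rewrite !nEE (conn_sym v w pp) !sc.
  have := der_jac_sym v w Uo Ls Ux; rewrite !dK !mulmxDr !mulmxA => hs.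
  rewrite !mulmxBl; apply: mx11_eq; move: (congr1 (fun A : 'M[R]_1 => A 0 0) hs).
  by mx_entries; lra.
have dUl : lin (fun w : 'rV[R]_d => der XK (x0 p) (w *m F p)).
  by apply: (lin_comp _ (lin_der XKd)).
have dU0 : der XK (x0 p) 0 = 0.
  by rewrite (lin_der XKd) big1 // => i _; rewrite zeromxE scale0r.
have := gtr_col (Gi p) (E p) dUl; rewrite eta_flati_tr xi_phi dU0 => T0.
(* Contracted in v and phi w, the right side of [key] becomes the derivative of xi(lam) along phi xi
   = 0, because eta phi = 0. *)
have : gtr (Gi p) (fun v w => ((w *m F p) *m nE p v - v *m nE p (w *m F p)) *m XK (x0 p)) = 0.
  rewrite -T0; apply: eq_gtr => v w.
  by rewrite key -[w *m F p *m E p]mulmxA phi_eta mulmx0 zeromxE scale0r subr0.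
rewrite gtr_mulmx gtrDr gtrNr gtr_nE_phi opprK => T1.
have XKE : XK (x0 p) 0 0 = dfun lam p (X p).
  by rewrite /XK hatv_id LE // tmx_id // mulmx1.
move: T1 Dne; rewrite Dphi_eta oppmxE -XKE [XK (x0 p)]mx11_scalar mul_mx_scalar.
move/(congr1 (fun A : 'M[R]_1 => A 0 0)); rewrite scalemxE addmxE zeromxE.
rewrite [_%:M 0 0]mxE eqxx mulr1n.
move: (gtr (Gi p) (fun v w => w *m F p *m nE p v)) => T; move: (T 0 0) => t /eqP; rewrite -mulr2n -mulr_natr !mulf_eq0.
by rewrite pnatr_eq0 orbF oppr_eq0 => /orP[/eqP//|->].
Qed.
End ClosedReeb.

(** * Horizontally weakly conformal maps and their fibres *)

(** The matrix of the adjoint of the differential. *)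
HB.lock Definition Lm {R : realType} {a b} {M : riemannian R a} {N : riemannian R b}
    (f : M -> N) (p : M) : 'M[R]_(b, a) :=
  met (f p) *m (dmx f p)^T *m invmx (met p).

(* the derivative of the conformality relation determines S as the first
   derivatives of a metric determine its Christoffel symbols *)
Lemma koszul_trace {R : realFieldType} {b} (H : 'M[R]_b) (D : 'rV[R]_b -> R)
    (S : 'rV[R]_b -> 'rV[R]_b -> 'rV[R]_b) (y : 'rV[R]_b) :
  H^T = H -> H \in unitmx -> lin (D : _ -> R^o) -> (forall x z, S x z = S z x) ->
  (forall x z t, (S x z *m H *m t^T) 0 0 + (S t z *m H *m x^T) 0 0
     = D z * (x *m H *m t^T) 0 0) ->
  (gtr (invmx H) S *m H *m y^T) 0 0 *+ 2 = (2 - b%:R) * D y.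
Proof.
move=> HT HU Dl SC key.
have hC (u w : 'rV[R]_b) : (u *m H *m w^T) 0 0 = (w *m H *m u^T) 0 0.
  by rewrite -[u *m _ *m _]tr_mx11 !trmx_mul !trmxK HT mulmxA.
pose D1 w : 'M[R]_1 := (D w)%:M.
have D1l : lin D1.
  move=> w; rewrite /D1 Dl raddf_sum; apply: eq_bigr => i _.
  by rewrite /= scale_scalar_mx.
(* The alternating sum of the relation over three orders of its arguments, as in the Koszul formula.
   Its trace contains D y twice with sign + and b times with sign -. *)
have kz x z : (S x z *m H *m y^T) *+ 2 = ((z *m (H *m y^T)) 0 0 *: D1 x
    + (x *m (H *m y^T)) 0 0 *: D1 z) - (x *m H *m z^T) 0 0 *: D1 y.
  have k1 := key x z y; have k2 := key x y z; have k3 := key y x z.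
  apply: mx11_eq; rewrite -scaler_nat !mulmxA; mx_entries.
  rewrite ![_%:M 0 0]mxE !eqxx !mulr1n.
  move: k1 k2 k3; rewrite (SC y x) (SC z x) (SC z y) (hC y z).
  by move: (D x) (D y) (D z) ((_ *m _) 0 0) => *; lra.
have e2 : (gtr (invmx H) S *m H *m y^T) *+ 2 = D1 y + D1 y - b%:R *: D1 y.
  rewrite -!gtr_mulmx -scaler_nat -gtrZr.
  rewrite (eq_gtr _ (fun x z => etrans (scaler_nat _ _) (kz x z))).
  have col : gtr (invmx H) (fun x z => (x *m (H *m y^T)) 0 0 *: D1 z) = D1 y.
    by rewrite gtr_col // trmx_mul trmxK HT mulmxK.
  rewrite gtrDr gtrNr gtr_bil HT mulVmx // mxtrace1 gtrDr col.
  by rewrite (gtr_tr _ (fun z x => (z *m (H *m y^T)) 0 0 *: D1 x)) trmx_inv HT col.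
have := congr1 (fun A : 'M[R]_1 => A 0 0) e2.
rewrite -scaler_nat; mx_entries; rewrite ![_%:M 0 0]mxE !eqxx !mulr1n => h.
by rewrite -mulr_natl h; ring.
Qed.

Section Fundamental.
Context {R : realType} {a b : nat} (M : riemannian R a) (N : riemannian R b).
Context (f : M -> N) (fs : smooth_map f) (mu : M -> R) (hw : hwc f mu).
Context (lam : M -> R) (lamd : forall p, differentiable (lam \o ichart p) (chart p p)).
Context (mulam : forall p, mu p ^+ 2 = lam p ^+ 2).
Local Notation x0 p := (chart p p).
Local Notation J p := (dmx f p).
Local Notation G p := (@met R a M p).
Local Notation H p := (@met R b N p).
Local Notation Gi p := (invmx (@met R a M p)).
Local Notation Hi p := (invmx (@met R b N p)).

Lemma hwc_lam p : (J p)^T *m Gi p *m J p = lam p ^+ 2 *: Hi (f p).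
Proof. by rewrite (hwc_mx fs p hw) mulam. Qed.

Lemma dilation_deriv p v :
  (sff f p v)^T *m Gi p *m J p + (J p)^T *m Gi p *m sff f p v
  = (2 * lam p * dfun lam p v) *: Hi (f p).
Proof.
have pp := cdom_refl p; have fpp := cdom_refl (f p).
have hGi : isD (x0 p) (fun v => - (conn p (x0 p) v)^T) (conn p (x0 p))
    (fun x => invmx (hatg p x)) (Gi p) (fun=> 0).
  by have := isD_meti pp; rewrite hatg_id.
have hHi : isD (x0 (f p)) (fun v => - (conn (f p) (x0 (f p)) v)^T) (conn (f p) (x0 (f p)))
    (fun x => invmx (hatg (f p) x)) (Hi (f p)) (fun=> 0).
  by have := isD_meti fpp; rewrite hatg_id.
have hJt := isD_tr (fun=> erefl) (fun=> erefl) (isD_jac fs p).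
have h1 := isD_mul (isD_mul hJt hGi) (isD_jac fs p).
have lp : (lam \o ichart p) (x0 p) = lam p by rewrite /= chartK.
pose l2 x : R := lam (ichart p x) * lam (ichart p x).
have l2d : differentiable l2 (x0 p) by exact: (differentiableM (lamd p) (lamd p)).
have l2v : 'D_v l2 (x0 p) = 2 * lam p * dfun lam p v.
  have lv : derivable (lam \o ichart p) (x0 p) v := diff_derivable (lamd p).
  apply: (etrans (deriveM lv lv)); rewrite lp /dfun.
  by move: ('D_v _ _) => z; rewrite /GRing.scale /=; ring.
have h2 := isD_scale l2d (isD_along fs hHi).
have := isD_eq _ h1 h2 v; rewrite mulmx0 addr0 scaler0 addr0 => -> //; last first.
  apply: (near_hat pp (near_fdom fs p)) => q pq [_ fq]; have qq := cdom_refl q.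
  have fqq := cdom_refl (f q); rewrite /= /l2 chartK // hatfE //.
  have UN := hatg_unit fq; have t1 := tmxK qq pq; have t2 := tmxK fqq fq.
  have t3 := tmxK fq fqq.
  apply: (can_inj (mulmxK UN)); rewrite -[RHS]scalemxAl mulVmx //.
  rewrite (jac_hatf fs) // !trmx_mul.
  have -> : invmx (hatg p (chart p q)) = (tmx q p q)^T *m Gi q *m tmx q p q.
    apply: (can_inj (mulmxK (hatg_unit pq))); rewrite mulVmx ?hatg_unit // hatgE //.
    rewrite -!mulmxA (mulmxA (tmx q p q)) t1 mul1mx (mulmxA (Gi q)) mulVmx ?met_unit //.
    by rewrite mul1mx -trmx_mul (tmxK pq qq) trmx1.
  rewrite hatgE // -!mulmxA (mulmxA (tmx p q q)^T) -(trmx_mul (tmx q p q)) t1 trmx1 mul1mx.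
  rewrite (mulmxA (tmx q p q)) t1 mul1mx (mulmxA (tmx (f q) (f p) (f q))) t2 mul1mx.
  rewrite (mulmxA (Gi q)) (mulmxA (J q)^T) (mulmxA (J q)^T) hwc_lam -!scalemxAl -scalemxAr.
  rewrite mulKmx ?met_unit // -trmx_mul t3 trmx1.
  by rewrite -expr2.
by rewrite derE l2v.
Qed.

(** At a regular point, the vertical part of the inverse metric: the subtracted term is its
    horizontal part. *)
Definition Gv p : 'M[R]_a := Gi p - (lam p ^- 2) *: (Gi p *m J p *m Lm f p).
Definition Dl p v : R := 2 * lam p * dfun lam p v.

Lemma Lm_dmx p : Lm f p *m J p = (lam p ^+ 2)%:M.
Proof.
rewrite Lm.unlock -!mulmxA (mulmxA (J p)^T) hwc_lam -scalemxAr mulmxV ?met_unit //.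
by rewrite scalemx1.
Qed.

Let BS p : bilin (fun v w => w *m sff f p v).
Proof. by apply: bilin_mul; exact: sff_lin. Qed.

Let dlam_linear p : linear (dfun lam p : 'rV[R]_a -> R^o).
Proof. by apply/lin_linearP; apply: lin_derive; exact: lamd. Qed.

(** [tauv] is the trace over the fibre directions, and [tauh] is lam^2 times the trace over the
    horizontal space; without this factor it is polynomial in df and meaningful at critical
    points. *)
Definition tauh p := gtr (Gi p *m J p *m Lm f p) (fun v w => w *m sff f p v).
Definition tauv p := gtr (Gv p) (fun v w => w *m sff f p v).

Lemma tension_split p : tension f p = tauv p + lam p ^- 2 *: tauh p.
Proof. by rewrite tensionE // /tauv /tauh -gtrZl -gtrDl /Gv subrK. Qed.

(** The second fundamental form pulled back by the adjoint is symmetric, and the derivative of the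
    conformality relation is for it the metric equation of a conformal change; hence the factor 2 -
    b of its trace. *)
Lemma tauh_form p (y : 'rV[R]_b) :
  (tauh p *m H (f p) *m y^T) 0 0 *+ 2 = (2 - b%:R) * Dl p (y *m Lm f p).
Proof.
have LT : (Lm f p)^T *m Hi (f p) *m Lm f p = Gi p *m J p *m Lm f p.
  have LE : (Lm f p)^T = Gi p *m J p *m H (f p).
    by rewrite Lm.unlock !trmx_mul trmx_inv !met_sym trmxK mulmxA.
  by rewrite LE mulmxK ?met_unit.
rewrite /tauh -LT -(gtr_push (Hi (f p)) (Lm f p) (Lm f p) (BS p)).
apply: (koszul_trace (D := fun x => Dl p (x *m Lm f p))).
- exact: met_sym.
- exact: met_unit.
- apply/lin_linearP => k u w; rewrite /Dl mulmxDl -scalemxAl dlam_linear.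
  by rewrite /GRing.scale /=; move: (dfun _ _ _) (dfun _ _ _) => *; ring.
- by move=> x z; exact: sff_sym.
move=> x z t; rewrite (sff_sym fs _ (x *m _)) (sff_sym fs _ (t *m _)).
have := congr1 (fun A => (x *m (H (f p) *m A *m H (f p)) *m t^T) 0 0)
    (dilation_deriv p (z *m Lm f p)).
rewrite -scalemxAr mulmxV ?met_unit // -scalemxAl mul1mx -scalemxAr -scalemxAl scalemxE.
rewrite -/(Dl p (z *m Lm f p)); move: (Dl p _) (sff f p _) => D B <-.
rewrite mulmxDr mulmxDl mulmxDr mulmxDl addmxE addrC; congr (_ + _).
  rewrite Lm.unlock -[t *m _ *m _ *m _ *m _]tr_mx11.
  by rewrite !trmx_mul !trmxK !met_sym trmx_inv met_sym !mulmxA.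
by rewrite Lm.unlock !mulmxA.
Qed.

Let lift_Lm (p : M) z : lift f p z = z *m Lm f p.
Proof. by rewrite /lift Lm.unlock !mulmxA. Qed.

Lemma horizontal_Lm p Y : lam p != 0 -> horizontal f p Y ->
  Y = (lam p ^- 2 *: (Y *m J p)) *m Lm f p.
Proof.
move=> l0 hY; have l2 : lam p ^+ 2 != 0 by rewrite expf_neq0.
pose Z := Y - (lam p ^- 2 *: (Y *m J p)) *m Lm f p.
have ZJ : Z *m J p = 0.
  rewrite mulmxBl -mulmxA Lm_dmx mul_mx_scalar scalerA divff // scale1r subrr.
  by [].
have h1 : Y *m G p *m Z^T = 0 by move/(horizontalP fs): hY; exact.
have /(horizontalP fs)/(_ Z ZJ) h2 := lift_horizontal fs (p := p) (lam p ^- 2 *: (Y *m J p)).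
have ZZ : Z *m G p *m Z^T = 0.
  transitivity ((Y - lift f p (lam p ^- 2 *: (Y *m J p))) *m G p *m Z^T).
    by rewrite lift_Lm.
  by rewrite !mulmxBl h1 h2 subrr.
have : Z = 0.
  apply/eqP; apply: contraT => /(@met_pos _ _ M p).
  by rewrite /bil ZZ zeromxE ltxx.
by move/eqP; rewrite subr_eq0 => /eqP.
Qed.

(** At a regular point the horizontal vectors are the values of the adjoint. For a target of
    dimension 2 the factor 2 - b is 0 and [tauh] carries no information on d lam. *)
Lemma tauh_eq0 p : lam p != 0 -> b != 2%N ->
  tauh p = 0 <-> forall Y, horizontal f p Y -> dfun lam p Y = 0.
Proof.
move=> l0 b2; split=> [t0 Y hY|h].
  rewrite (horizontal_Lm l0 hY); move: (lam p ^- 2 *: _) => y.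
  have := tauh_form p y; rewrite t0 !mul0mx zeromxE mul0rn => /esym/eqP.
  rewrite !mulf_eq0 subr_eq0 eqr_nat eq_sym (negPf b2) pnatr_eq0 (negPf l0) /=.
  by move/eqP.
apply: (form_inj (met_unit (f p))) => y; rewrite !mul0mx zeromxE.
have := tauh_form p y; rewrite /Dl h; last by rewrite -lift_Lm; exact: lift_horizontal.
by rewrite !mulr0 => /eqP; rewrite mulrn_eq0 /= => /eqP.
Qed.

Lemma tension_regular p : lam p != 0 -> b != 2%N ->
  [/\ tauv p = 0 -> (forall Y, horizontal f p Y -> dfun lam p Y = 0) -> tension f p = 0,
      tension f p = 0 -> (forall Y, horizontal f p Y -> dfun lam p Y = 0) -> tauv p = 0
    & tension f p = 0 -> tauv p = 0 ->
        forall Y, horizontal f p Y -> dfun lam p Y = 0].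
Proof.
move=> l0 b2; have [h1 h2] := tauh_eq0 l0 b2; rewrite tension_split; split.
- by move=> -> /h2 ->; rewrite scaler0 addr0.
- by move=> t /h2 t0; move: t; rewrite t0 scaler0 addr0.
- move=> t t0; apply: h1; move: t; rewrite t0 add0r => /eqP.
  by rewrite scaler_eq0 invr_eq0 expf_eq0 (negPf l0) andbF => /eqP.
Qed.

(** The rows of [G p *m Gv p] lie in the kernel of df and so are combinations of those of [W];
    orthonormality determines the coefficients. *)
Lemma vertical_basis p k (W : 'M[R]_(k, a)) : lam p != 0 -> W *m J p = 0 ->
  W *m G p *m W^T = 1%:M -> (forall Y : 'rV[R]_a, Y *m J p = 0 -> (Y <= W)%MS) -> W^T *m W = Gv p.
Proof.
move=> l0 WJ WW span; have l2 : lam p ^+ 2 != 0 by rewrite expf_neq0.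
have GvJ : G p *m Gv p *m J p = 0.
  rewrite /Gv mulmxBr mulmxV ?met_unit // mulmxBl mul1mx -scalemxAr -scalemxAl.
  rewrite -!mulmxA Lm_dmx mul_mx_scalar -!scalemxAr (mulmxA (G p)) mulmxV ?met_unit //.
  by rewrite mul1mx scalerA mulVf // scale1r subrr.
have /submxP[C GC] : (G p *m Gv p <= W)%MS.
  by apply/row_subP => i; apply: span; rewrite -row_mul GvJ row0.
have GvW : Gv p *m G p *m W^T = W^T.
  have LW : Lm f p *m G p *m W^T = 0.
    rewrite Lm.unlock -!mulmxA (mulmxA (Gi p)) mulVmx ?met_unit // mul1mx -trmx_mul WJ.
    by rewrite trmx0 mulmx0.
  rewrite /Gv !mulmxBl mulVmx ?met_unit // mul1mx -!scalemxAl -!mulmxA.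
  by rewrite (mulmxA (Lm f p)) LW !mulmx0 scaler0 subr0.
have CE : C = G p *m W^T.
  have := congr1 (fun A => A *m (G p *m W^T)) GC.
  by rewrite -[RHS]mulmxA (mulmxA W) WW mulmx1 -mulmxA (mulmxA (Gv p)) GvW.
apply: (can_inj (mulKmx (met_unit p))); by rewrite GC CE mulmxA.
Qed.

Lemma frame_tauv p k (V : 'I_k -> 'rV[R]_a) : lam p != 0 ->
  (forall i, V i *m J p = 0) ->
  (forall i j, (V i *m G p *m (V j)^T) 0 0 = (i == j)%:R) ->
  (forall Y : 'rV[R]_a, Y *m J p = 0 -> exists c : 'I_k -> R, Y = \sum_i c i *: V i) ->
  tauv p = \sum_i V i *m sff f p (V i).
Proof.
move=> l0 VJ VV span; pose W := \matrix_i V i.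
have WE : W^T *m W = Gv p.
  apply: vertical_basis => //.
  - by apply/row_matrixP => i; rewrite row_mul rowK VJ row0.
  - apply/matrixP => i j; rewrite [RHS]mxE -VV -[LHS]form_entry !mulmxA -rowE rowK.
    by rewrite -mulmxA -trmx_mul -rowE rowK.
  - move=> Y /span[c ->]; apply/submxP; exists (\row_i c i); rewrite mulmx_sum_row.
    by apply: eq_bigr => i _; rewrite mxE rowK.
apply: gtr_frame; first exact: BS.
rewrite -WE; apply/matrixP => i j; rewrite summxE [RHS]mxE.
by apply: eq_bigr => k' _; rewrite !mxE big_ord1 !mxE.
Qed.

(** The covariant derivative of df(V) = 0. Summed over a frame of the fibre it identifies the image
    of the mean curvature vector with minus [tauv]. *)
Lemma nabla_vertical (U : set M) (V : vfield M) p v : open U -> U p -> smooth_field U V ->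
  (forall q, U q -> dmap f q (V q) = 0) ->
  nabla p v V *m J p + V p *m sff f p v = 0.
Proof.
move=> Uo Up Vs VJ; have pp := cdom_refl p.
have Wo := chart_image_open (p := p) (openI Uo (cdom_open p)).
have Wx : (chart p @` ((U `&` cdom p) `&` cdom p)) (x0 p) by exists p.
have Vd : differentiable (hatv V p) (x0 p).
  apply: (near_eq_differentiable (f := coord_field p V \o ichart p)); last first.
    by apply: smooth_on_differentiable Wo _ Wx; exact: (Vs p p).
    by apply: near_hat_all => q pq; rewrite /= chartK // coord_fieldE // hatvE.
have hV : isD (x0 p) (fun=> 0) (conn p (x0 p)) (hatv V p) (V p) (cvec V p (x0 p)).
  by split=> //; [rewrite hatv_id|move=> u; rewrite -(hatv_id V p)].
have h1 := isD_mul hV (isD_jac fs p).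
have h2 : isD (x0 p) (fun=> 0) (fun v => conn (f p) (x0 (f p)) (v *m J p))
    (fun=> 0 : 'M[R]_(1, b)) 0 (fun=> 0).
  by split=> [|//|u]; [exact: differentiable_cst|rewrite der_cst /cov !mulmx0 mul0mx subrr addr0].
rewrite nabla_vecE; apply: (isD_eq _ h1 h2 v).
have nUf : \forall q \near p, U q /\ (cdom p q /\ cdom (f p) (f q)).
  by apply: filterI (near_fdom fs p); exact: open_nbhs_nbhs.
apply: (near_hat pp nUf) => q pq [Uq [_ fq]]; have qq := cdom_refl q.
rewrite hatvE // (jac_hatf fs) // -!mulmxA (mulmxA (tmx q p q)) tmxK // mul1mx.
by rewrite mulmxA -dmapE // VJ // mul0mx.
Qed.

Hypothesis b0 : (0 < b)%N.

Let regularP p : lam p != 0 <-> forall Z, exists Y, dmap f p Y = Z.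
Proof.
split=> [l0|/(mu_regular fs b0 hw)].
  have [m0 _ sj] := hw p; have : 0 < mu p.
    by rewrite lt0r m0 andbT; move: (mulam p); apply: contra_eq_neq => ->;
       rewrite expr0n eq_sym expf_neq0.
  by move/sj => h Z; have [Y _ YZ] := h Z; exists Y.
by apply: contra_neq => l0; move: (mulam p); rewrite l0 expr0n => /eqP; rewrite sqrf_eq0 => /eqP.
Qed.

Lemma minimal_of_tauv : (forall p, lam p != 0 -> tauv p = 0) -> minimal_fibres f.
Proof.
move=> h p /regularP l0 U k V Uo Up Vs VJ VV span Y hY.
have VJp i : V i p *m J p = 0 by rewrite -dmapE // VJ.
have t0 := h p l0; rewrite (@frame_tauv p k (fun i => V i p)) // in t0; last first.
  by move=> Z ZJ; apply: span; rewrite dmapE.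
have e : (\sum_i nabla p (V i p) (V i)) *m J p = 0.
  rewrite mulmx_suml -[LHS]addr0 -[U in _ + U]t0 -big_split /= big1 // => i _.
  exact: (nabla_vertical _ Uo Up (Vs i) (VJ i)).
by have := hY _ (etrans (dmapE fs p _) e); rewrite !gmetE -[_ *m _ *m Y^T]tr_mx11
  !trmx_mul !trmxK met_sym mulmxA.
Qed.

Lemma vertical_onb p : lam p != 0 -> exists k (w : 'I_k -> 'rV[R]_a),
  [/\ forall i, w i *m J p = 0, forall i j, (w i *m G p *m (w j)^T) 0 0 = (i == j)%:R
    & forall Y : 'rV[R]_a, Y *m J p = 0 -> exists c : 'I_k -> R, Y = \sum_i c i *: w i].
Proof.
move=> l0; have l2 : lam p ^+ 2 != 0 by rewrite expf_neq0.
have rJ : \rank (J p) = b.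
  apply/eqP; rewrite eqn_leq rank_leq_col /=.
  have := mxrankM_maxr (Lm f p) (J p); rewrite Lm_dmx -scalemx1 mxrank_scale_nz //.
  by rewrite mxrank1.
have ba : (b <= a)%N by rewrite -rJ rank_leq_row.
have [||w [w1 _ w3]] := @frame_exists R a b (G p) 0 (J p) (met_sym p) (@met_pos _ _ M p)
    _ 1 (or_intror (conj erefl erefl)) (a - b).
- by rewrite mul0mx trmx0 mulmx0 oppr0.
- by rewrite muln1 subnK.
exists (a - b)%N, w; split=> // Y YJ; pose W := \matrix_i w i.
have WJ : (W <= kermx (J p))%MS.
  by apply/sub_kermxP/row_matrixP => i; rewrite row_mul rowK w3 row0.
have rW : \rank W = (a - b)%N.
  apply/eqP; rewrite eqn_leq rank_leq_row /=.
  have WW : W *m (G p *m W^T) = 1%:M.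
    apply/matrixP => i j; rewrite [RHS]mxE -w1 -[LHS]form_entry !mulmxA -rowE rowK.
    by rewrite -mulmxA -trmx_mul -rowE rowK.
  by have := mxrankM_maxl W (G p *m W^T); rewrite WW mxrank1.
have YW : (Y <= W)%MS.
  have [_] := mxrank_leqif_eq WJ; rewrite mxrank_ker rJ rW eqxx => /esym/eqmxP WE.
  by rewrite WE; apply/sub_kermxP.
have /submxP[c ->] := YW; exists (fun i => c 0 i); rewrite mulmx_sum_row.
by apply: eq_bigr => i _; rewrite rowK.
Qed.

(** Minimality is a statement about smooth local vertical frames, so a basis of the kernel at one
    point must be extended to such a frame. *)
Lemma vertical_extension p w : lam p != 0 -> w *m J p = 0 ->
  exists V : vfield M, [/\ smooth_field (f @^-1` cdom (f p) `&` cdom p) V, V p = w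
    & forall q, (f @^-1` cdom (f p) `&` cdom p) q -> dmap f q (V q) = 0].
Proof.
move=> l0 wJ; have l2 : lam p ^+ 2 != 0 by rewrite expf_neq0.
(* [r] is the adjoint normalised so that r followed by df is the identity at p; hence [A] is
   invertible near p. *)
have pp := cdom_refl p; pose r := lam p ^- 2 *: Lm f p.
pose A x := r *m jac (hatf f p) x.
(* the projection of w to ker J along the rows of r, times the determinant of r J
   to make it polynomial in J *)
pose W x : 'rV[R]_a := \det (A x) *: w + - w *m jac (hatf f p) x *m \adj (A x) *m r.
have WJ x : W x *m jac (hatf f p) x = 0.
  rewrite mulmxDl -scalemxAl -(mulmxA _ r) -(mulmxA _ (\adj _)) -/(A x) mul_adj_mx.
  by rewrite mul_mx_scalar !mulNmx scalerN subrr.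
have Ap : A (x0 p) = 1%:M.
  by rewrite /A jac_hatf_id // /r -scalemxAl Lm_dmx scale_scalar_mx mulVf.
have Wp : W (x0 p) = w.
  by rewrite /W Ap det1 scale1r jac_hatf_id // mulNmx wJ oppr0 !mul0mx addr0.
exists (fun q => W (chart p q) *m tmx p q q); split; last 2 first.
- by rewrite tmx_id // mulmx1.
- move=> q [fq pq]; have qq := cdom_refl q; rewrite dmapE //.
  have := WJ (chart p q); rewrite (jac_hatf fs) // !mulmxA.
  move/(congr1 (mulmx^~ (tmx (f p) (f q) (f q)))).
  by rewrite -[_ *m tmx (f q) _ _ *m _]mulmxA tmxK ?mulmx1 ?mul0mx //; exact: cdom_refl.
have fc : continuous f by case: fs.
pose U0 := f @^-1` cdom (f p) `&` cdom p.
have U0o : open U0.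
  apply: openI; last exact: cdom_open.
  by apply: open_comp (cdom_open _) => ? _; exact: fc.
move=> p' p''; have U1o : open (U0 `&` cdom p') by apply: openI => //; exact: cdom_open.
have Io : open (chart p'' @` ((U0 `&` cdom p') `&` cdom p'')) by exact: chart_image_open.
apply: smooth_on_mx => // i j; rewrite ord1.
apply: (@smoothM_local _ _ M (fun q => coord_field p'
   (fun q => W (chart p q) *m tmx p q q) q 0 j) (U0 `&` cdom p')) => q Uq.
exists (U0 `&` cdom p'), p; split=> //; first by move=> ? [[]].
have Oo : open (chart p @` (U0 `&` cdom p')).
  have := chart_image_open (p := p) U1o.
  by rewrite (proj2 (setIidPl _ _)) // => ? [[]].
pose K x := W x *m jac (chart p' \o ichart p) x.
apply: (@smooth_on_ext _ _ _ _ (fun x => K x 0 j)) => //.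
  move=> x [s [[fs' ps] p's] <-]; have ss := cdom_refl s.
  by rewrite /= chartK // coord_fieldE // -mulmxA tmx_trans.
apply: smooth_on_entry => //; apply: smooth_on_mulmx => //; last first.
  apply: smooth_on_jac => //.
  apply: (@smooth_on_sub _ _ _ (chart p @` (cdom p' `&` cdom p))); last exact: trans_smooth.
  by move=> x [s [[_ ps] p's] <-]; exists s.
have js : smooth_on (chart p @` (U0 `&` cdom p')) (jac (hatf f p)).
  apply: (@smooth_on_sub _ _ _ (fdom f p)).
    by move=> x [s [Us _] <-]; exists s.
  by apply: smooth_on_jac; [exact: fdom_open|exact: hatf_smooth].
have cs m' n' (B : 'M[R]_(m', n')) : smooth_on (chart p @` (U0 `&` cdom p')) (fun=> B).
  by apply: smooth_on_mx => // k l; exact: smooth_on_cst.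
have As : smooth_on (chart p @` (U0 `&` cdom p')) A by exact: smooth_on_mulmx.
apply: smooth_on_mx => // k l.
pose W2 x := - w *m jac (hatf f p) x *m \adj (A x) *m r.
have -> : (fun y => W y k l) = (fun y => \det (A y) * w k l) \+ (fun y => W2 y k l).
  by apply/funext => y; rewrite /= /W addmxE scalemxE.
apply: smooth_on_add => //.
  apply: (smooth_on_mul Oo (B := fun=> w k l)); first exact: smooth_on_det.
  exact: smooth_on_cst.
apply: (smooth_on_entry k l Oo).
apply: (smooth_on_mulmx Oo _ (cs _ _ r)).
apply: (smooth_on_mulmx Oo (smooth_on_mulmx Oo (cs _ _ (- w)) js)).
apply: (smooth_on_mx Oo) => k' l'.
have -> : (fun y => (\adj (A y)) k' l') = (fun y => cofactor (A y) l' k').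
  by apply/funext => y; rewrite mxE.
exact: smooth_on_cofactor.
Qed.

(** The mean curvature vector of an extended vertical frame is orthogonal to every value of the
    adjoint, so its image under df, which is minus [tauv], is 0. *)
Lemma tauv_of_minimal : minimal_fibres f -> forall p, lam p != 0 -> tauv p = 0.
Proof.
move=> h p l0; have [k [w [w1 w2 w3]]] := vertical_onb l0.
have [V VP] := choice (fun i => vertical_extension l0 (w1 i)).
pose U0 := f @^-1` cdom (f p) `&` cdom p.
have fc : continuous f by case: fs.
have U0o : open U0.
  apply: openI; last exact: cdom_open.
  by apply: open_comp (cdom_open _) => ? _; exact: fc.
have U0p : U0 p by split; exact: cdom_refl.
have Vp i : V i p = w i by have [] := VP i.
have VJ i q : U0 q -> dmap f q (V i q) = 0 by have [_ _] := VP i; exact.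
have Vs i : smooth_field U0 (V i) by have [] := VP i.
have hm Y : horizontal f p Y -> gmet p (\sum_i nabla p (V i p) (V i)) Y = 0.
  apply: (h p _ U0 k V U0o U0p Vs VJ); first by apply/regularP.
    by move=> i j; rewrite gmetE !Vp.
  by move=> Z; rewrite dmapE // => /w3[c ->]; exists c; apply: eq_bigr => i _; rewrite Vp.
rewrite (frame_tauv l0 w1 w2 w3).
set S := \sum_i _ in hm.
have SJ : S *m J p + \sum_i w i *m sff f p (w i) = 0.
  rewrite mulmx_suml -big_split big1 // => i _; rewrite -Vp.
  exact: (nabla_vertical _ U0o U0p (Vs i) (VJ i)).
suff e : S *m J p = 0 by move: SJ; rewrite e add0r.
apply: (form_inj (met_unit (f p))) => z; rewrite !mul0mx zeromxE.
have := hm _ (lift_horizontal fs (p := p) z); rewrite gmetE /lift !trmx_mul trmx_inv.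
rewrite !met_sym trmxK !mulmxA mulmxK ?met_unit // => <-.
Qed.
End Fundamental.

(** * Critical points *)

Section Topology.
Context {R : realType} {a b : nat} (M : riemannian R a) (N : riemannian R b).
Context (f : M -> N) (fs : smooth_map f).
Local Notation x0 p := (chart p p).

Lemma chart_continuous_fun {T : topologicalType} (F : M -> T) p :
  {for x0 p, continuous (F \o ichart p)} -> {for p, continuous F}.
Proof.
move=> Fc; have pp := cdom_refl p.
apply: (@continuous_near_eq _ _ ((F \o ichart p) \o chart p)).
  by apply: filterS (near_cdom pp) => q pq; rewrite /= chartK.
by apply: continuous_comp => //; exact: chart_continuous.
Qed.

Lemma smooth_fun_continuous (lam : M -> R) : smooth_fun lam -> continuous lam.
Proof.
move=> ls p; apply: chart_continuous_fun; apply: differentiable_continuous.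
apply: (@smooth_on_differentiable1 R a (chart p @` cdom p)).
- exact: chart_dom_open.
- by move: (ls : forall p, smooth_on _ _) => /(_ p); rewrite setTI.
- by exists p => //; exact: cdom_refl.
Qed.

(** The mean value theorem along segments in a coordinate ball on which the Jacobian vanishes. *)
Lemma near_critical_constant p : (\forall q \near p, dmx f q = 0) ->
  \forall q \near p, f q = f p.
Proof.
move=> h; have pp := cdom_refl p.
have fo := fdom_open fs (p := p).
have : \forall x \near x0 p, fdom f p x /\ jac (hatf f p) x = 0.
  apply: (near_hat (P := fun q => dmx f q = 0 /\ (cdom p q /\ cdom (f p) (f q))) pp).
    by apply: filterI => //; exact: near_fdom.
  move=> q pq [d0 [_ fq]]; split; first by exists q.
  by rewrite (jac_hatf fs) // d0 mulmx0 mul0mx.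
move=> /nbhs_ballP[e /= e0 he].
have ncst : \forall x \near x0 p, hatf f p x = hatf f p (x0 p).
  apply/nbhs_ballP; exists e => //= x; rewrite -ball_normE /= => xe.
  pose v := x - x0 p.
  have line s : `|s| <= `|1 : R| -> fdom f p (s *: v + x0 p) /\
      jac (hatf f p) (s *: v + x0 p) = 0.
    rewrite normr1 => s1; apply: he; rewrite -ball_normE /= opprD addrC subrK normrN normrZ.
    rewrite (le_lt_trans _ xe) // -normrN opprB -/v.
    by rewrite -[leRHS]mul1r ler_wpM2r.
  have ld s : `|s| <= `|1 : R| -> differentiable (hatf f p) (s *: v + x0 p).
    by move/line => [fd _]; exact: smooth_on_differentiable fo (hatf_smooth fs (p := p)) fd.
  apply/rowP => j.
  have [|s s1] := @line_MVT R a (fun y => hatf f p y 0 j) (x0 p) v 1.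
    by move=> s /ld sd; apply: diff_derivable; exact: differentiable_entry.
  rewrite -derE -(der_entry _ _ _ (ld s s1)) (der_jac v (ld s s1)).
  have [_ ->] := line s s1; rewrite mulmx0 zeromxE mul0r scale1r /v subrK.
  by move/eqP; rewrite subr_eq0 => /eqP.
have := near_ichart pp ncst; apply: filterS2 (near_fdom fs p) => q [pq fq].
rewrite hatfE // hatf_id => e1; rewrite -(chartK fq) e1 chartK //; exact: cdom_refl.
Qed.

Lemma clopen_component (K : set M) p q : K p -> (forall r, K r -> nbhs r K) -> closed K ->
  connected_component setT p q -> K q.
Proof.
move=> Kp Ko Kc [C [Cp _ Cc] Cq].
have : C `&` K = C.
  apply: Cc; first by exists p.
  - by exists K => //; rewrite openE => r /Ko.
  - by exists K.
by move=> CK; have [] : (C `&` K) q by rewrite CK.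
Qed.

Let fc : continuous f. Proof. by case: fs. Qed.

Lemma closed_fibre p : closed [set q | f q = f p].
Proof.
have -> : [set q | f q = f p] = f @^-1` [set f p] by [].
apply: closed_comp => [q _|]; first exact: fc.
by apply: accessible_closed_set1; apply: hausdorff_accessible; exact: manifold_hausdorff.
Qed.

(** If lam vanished at p, the set where lam = 0 and f = f p would be closed, open since f is locally
    constant near it, and nonempty; it would contain the component of p, on which f is not
    constant. *)
Lemma regular_everywhere (lam : M -> R) : nowhere_componentwise_constant f ->
  continuous lam -> (forall q, lam q = 0 -> dmx f q = 0) ->
  (forall q, lam q = 0 -> \forall r \near q, lam r = 0) -> forall p, lam p != 0.
Proof.
move=> nc lc lJ ln p; apply/eqP => lp; have [q pq] := nc p; apply.
pose K := [set q | lam q = 0] `&` [set q | f q = f p].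
suff : K q by case.
apply: (@clopen_component K p) pq => //.
  move=> r [r0 rp]; have := ln r r0 => nr.
  have nJ : \forall s \near r, dmx f s = 0 by apply: filterS nr => s /lJ.
  by apply: filterS2 nr (near_critical_constant nJ) => s s0 sr; split=> //=; rewrite sr.
apply: closedI; last exact: closed_fibre.
have -> : [set q | lam q = 0] = lam @^-1` [set 0] by [].
apply: closed_comp => [? _|]; [exact: lc|exact: closed_eq].
Qed.

(** Over the open set [P] the map f is locally constant, so the fibre through such a point is open
    and closed and contains a whole component. *)
Lemma open_critical_empty (P : set N) : nowhere_componentwise_constant f ->
  (forall r, P r -> nbhs r P) -> (forall q, P (f q) -> dmx f q = 0) -> forall p, ~ P (f p).
Proof.
move=> nc Po PJ p Pp; have [q pq] := nc p; apply.
apply: (@clopen_component [set q | f q = f p] p) pq => //; last exact: closed_fibre.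
move=> r /= rp; have nP : \forall s \near r, P (f s) by apply: fc; rewrite rp; exact: Po.
have nJ : \forall s \near r, dmx f s = 0 by apply: filterS nP => s /PJ.
by apply: filterS (near_critical_constant nJ) => s; rewrite /= rp.
Qed.

(** f is constant on suitable members of a countable basis that cover [W]; each of them contributes
    one value. *)
Lemma critical_image_countable (W : set M) : (forall r, W r -> nbhs r W) ->
  (forall q, W q -> dmx f q = 0) -> countable (f @` W).
Proof.
move=> Wo WJ; have [B Bc [Bo Bb]] := @manifold_second_countable _ _ M.
have [->|/set0P[p0 _]] := eqVneq W set0; first by rewrite image_set0; exact: countable0.
apply: (@sub_countable _ _ _ ((fun S : set M => xget (f p0) (f @` S)) @` B)); last first.
  exact: sub_countable (card_image_le _ _) Bc.
apply: subset_card_le => _ [r Wr <-].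
have nJ : \forall s \near r, dmx f s = 0 by apply: filterS (Wo r Wr) => s /WJ.
have [S [BS Sr] Sf] := Bb r _ (near_critical_constant nJ).
exists S => //; have : (f @` S) (xget (f p0) (f @` S)) by apply: xgetPex; exists (f r), r.
by case=> s Ss <-; exact: Sf.
Qed.

(** By surjectivity [P] is the image of an open set of critical points, hence countable; but a
    nonempty open set contains a coordinate segment, which has positive length. *)
Lemma surjective_critical_empty (P : set N) : (0 < b)%N -> (forall q, exists p, f p = q) ->
  (forall r, P r -> nbhs r P) -> (forall q, P (f q) -> dmx f q = 0) -> forall q, ~ P q.
Proof.
move=> b0 fsur Po PJ q Pq; have qq := cdom_refl q.
have Pc : countable P.
  have <- : f @` (f @^-1` P) = P.
    by rewrite image_preimage // eqEsubset; split=> // y _; have [p <-] := fsur y; exists p.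
  apply: critical_image_countable => [r Pr|r Pr]; [exact: fc (Po _ Pr)|exact: PJ].
have /nbhs_ballP[e /= e0 he] : \forall x \near x0 q, P (ichart q x) /\ chart q (ichart q x) = x.
  apply: filterI; first exact: near_chart qq (Po q Pq).
  by apply: filterS (near_chart_im qq) => x [].
pose i0 := Ordinal b0; pose k (y : N) : R := (chart q y - x0 q) 0 i0.
pose u : 'rV[R]_b := delta_mx 0 i0.
(* [P] contains the points of coordinates x0 q + t u for 0 < t < e, and [k] recovers t from them. *)
have Ic : countable `]0, e[%classic.
  apply: (@sub_countable _ _ _ (k @` P)); last exact: sub_countable (card_image_le _ _) Pc.
  apply: subset_card_le => t /=; rewrite in_itv /= => /andP[t0 te].
  have [|h1 h2] := he (x0 q + t *: u).
    rewrite -ball_normE /= opprD addrA subrr sub0r normrN normrZ gtr0_norm //.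
    rewrite (le_lt_trans _ te) // -[leRHS]mulr1 ler_wpM2l ?(ltW t0) //.
    apply: row_norm_le => // i; rewrite /u mxE eqxx /=.
    by case: (_ == _); rewrite ?normr1 ?normr0.
  exists (ichart q (x0 q + t *: u)) => //; rewrite /k h2 addrC addKr scalemxE /u mxE.
  by rewrite !eqxx mulr1.
have := countable_lebesgue_measure0 Ic.
rewrite lebesgue_measure_itv /= lte_fin e0 -EFinD => -[] /eqP.
by rewrite subr0 gt_eqF.
Qed.
End Topology.

(** * Continuity of the trace of nabla A *)

Section NearTrace.
Context {R : realType} {d : nat} (M : riemannian R d) (A : M -> 'M[R]_d) (As : smooth_endo A).
Local Notation x0 p := (chart p p).

Lemma conn_differentiable (p : M) v : differentiable (fun x => conn p x v) (x0 p).
Proof.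
have pp := cdom_refl p; have Uo := @chart_dom_open R d M p.
have Ux : (chart p @` cdom p) (x0 p) by exists p.
have dGd (w : 'rV[R]_d) : differentiable (fun y => der (hatg p) y w) (x0 p).
  exact: smooth_on_der_differentiable Uo (@hatg_smooth _ _ M p) w _ Ux.
rewrite conn.unlock chr.unlock; apply: differentiable_mulmx; last first.
  exact: differentiable_invmx (hatg_differentiable pp) (near_hatg_unit pp).
pose B x : 'M[R]_d := \matrix_(i, l) (der (hatg p) x v i l + (v *m der (hatg p) x 'e_i) 0 l
   - (v *m der (hatg p) x 'e_l) 0 i).
apply: (@differentiableZ _ _ _ B); apply: differentiable_mx => i l.
have dm w j : differentiable (fun x => (v *m der (hatg p) x w) 0 j) (x0 p).
  apply: (differentiable_entry (F := fun x => v *m der (hatg p) x w)).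
  by apply: differentiable_mulmx => //; exact: differentiable_cst.
have -> : (fun x => B x i l) = (fun x => der (hatg p) x v i l + (v *m der (hatg p) x 'e_i) 0 l
   - (v *m der (hatg p) x 'e_l) 0 i) by apply/funext => x; rewrite mxE.
apply: differentiableB; last exact: dm.
by apply: differentiableD; [exact: differentiable_entry|exact: dm].
Qed.

Lemma near_trace_neq0 p : gtr (invmx (met p)) (fun v w => w *m cendo A p (x0 p) v) != 0 ->
  \forall q \near p, gtr (invmx (met q)) (fun v w => w *m cendo A q (x0 q) v) != 0.
Proof.
have pp := cdom_refl p; have Uo := @chart_dom_open R d M p.
have Ux : (chart p @` cdom p) (x0 p) by exists p.
pose D x := \sum_i ('e_i : 'rV[R]_d) *m (invmx (hatg p x) *m cendo A p x 'e_i).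
have DE q : cdom p q -> D (chart p q)
    = gtr (invmx (met q)) (fun v w => w *m cendo A q (x0 q) v) *m tmx q p q.
  by move=> pq; rewrite gtr_cendo_trans.
have Dd : differentiable D (x0 p).
  have -> : D = \sum_i (fun x => ('e_i : 'rV[R]_d) *m
      (invmx (hatg p x) *m cendo A p x 'e_i)) by apply/funext => x; rewrite fct_sumE.
  apply: differentiable_sum => i; apply: differentiable_mulmx; first exact: differentiable_cst.
  apply: differentiable_mulmx.
    exact: differentiable_invmx (hatg_differentiable pp) (near_hatg_unit pp).
  have Ad := hate_differentiable As pp; have cd := conn_differentiable p 'e_i.
  apply: differentiableD; last exact: differentiable_mulmx.
  apply: differentiableB; last exact: differentiable_mulmx.
  exact: smooth_on_der_differentiable Uo (hate_smooth As (p := p)) _ _ Ux.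
move=> D0; have {D0} : D (x0 p) != 0 by rewrite DE // tmx_id // mulmx1.
have Dc := differentiable_continuous Dd.
move=> D0; have nD : \forall x \near x0 p, D x != 0 by exact: cvgr_neq0 Dc D0.
apply: filterS2 (near_cdom pp) (near_ichart pp nD) => q pq.
by rewrite DE //; apply: contraNneq => ->; rewrite mul0mx.
Qed.
End NearTrace.

(** * Maps into almost Hermitian manifolds *)

Section IntoHermitian.
Context {R : realType} {a n : nat} (M : riemannian R a) (H : almost_hermitian R n).
Context (f : M -> H) (fs : smooth_map f) (A : M -> 'M[R]_a) (s : R) (s0 : s != 0).
Context (As : smooth_endo A) (Askew : forall p, (invmx (met p) *m A p)^T = - (invmx (met p) *m A p)).
Context (mu : M -> R) (hw : hwc f mu) (n0 : (0 < n)%N).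
Context (hol : forall p X, dmap f p (X *m A p) = s *: (dmap f p X *m cplx (f p))).
Context (DA : forall p,
  gtr (invmx (met p)) (fun v w => w *m cendo A p (chart p p) v) *m dmx f p = 0).

Lemma tension_cplx p : tension f p *m cplx (f p) = - (mu p ^+ 2 *: DJ (f p)).
Proof.
have AB q : A q *m dmx f q = s *: (dmx f q *m cplx (f q)).
  apply/row_matrixP => i; have := hol q 'e_i; rewrite !dmapE // -!mulmxA -!rowE => ->.
  by rewrite linearZ.
have := holo_trace fs As (@cplx_smooth R n H) AB Askew hw p; rewrite DA => /esym/eqP.
rewrite scaler_eq0 (negPf s0) /= addr_eq0 => /eqP ->.
by congr (- (_ *: _)); apply: eq_gtr => v w; rewrite nJ.unlock.
Qed.

Let critical : harmonic_morphism f -> forall q, DJ (f q) != 0 -> dmx f q = 0.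
Proof.
move=> [h _] q Dq; apply: (dmx_eq0 fs hw).
have := tension_cplx q; rewrite h mul0mx => /esym/eqP.
by rewrite oppr_eq0 scaler_eq0 (negPf Dq) orbF sqrf_eq0 => /eqP.
Qed.

Let DJ_near q : DJ q != 0 -> nbhs q [set r : H | DJ r != 0].
Proof.
have DE (r : H) : gtr (invmx (met r)) (fun v w => w *m cendo (@cplx R n H) r (chart r r) v)
    = DJ r by apply: eq_gtr => v w; rewrite nJ.unlock.
rewrite -DE => /(near_trace_neq0 (@cplx_smooth R n H)).
by apply: filterS => r; rewrite DE.
Qed.

(** Where the trace of nabla J1 is nonzero, harmonicity forces df = 0. This is an open condition on
    the target, over which f would be locally constant; surjectivity or nonconstancy on components
    excludes that. *)
Lemma into_hermitian :
  [/\ semi_kahler H -> harmonic_morphism f,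
      (forall q, exists p, f p = q) -> harmonic_morphism f -> semi_kahler H
    & nowhere_componentwise_constant f -> harmonic_morphism f ->
        forall p, semi_kahler_at (f p)].
Proof.
split.
- move=> sk; split=> [p|]; last by exists mu.
  have := tension_cplx p; rewrite (proj1 (semi_kahler_atP _) (sk _)) scaler0 oppr0.
  move/(congr1 (mulmx^~ (cplx (f p)))); rewrite cplx_sq mul0mx => /eqP.
  by rewrite oppr_eq0 => /eqP.
- move=> fsur hm q; apply/semi_kahler_atP/eqP; apply: contraT => Dq.
  have b0 : (0 < n.*2)%N by rewrite double_gt0.
  by have := surjective_critical_empty fs b0 fsur DJ_near (critical hm) Dq.
- move=> nc hm p; apply/semi_kahler_atP/eqP; apply: contraT => Dq.
  by have := open_critical_empty fs nc DJ_near (critical hm) Dq.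
Qed.
End IntoHermitian.

(** * The derivative of xi on almost Kenmotsu manifolds *)

Section KenmotsuTrace.
Context {R : realType} {m : nat} (M : acm R m).
Local Notation d := (m.*2.+1).
Local Notation F p := (@phi R m M p).
Local Notation X p := (@xi R m M p).
Local Notation E p := (@eta_vec R m M p).
Local Notation G p := (@met R d M p).

Lemma form_ext (A B : 'M[R]_d) :
  (forall v w : 'rV[R]_d, (v *m A *m w^T) 0 0 = (v *m B *m w^T) 0 0) -> A = B.
Proof. by move=> h; apply/matrixP => i j; rewrite -[LHS]form_entry -[RHS]form_entry. Qed.

(* nabla_xi phi both commutes and anticommutes with phi, hence vanishes; the identity
   is then d Omega(xi, _, _) = 2 beta Omega *)
Lemma kenmotsu_anticomm (p : M) (beta : R) : nX p (X p) = 0 ->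
  (forall Y v w, dOmega p Y v w = 2 * beta * eta_wedge_Omega p Y v w) ->
  (forall v w, deta p v w = 0) ->
  nXm p *m F p + F p *m nXm p = (2 * beta) *: F p.
Proof.
move=> g0 hO hd.
have nXm_sym : G p *m (nXm p)^T = nXm p *m G p.
  apply: form_ext => v w; have := hd w v; rewrite detaE !nE_flat !nXE !trmx_mul.
  rewrite !mulmxA => h; transitivity ((w *m G p *m (nXm p)^T *m v^T) 0 0); first by move: h; lra.
  by rewrite -[w *m _ *m _ *m _]tr_mx11 !trmx_mul !trmxK met_sym !mulmxA.
have FGt : G p *m (F p)^T = - (F p *m G p) by rewrite phi_skew opprK.
have nE0 : nE p (X p) = 0 by rewrite nE_flat g0 trmx0 mulmx0.
set Z := nP p (X p).
have GZ : G p *m Z^T = - (Z *m G p) by rewrite nP_skew opprK.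
(* This is d Omega(xi, v, w) = 2 beta Omega(v, w), with eta closed used in the form that nabla xi is
   self-adjoint. *)
have e1 : Z + (nXm p *m F p + F p *m nXm p) = (2 * beta) *: F p.
  apply: (can_inj (mulmxK (met_unit p))); apply: form_ext => v w.
  have := hO (X p) v w; rewrite dOmegaE /eta_wedge_Omega !OmegaE !etaE eta_xi1 xi_phi.
  rewrite trmx0 mulmx0 zeromxE mulr0 addr0 mul1r.
  have -> : (X p *m G p *m (v *m F p)^T) 0 0 = 0.
    rewrite -[X p *m _ *m _]tr_mx11 !trmx_mul !trmxK met_sym -eta_flat -mulmxA phi_eta.
    by rewrite mulmx0 zeromxE.
  rewrite mulr0 addr0 -/Z xi_nP nXE.
  have -> : (w *m G p *m (- (v *m nXm p *m F p))^T) 0 0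
     = - (v *m nXm p *m F p *m G p *m w^T) 0 0.
    rewrite [(- _)^T]linearN /= mulmxN oppmxE; congr (- _).
    by rewrite -[w *m _ *m _]tr_mx11 !trmx_mul !trmxK met_sym !mulmxA.
  have -> : (X p *m G p *m (v *m nP p w)^T) 0 0 = - (v *m F p *m nXm p *m G p *m w^T) 0 0.
    rewrite -[X p *m _ *m _]tr_mx11 !trmx_mul !trmxK met_sym -eta_flat -mulmxA nP_eta.
    rewrite mulmxN oppmxE nE_flat nXE trmx_mul !mulmxA; congr (- _).
    by rewrite -!(mulmxA (v *m F p)) nXm_sym !mulmxA.
  rewrite !trmx_mul !mulmxA -!(mulmxA v) GZ FGt !(mulmxN, mulNmx) !mulmxA.
  rewrite !mulmxDr !mulmxDl -scalemxAr -!scalemxAl !mulmxA.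
  by mx_entries => h; move: h; lra.
have ZE : Z *m E p = 0 by rewrite nP_eta nE0 mulmx0 oppr0.
have Zanti : Z *m F p + F p *m Z = 0 by rewrite nP_phi nE0 g0 mul0mx mulmx0 addr0.
have FF : nXm p *m F p *m F p = F p *m F p *m nXm p.
  rewrite -mulmxA phi_phi mulmxDr mulmxDl mulmxN mulNmx mulmx1 mul1mx mulmxA nXm_eta mul0mx.
  by rewrite -mulmxA -nXE g0 mulmx0.
(* The sum (nabla xi) phi + phi (nabla xi) commutes with phi because phi^2 acts as -1 on either side
   of nabla xi. *)
have Zcomm : Z *m F p = F p *m Z.
  have -> : Z = (2 * beta) *: F p - (nXm p *m F p + F p *m nXm p) by rewrite -e1 addrK.
  rewrite mulmxBl mulmxBr -!scalemxAl -!scalemxAr; congr (_ - _).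
  by rewrite mulmxDl mulmxDr FF !mulmxA addrC.
have ZF : Z *m F p = 0.
  by move: Zanti; rewrite -Zcomm -mulr2n -scaler_nat => /eqP; rewrite scaler_eq0 pnatr_eq0 => /eqP.
have Z0 : Z = 0.
  have : Z *m F p *m F p = 0 by rewrite ZF mul0mx.
  rewrite -mulmxA phi_phi mulmxDr mulmxN mulmx1 mulmxA ZE mul0mx addr0 => /eqP.
  by rewrite oppr_eq0 => /eqP.
by move: e1; rewrite Z0 add0r.
Qed.

(** Multiply the relation by phi P and take traces: by cyclicity and the commutation of P with phi,
    both terms on the left become - tr (nabla xi P). *)
Lemma anticomm_trace (p : M) (beta : R) (P : 'M[R]_d) : nX p (X p) = 0 ->
  nXm p *m F p + F p *m nXm p = (2 * beta) *: F p -> F p *m P = P *m F p ->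
  \tr (nXm p *m P) = beta * (\tr P - (X p *m P *m E p) 0 0).
Proof.
move=> g0 h FP.
have tE A : \tr (E p *m (X p *m A)) = (X p *m A *m E p) 0 0.
  by rewrite mxtrace_mulC /mxtrace big_ord1.
have := congr1 (fun A => \tr (A *m (F p *m P))) h.
rewrite mulmxDl mxtraceD -scalemxAl mxtraceZ.
have FFP : F p *m (F p *m P) = - P + E p *m (X p *m P).
  by rewrite mulmxA phi_phi mulmxDl mulNmx mul1mx mulmxA.
rewrite -[nXm p *m F p *m _]mulmxA FFP mulmxDr mulmxN (mulmxA _ (E p)) nXm_eta mul0mx addr0.
rewrite FP -[F p *m nXm p *m _]mulmxA mxtrace_mulC !mulmxA -[_ *m F p *m F p]mulmxA.
rewrite [\tr (_ *m (F p *m F p))]mxtrace_mulC phi_phi mulmxDl mulNmx mul1mx.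
have -> : E p *m X p *m (nXm p *m P) = 0.
  by rewrite -mulmxA (mulmxA (X p)) -nXE g0 mul0mx mulmx0.
rewrite addr0 mxtraceD !linearN /= -[E p *m X p *m P]mulmxA tE.
by move: (\tr _) (\tr _) (_ 0 0) => *; lra.
Qed.
End KenmotsuTrace.

(** * The dilation of a holomorphic map *)

Lemma dfun0 {R : realType} {d} (M : manifold R d) (F : M -> R) p : dfun F p 0 = 0.
Proof. by have [_ dF] := is_derive0 (F \o ichart p) (chart p p). Qed.

Section ContactCorollaries.
Context {R : realType} {m n : nat} (M : acm R m) (N : acm R n).
Context (f : M -> N) (fs : smooth_map f) (s : R) (s2 : s ^+ 2 = 1).
Context (mu : M -> R) (hw : hwc f mu).
Context (hol : forall p X, dmap f p (X *m phi p) = s *: (dmap f p X *m phi (f p))).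
Context (lam : M -> R) (lamP : forall p, dmap f p (@xi R m M p) = lam p *: @xi R n N (f p)).
Context (lams : smooth_fun lam) (n0 : (0 < n)%N).
Local Notation d := (m.*2.+1).
Local Notation e := (n.*2.+1).
Local Notation x0 p := (chart p p).
Local Notation F p := (@phi R m M p).
Local Notation X p := (@xi R m M p).
Local Notation E p := (@eta_vec R m M p).
Local Notation G p := (@met R d M p).
Local Notation Gi p := (invmx (@met R d M p)).
Local Notation F' p := (@phi R n N p).
Local Notation X' p := (@xi R n N p).
Local Notation E' p := (@eta_vec R n N p).
Local Notation H p := (@met R e N p).
Local Notation J p := (dmx f p).

Let s0 : s != 0.
Proof. by apply: contra_eq_neq s2 => ->; rewrite expr0n eq_sym oner_neq0. Qed.
Let mulam p : mu p ^+ 2 = lam p ^+ 2.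
Proof. exact: (dilation_lam fs hw hol lamP). Qed.
Let lamd p : differentiable (lam \o ichart p) (x0 p).
Proof. exact: lam_diff. Qed.
Let e2 : e != 2%N.
Proof. by apply/eqP => h; have := congr1 odd h; rewrite /= odd_double. Qed.
Let regular p l0 := tension_regular fs hw lamd mulam (p := p) l0 e2.

Lemma mu_lam p : mu p = `|lam p|.
Proof.
have [m0 _ _] := hw p; rewrite -(ger0_norm m0).
by rewrite -sqrtr_sqr mulam sqrtr_sqr.
Qed.

Lemma lam_eq0_dmx p : lam p = 0 -> J p = 0.
Proof. by move=> l0; apply: (dmx_eq0 fs hw); rewrite mu_lam l0 normr0. Qed.

Lemma dfun_mu p v : lam p != 0 -> dfun mu p v = Num.sg (lam p) * dfun lam p v.
Proof.
move=> l0; have lc : lam q @[q --> p] --> lam p by exact: smooth_fun_continuous.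
have [lp|lp|/eqP] := ltgtP (lam p) 0; last by rewrite (negPf l0).
  have nl : \forall q \near p, mu q = - lam q.
    have : \forall q \near p, lam q < 0 by exact: cvgr_lt lc _ lp.
    by apply: filterS => q lq; rewrite mu_lam ltr0_norm.
  rewrite (near_dfun v nl) ltr0_sg // mulN1r !dfun_der -(derN v (lamd p)).
  by [].
have nl : \forall q \near p, mu q = lam q.
  have : \forall q \near p, 0 < lam q by exact: cvgr_gt lc _ lp.
  by apply: filterS => q lq; rewrite mu_lam gtr0_norm.
by rewrite (near_dfun v nl) gtr0_sg // mul1r.
Qed.

(** Off the zeros of lam, mu is locally lam or - lam. At a zero of lam the differential vanishes,
    and 0 is the only horizontal vector. *)
Lemma horizontally_homothetic_lam : horizontally_homothetic f mu <->
  forall p, lam p != 0 -> forall Y, horizontal f p Y -> dfun lam p Y = 0.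
Proof.
split=> [[_ h] p l0 Y hY|h].
  have := h p Y hY; rewrite dfun_mu // => /eqP.
  by rewrite mulf_eq0 sgr_eq0 (negPf l0) => /eqP.
split=> // p Y hY; have [l0|l0] := eqVneq (lam p) 0; last by rewrite dfun_mu // h // mulr0.
suff -> : Y = 0 by exact: dfun0.
apply/eqP; apply: contraT => /(@met_pos _ _ M p); rewrite -/(gmet p Y Y).
by rewrite hY ?ltxx // dmapE // lam_eq0_dmx // mulmx0.
Qed.

Lemma xi_horizontal p : lam p != 0 -> horizontal f p (X p).
Proof.
move=> l0; apply/(horizontalP fs) => V VJ.
have : lam p *: (V *m E p) = 0.
  by rewrite scalemxAr -(dmx_eta fs hol lamP) mulmxA VJ mul0mx.
move/eqP; rewrite scaler_eq0 (negPf l0) /= => /eqP VE.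
by rewrite -[LHS]tr_mx11 !trmx_mul trmxK met_sym mulmxA -mulmxA -eta_flat.
Qed.

Lemma dlam_xi_smooth : smooth_fun (fun q => dfun lam q (X q)).
Proof.
move=> p; have Uo := @chart_dom_open R d M p; rewrite setTI.
have ls : smooth_on (chart p @` cdom p) (lam \o ichart p).
  by move: (lams : forall p, smooth_on _ _) => /(_ p); rewrite setTI.
have Xs : smooth_on (chart p @` cdom p) (hatv (@xi R m M) p).
  exact/hatv_smooth/xi_smooth.
pose D i := (fun x => hatv (@xi R m M) p x 0 i) \* 'D_('e_i) (lam \o ichart p).
have Ds : smooth_on (chart p @` cdom p) (fun x => \sum_i D i x).
  apply: (smooth_on_sum _ Uo) => i.
  exact: (smooth_on_mul Uo (smooth_on_entry 0 i Uo Xs) (smooth_on_derive _ ls)).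
apply: (smooth_on_ext Uo _ Ds) => x [q pq <-].
  have Uq : (chart p @` cdom p) (chart p q) by exists q.
  have ld : differentiable (lam \o ichart p) (chart p q).
    exact: smooth_on_differentiable1 Uo ls Uq.
  rewrite /= chartK // (dfunE _ pq ld) -hatvE // (lin_der ld).
  by apply: eq_bigr => i _; rewrite /D derE.
Qed.

(** xi is horizontal at regular points, so xi(lam) = 0 there. If xi(lam) were nonzero at p it would
    be so near p, where lam would then vanish identically. *)
Lemma homothetic_dlam_xi : horizontally_homothetic f mu -> forall p, dfun lam p (X p) = 0.
Proof.
move=> /horizontally_homothetic_lam h p; apply/eqP; apply: contraT => d0.
have nd : \forall q \near p, lam q = 0.
  have : \forall q \near p, dfun lam q (X q) != 0.
    have dc : dfun lam q (X q) @[q --> p] --> dfun lam p (X p).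
      exact: (smooth_fun_continuous dlam_xi_smooth).
    exact: cvgr_neq0 dc d0.
  apply: filterS => q; apply: contraNeq => l0.
  by rewrite h //; exact: xi_horizontal.
by move: d0; rewrite (near_dfun _ nd) dfun_der der_cst eqxx.
Qed.

Lemma minimal_of_homothetic : horizontally_homothetic f mu -> harmonic_map f ->
  minimal_fibres f.
Proof.
move=> /horizontally_homothetic_lam h hm; apply: (minimal_of_tauv fs hw mulam) => // p l0.
by have [_ h2 _] := regular l0; apply: h2 (hm p) (h p l0).
Qed.

Lemma homothetic_of_minimal : harmonic_map f -> minimal_fibres f ->
  horizontally_homothetic f mu.
Proof.
move=> hm mf; apply/horizontally_homothetic_lam => p l0 Y.
have [_ _ h] := regular l0; apply: (h (hm p)).
exact: (tauv_of_minimal fs hw mulam _ mf).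
Qed.

Lemma harmonic_of_minimal : horizontally_homothetic f mu -> minimal_fibres f ->
  (forall p, lam p != 0) -> harmonic_map f.
Proof.
move=> /horizontally_homothetic_lam h mf l0 p.
have [h1 _ _] := regular (l0 p); apply: h1 (h p (l0 p)).
exact: (tauv_of_minimal fs hw mulam _ mf).
Qed.

Lemma riemannian_submersion_homothetic : riemannian_submersion f ->
  horizontally_homothetic f mu.
Proof.
move=> [hw1 _]; have l1 p := dilation_lam fs hw1 hol lamP p.
have m1 p : mu p = 1.
  by rewrite mu_lam -sqrtr_sqr -l1 expr1n sqrtr1.
split=> // p Y _; rewrite dfun_der.
have -> : mu \o ichart p = (fun=> 1) by apply/funext => y; rewrite /= m1.
by rewrite der_cst.
Qed.

Lemma lam_constant_homothetic : (forall p v, dfun lam p v = 0) -> horizontally_homothetic f mu.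
Proof. by move=> h; apply/horizontally_homothetic_lam => p _ Y _; exact: h. Qed.

(* the horizontal traces of nabla xi on both sides agree when d lam = 0 *)
Lemma kenmotsu_dilation (betaM : M -> R) (betaN : N -> R) p :
  almost_kenmotsu betaM -> almost_kenmotsu betaN -> (forall v, dfun lam p v = 0) ->
  lam p != 0 -> betaM p = lam p * betaN (f p).
Proof.
move=> kM kN dl l0; have [g0 _ _] := almost_kenmotsu_facts p kM.
have [_ trN _] := almost_kenmotsu_facts (f p) kN.
have [_ _ hO hd _] := kM.
have anti := kenmotsu_anticomm g0 (hO p) (hd p).
have sJ : J p *m F' (f p) = s *: (F p *m J p).
  by rewrite (hol_mx fs hol) scalerA -expr2 s2 scale1r.
have Fi : (F p)^T *m Gi p = - (Gi p *m F p).
  by rewrite -phi_skewi trmx_mul trmx_inv met_sym.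
have FL : F' (f p) *m Lm f p = s *: (Lm f p *m F p).
  rewrite Lm.unlock !mulmxA phi_skew !mulNmx -[_ *m (F' _)^T *m _]mulmxA -trmx_mul sJ.
  rewrite [(_ *: _)^T]linearZ /= trmx_mul -scalemxAr -scalemxAl !mulmxA.
  by rewrite -[_ *m (F p)^T *m _]mulmxA Fi mulmxN scalerN opprK !mulmxA.
(* The composite of df with its adjoint commutes with phi as f is holomorphic; s^2 = 1 removes the
   sign. *)
have FP : F p *m (J p *m Lm f p) = J p *m Lm f p *m F p.
  rewrite mulmxA (hol_mx fs hol) -scalemxAl -mulmxA FL -scalemxAr scalerA -expr2 s2.
  by rewrite scale1r mulmxA.
have trP : \tr (J p *m Lm f p) = lam p ^+ 2 * e%:R.
  by rewrite mxtrace_mulC (Lm_dmx fs hw mulam) mxtrace_scalar mulr_natr.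
have LE : Lm f p *m E p = lam p *: E' (f p).
  rewrite Lm.unlock -!mulmxA eta_flati -trmx_mul (lam_mx fs lamP).
  by rewrite [(_ *: _)^T]linearZ /= -scalemxAr -eta_flat.
have XPE : (X p *m (J p *m Lm f p) *m E p) 0 0 = lam p ^+ 2.
  rewrite mulmxA (lam_mx fs lamP) -!scalemxAl -mulmxA LE -scalemxAr scalerA xi_eta.
  by rewrite scalemxE mxE mulr1 expr2.
have tr1 := anticomm_trace g0 anti FP; rewrite trP XPE in tr1.
pose P := Gi p *m J p *m Lm f p.
have PT : P^T = P.
  by rewrite /P Lm.unlock !trmx_mul !trmx_inv !met_sym !trmxK !mulmxA.
have JPJ : (J p)^T *m P *m J p = (lam p ^+ 2 * lam p ^+ 2) *: invmx (H (f p)).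
  rewrite /P !mulmxA (hwc_lam fs hw mulam) -mulmxA (Lm_dmx fs hw mulam) mul_mx_scalar.
  by rewrite scalerA.
have t1 : gtr P (fun v w => w *m nE p v) = (\tr (nXm p *m (J p *m Lm f p)))%:M.
  transitivity (gtr P (fun v w => (v *m (nXm p *m G p) *m w^T) 0 0 *: (1%:M : 'M[R]_1))).
    apply: eq_gtr => v w; apply: mx11_eq; rewrite scalemxE [1%:M _ _]mxE mulr1 nE_flat nXE.
    by rewrite -[w *m _]tr_mx11 !trmx_mul !trmxK met_sym !mulmxA.
  rewrite gtr_bil scalemx1 -mxtrace_tr trmx_mul trmxK PT /P; congr (\tr _)%:M.
  by rewrite -!mulmxA (mulmxA (G p)) mulmxV ?met_unit // mul1mx.
have t2 : gtr P (fun v w => (w *m J p) *m nE (f p) (v *m J p))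
    = (lam p ^+ 2 * lam p ^+ 2 * \tr (nXm (f p)))%:M.
  rewrite (gtr_push P (J p) (J p) (@nE_bilin R n N (f p))) JPJ gtrZl gtr_nE.
  by rewrite scale_scalar_mx.
have t0 : gtr P (fun v w => w *m sff f p v) = 0.
  apply/(tauh_eq0 fs hw lamd mulam l0 e2) => Y _; exact: dl.
have : gtr P (fun v w => w *m sff f p v) *m E' (f p)
   = lam p *: gtr P (fun v w => w *m nE p v)
     - gtr P (fun v w => (w *m J p) *m nE (f p) (v *m J p)).
  rewrite -gtr_mulmx -gtrZr -gtrNr -gtrDr; apply: eq_gtr => v w.
  have := eta_deriv fs hol lamP lams p v; rewrite dl scale0r add0r => h.
  rewrite -mulmxA; have -> : sff f p v *m E' (f p) = lam p *: nE p v - J p *m nE (f p) (v *m J p).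
    by rewrite -h addrK.
  by rewrite mulmxBr -scalemxAr !mulmxA.
rewrite t0 mul0mx t1 t2 tr1 trN => /(congr1 (fun A : 'M[R]_1 => A 0 0)).
rewrite zeromxE addmxE oppmxE scalemxE ![_%:M 0 0]mxE !eqxx !mulr1n => h.
have n2 := natr2_neq0 (R := R) n0.
(* The traces now give 2n lam^3 beta_M = 2n lam^4 beta_N. *)
apply: (mulfI (x := lam p ^+ 3 * (2 * n)%:R)); first by rewrite mulf_neq0 // expf_neq0.
have eE : e%:R = (2 * n)%:R + 1 :> R by rewrite -natr_d subrK.
move: h; rewrite eE; move: (_%:R) => c h; apply/eqP; rewrite -subr_eq0; apply/eqP.
by rewrite [RHS]h; ring.
Qed.

Lemma harmonic_morphism_lam :
  (forall p : M, Dphi p *m F p = 0) -> (forall q : N, Dphi q *m F' q = 0) ->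
  harmonic_morphism f <->
  forall p, dfun lam p (X p) + lam p * \tr (nXm p) - lam p ^+ 2 * \tr (nXm (f p)) = 0.
Proof.
move=> D1 D2; have h := harmonic_lam fs s0 hw hol lamP lams D1 D2.
by split=> [[/h]|/h hm] //; split=> //; exists mu.
Qed.

Lemma divergence_free_morphism :
  (forall p : M, \tr (nXm p) = 0 /\ Dphi p *m F p = 0) ->
  (forall q : N, \tr (nXm q) = 0 /\ Dphi q *m F' q = 0) ->
  [/\ harmonic_morphism f <-> forall p, dfun lam p (X p) = 0,
      horizontally_homothetic f mu \/ riemannian_submersion f ->
        harmonic_morphism f /\ minimal_fibres f
    & harmonic_morphism f -> minimal_fibres f -> horizontally_homothetic f mu].
Proof.
move=> hM hN; have hi : harmonic_morphism f <-> forall p, dfun lam p (X p) = 0.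
  have h := harmonic_morphism_lam (fun p => proj2 (hM p)) (fun q => proj2 (hN q)).
  split=> [/h + p|h0]; first by move/(_ p); rewrite (proj1 (hM p)) (proj1 (hN _)) !mulr0 addr0 subr0.
  by apply/h => p; rewrite (proj1 (hM p)) (proj1 (hN _)) !mulr0 addr0 subr0.
split=> //.
  move=> hh; have hm : horizontally_homothetic f mu.
    by case: hh => // /riemannian_submersion_homothetic.
  have hf : harmonic_morphism f by apply/hi; exact: homothetic_dlam_xi.
  by split=> //; apply: minimal_of_homothetic => //; case: hf.
by move=> [hf _]; exact: homothetic_of_minimal.
Qed.

(** With both Reeb fields geodesic, d lam is a multiple of eta, so d lam(xi) = 0 gives d lam = 0 and
    hence homothety. *)
Lemma geodesic_morphism :
  (forall p : M, [/\ nX p (X p) = 0, \tr (nXm p) = 0 & Dphi p *m F p = 0]) ->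
  (forall q : N, [/\ nX q (X' q) = 0, \tr (nXm q) = 0 & Dphi q *m F' q = 0]) ->
  (horizontally_homothetic f mu /\ harmonic_morphism f <->
    forall p, dfun lam p (X p) = 0) /\
  (horizontally_homothetic f mu -> harmonic_morphism f -> minimal_fibres f).
Proof.
move=> hM hN.
have [h1 h2 h3] := divergence_free_morphism
  (fun p => let: And3 _ b c := hM p in conj b c) (fun q => let: And3 _ b c := hN q in conj b c).
split; last by move=> hh [hm _]; exact: minimal_of_homothetic.
split=> [[_ /h1]|h0] //; split; last exact/h1.
apply: lam_constant_homothetic => p v; have [g1 _ _] := hM p; have [g2 _ _] := hN (f p).
by rewrite (dlam_eta fs hol lamP lams v g1 g2) h0 mul0r.
Qed.

(** At a zero of lam the second factor is m beta_M, which is nonzero; it stays nonzero nearby and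
    forces lam = 0 there. So the zero set of lam is open, and it is empty since f is not constant on
    a component. *)
Lemma kenmotsu_regular (betaM : M -> R) (betaN : N -> R) : (0 < m)%N ->
  almost_kenmotsu betaM -> almost_kenmotsu betaN -> nowhere_componentwise_constant f ->
  (forall p, lam p * (m%:R * betaM p - n%:R * lam p * betaN (f p)) = 0) ->
  forall p, lam p != 0 /\ lam p = m%:R * betaM p / (n%:R * betaN (f p)).
Proof.
move=> m0 [bMs bM0 _ _ _] [bNs bN0 _ _ _] nc h.
have fc : continuous f by case: fs.
pose g p : R := m%:R * betaM p - n%:R * lam p * betaN (f p).
have gc q : g r @[r --> q] --> g q.
  apply: cvgB; apply: cvgM.
  - exact: cvg_cst.
  - exact: smooth_fun_continuous.
  - by apply: cvgM; [exact: cvg_cst|exact: smooth_fun_continuous].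
  - by apply: continuous_comp; [exact: fc|exact: (smooth_fun_continuous bNs)].
have l0 : forall p, lam p != 0.
  apply: (regular_everywhere fs nc) => [|q|q lq].
  - exact: smooth_fun_continuous.
  - exact: lam_eq0_dmx.
  have g0 : g q != 0.
    by rewrite /g lq mulr0 mul0r subr0 mulf_neq0 ?pnatr_eq0 -?lt0n //; exact/eqP.
  have : \forall r \near q, g r != 0 by exact: cvgr_neq0 (gc q) g0.
  apply: filterS => r /negPf gr; have := h r => /eqP.
  by rewrite mulf_eq0 -/(g r) gr orbF => /eqP.
move=> p; split=> //; have := h p => /eqP; rewrite mulf_eq0 (negPf (l0 p)) /=.
have nne : n%:R != 0 :> R by rewrite pnatr_eq0 -lt0n.
have b0 : betaN (f p) != 0 by exact/eqP.
by rewrite subr_eq0 => /eqP ->; field; rewrite ?nne ?b0.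
Qed.

Lemma constant_dilation_dlam (c : R) : c != 0 -> (forall p, `|lam p| = `|c|) ->
  forall p v, dfun lam p v = 0.
Proof.
move=> c0 lc p v.
have lcv : lam q @[q --> p] --> lam p by exact: smooth_fun_continuous.
have nl : \forall q \near p, lam q = lam p.
  have [lp|lp|/eqP] := ltgtP (lam p) 0; last first.
    by rewrite -normr_eq0 lc normr_eq0 (negPf c0).
  - have : \forall q \near p, 0 < lam q by exact: cvgr_gt lcv _ lp.
    by apply: filterS => q lq; rewrite -(gtr0_norm lq) -(gtr0_norm lp) !lc.
  - have : \forall q \near p, lam q < 0 by exact: cvgr_lt lcv _ lp.
    by apply: filterS => q lq; apply: oppr_inj; rewrite -(ltr0_norm lq) -(ltr0_norm lp) !lc.
by rewrite (near_dfun v nl) dfun_der der_cst.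
Qed.

Lemma kenmotsu_morphism (betaM : M -> R) (betaN : N -> R) : (0 < m)%N ->
  almost_kenmotsu betaM -> almost_kenmotsu betaN ->
  (harmonic_morphism f <->
   forall p, dfun lam p (X p)
     + 2 * lam p * (m%:R * betaM p - n%:R * lam p * betaN (f p)) = 0)
  /\
  (nowhere_componentwise_constant f ->
   [/\ (minimal_fibres f ->
        (harmonic_map f <-> horizontally_homothetic f mu /\
         forall p, mu p = `|lam p| /\ `|lam p| = `|m%:R * betaM p / (n%:R * betaN (f p))|)),
       (let h1 := harmonic_morphism f in
        let h2 := forall p, lam p = m%:R * betaM p / (n%:R * betaN (f p)) in
        let h3 := forall p, dfun lam p (X p) = 0 in
        [/\ h1 -> h2 -> h3, h1 -> h3 -> h2 & h2 -> h3 -> h1])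
     & (forall cM cN : R, (forall p, betaM p = cM) -> (forall q, betaN q = cN) ->
        (harmonic_morphism f /\ minimal_fibres f <-> horizontally_homothetic f mu /\
         forall p, mu p = `|lam p| /\ `|lam p| = `|m%:R * cM / (n%:R * cN)|))]).
Proof.
move=> m0 kM kN.
have facM p := almost_kenmotsu_facts p kM; have facN q := almost_kenmotsu_facts q kN.
have [_ bM0 _ _ _] := kM; have [_ bN0 _ _ _] := kN.
have mne : m%:R != 0 :> R by rewrite pnatr_eq0 -lt0n.
have nne : n%:R != 0 :> R by rewrite pnatr_eq0 -lt0n.
have hi : harmonic_morphism f <->
   forall p, dfun lam p (X p)
     + 2 * lam p * (m%:R * betaM p - n%:R * lam p * betaN (f p)) = 0.
  have h := harmonic_morphism_lam (fun p => let: And3 _ _ c := facM p in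
      etrans (congr1 (mulmx^~ (F p)) c) (mul0mx _ _))
    (fun q => let: And3 _ _ c := facN q in etrans (congr1 (mulmx^~ (F' q)) c) (mul0mx _ _)).
  have E p : dfun lam p (X p) + lam p * \tr (nXm p) - lam p ^+ 2 * \tr (nXm (f p))
     = dfun lam p (X p) + 2 * lam p * (m%:R * betaM p - n%:R * lam p * betaN (f p)).
    by have [_ -> _] := facM p; have [_ -> _] := facN (f p); rewrite !natrM; ring.
  by split=> [/h h0 p|h0]; [rewrite -E|apply/h => p; rewrite E].
split=> // nc.
have reg : harmonic_morphism f -> (forall p, dfun lam p (X p) = 0) ->
    forall p, lam p != 0 /\ lam p = m%:R * betaM p / (n%:R * betaN (f p)).
  move=> /hi hm d0; apply: (kenmotsu_regular m0 kM kN nc) => p.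
  have := hm p; rewrite d0 add0r -mulrA => /eqP; rewrite mulf_eq0 pnatr_eq0 /=.
  by move/eqP.
have c0 p : m%:R * betaM p / (n%:R * betaN (f p)) != 0.
  by rewrite mulf_neq0 ?invr_neq0 // mulf_neq0 //; exact/eqP.
have fwd : harmonic_map f -> minimal_fibres f -> horizontally_homothetic f mu /\
    forall p, mu p = `|lam p| /\ `|lam p| = `|m%:R * betaM p / (n%:R * betaN (f p))|.
  move=> hm mf; have hh := homothetic_of_minimal hm mf; split=> // p.
  split; first exact: mu_lam.
  have hmm : harmonic_morphism f by split=> //; exists mu.
  by have [_ <-] := reg hmm (homothetic_dlam_xi hh) p.
split.
- move=> mf; split=> [hm|[hh hp]]; first exact: fwd.
  apply: harmonic_of_minimal => // p; have [_ lp] := hp p.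
  by rewrite -normr_eq0 lp normr_eq0.
- move=> h1 h2 h3; split.
  + move=> /hi hm hl p; have := hm p.
    have -> : m%:R * betaM p - n%:R * lam p * betaN (f p) = 0.
      have b0 : betaN (f p) != 0 by exact/eqP.
      by rewrite (hl p); field; rewrite nne b0.
    by rewrite mulr0 addr0.
  + by move=> hm d0 p; have [_ <-] := reg hm d0 p.
  + move=> hl d0; apply/hi => p; rewrite d0.
    have b0 : betaN (f p) != 0 by exact/eqP.
    by rewrite (hl p); field; rewrite nne b0.
- move=> cM cN hcM hcN; split=> [[[hm _] mf]|[hh hp]].
    by have [hh hl] := fwd hm mf; split=> // p; have := hl p; rewrite hcM hcN.
  have dl p v : dfun lam p v = 0.
    have := c0 p; rewrite hcM hcN => cne.
    by apply: (constant_dilation_dlam cne) => q; have [_] := hp q.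
  have hm : harmonic_morphism f.
    apply/hi => p; rewrite dl add0r hcM hcN.
    have [_ lp] := hp p; have lne : lam p != 0.
      by rewrite -normr_eq0 lp normr_eq0 -(hcM p) -(hcN (f p)) c0.
    have := kenmotsu_dilation kM kN (dl p) lne; rewrite hcM hcN => eM.
    have cNne : cN != 0 by rewrite -(hcN (f p)); exact/eqP.
    (* beta_M = lam beta_N inserted in the prescribed value of |lam| gives |lam| = (m/n) |lam|; with
       m = n the bracket in the criterion of harmonicity is 0. *)
    have mn : m%:R / n%:R = 1 :> R.
      apply: (mulIf (x := `|lam p|)); first by rewrite normr_eq0.
      rewrite mul1r [RHS]lp eM.
      have -> : m%:R * (lam p * cN) / (n%:R * cN) = m%:R / n%:R * lam p.
        by field; rewrite ?nne ?cNne.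
      by rewrite normrM ger0_norm // divr_ge0 // ler0n.
    by rewrite eM (divr1_eq mn); ring.
  by split=> //; apply: minimal_of_homothetic => //; case: hm.
Qed.
End ContactCorollaries.

(** Nonconstancy on components, or surjectivity, enters where a conclusion determines lam or the
    target: a constant map is harmonic with lam = 0 and imposes no condition on the target. *)
Theorem theorem4p10 (R : realType) :
  (* (1) *)
  (forall (m n : nat) (M : acm R m) (N : acm R n) (f : M -> N) (mu : M -> R),
    (0 < m)%N -> (0 < n)%N ->
    smooth_map f -> pm_holomorphic (@phi R m M) (@phi R n N) f -> hwc f mu ->
    (* (i) *)
    ((classA1 M \/ classA6 M \/ classA7 M) ->
     (classA1 N \/ classA4 N \/ classA6 N \/ classA7 N) ->
     [/\ horizontally_homothetic f mu, harmonic_morphism f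
       & minimal_fibres f])
    /\
    forall lam : M -> R,
      smooth_fun lam ->
      (forall p, dmap f p (xi p) = lam p *: xi (f p)) ->
      [/\ (* (ii) *)
          ((classA4 M \/ classA7a M) ->
           (classA1 N \/ classA4 N \/ classA6 N \/ classA7a N) ->
           [/\ harmonic_morphism f <-> forall p, dfun lam p (xi p) = 0,
               horizontally_homothetic f mu \/ riemannian_submersion f ->
                 harmonic_morphism f /\ minimal_fibres f,
               harmonic_morphism f -> minimal_fibres f ->
                 horizontally_homothetic f mu
             & classA4 M ->
               (classA1 N \/ classA4 N \/ classA6 N \/ classA7 N) ->
               (horizontally_homothetic f mu /\ harmonic_morphism f <->
                 forall p, dfun lam p (xi p) = 0) /\
               (horizontally_homothetic f mu -> harmonic_morphism f ->
                 minimal_fibres f)]),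
          (* (iii) *)
          (classB2a M -> classB2a N ->
           [/\ harmonic_morphism f <-> forall p, dfun lam p (xi p) = 0,
               horizontally_homothetic f mu \/ riemannian_submersion f ->
                 harmonic_morphism f /\ minimal_fibres f
             & harmonic_morphism f -> minimal_fibres f ->
                 horizontally_homothetic f mu])
          /\
          ((classB1 M \/ classB2 M) -> (classB1 N \/ classB2 N) ->
           (horizontally_homothetic f mu /\ harmonic_morphism f <->
             forall p, dfun lam p (xi p) = 0) /\
           (horizontally_homothetic f mu -> harmonic_morphism f ->
             minimal_fibres f)),
          (* (iv) *)
          (forall betaN : N -> R,
           classB2a M -> almost_kenmotsu betaN ->
           (harmonic_morphism f <->
            forall p, dfun lam p (xi p)
                      - 2 * n%:R * lam p ^+ 2 * betaN (f p) = 0)),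
          (* (v) *)
          (forall betaM : M -> R,
           almost_kenmotsu betaM -> classB2a N ->
           (harmonic_morphism f <->
            forall p, dfun lam p (xi p)
                      + 2 * m%:R * lam p * betaM p = 0))
        & (* (vi) *)
          (forall (betaM : M -> R) (betaN : N -> R),
           almost_kenmotsu betaM -> almost_kenmotsu betaN ->
           (harmonic_morphism f <->
            forall p, dfun lam p (xi p)
                      + 2 * lam p * (m%:R * betaM p
                                     - n%:R * lam p * betaN (f p)) = 0)
           /\
           (nowhere_componentwise_constant f ->
            [/\ (* (a), second part *)
                (minimal_fibres f ->
                 (harmonic_map f <->
                  horizontally_homothetic f mu /\
                  forall p, mu p = `|lam p| /\
                    `|lam p| = `|m%:R * betaM p / (n%:R * betaN (f p))|)),
                (* (b) *)
                (let h1 := harmonic_morphism f in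
                 let h2 := forall p,
                   lam p = m%:R * betaM p / (n%:R * betaN (f p)) in
                 let h3 := forall p, dfun lam p (xi p) = 0 in
                 [/\ h1 -> h2 -> h3, h1 -> h3 -> h2 & h2 -> h3 -> h1])
              & (* (c) *)
                (forall cM cN : R,
                 (forall p, betaM p = cM) -> (forall q, betaN q = cN) ->
                 (harmonic_morphism f /\ minimal_fibres f <->
                  horizontally_homothetic f mu /\
                  forall p, mu p = `|lam p| /\
                    `|lam p| = `|m%:R * cM / (n%:R * cN)|))]))])
  /\
  (* (2) *)
  (forall (n : nat) (H : almost_hermitian R n), (0 < n)%N ->
    let conclusion (d : nat) (M : riemannian R d) (f : M -> H) : Prop :=
      [/\ semi_kahler H -> harmonic_morphism f,
          (forall q, exists p, f p = q) -> harmonic_morphism f -> semi_kahler H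
        & nowhere_componentwise_constant f -> harmonic_morphism f ->
            forall p, semi_kahler_at (f p)] in
    (forall (m : nat) (M : acm R m) (f : M -> H) (mu : M -> R),
       (0 < m)%N -> smooth_map f ->
       pm_holomorphic (@phi R m M) (@cplx R n H) f -> hwc f mu ->
       (classA1 M \/ classA2 M \/ classA3 M \/ classA4 M \/ classA6 M \/
        classA7a M \/ classB2a M \/ classB3 M) ->
       conclusion _ M f)
    /\
    (forall (m : nat) (M : almost_hermitian R m) (f : M -> H) (mu : M -> R),
       (0 < m)%N -> smooth_map f ->
       pm_holomorphic (@cplx R m M) (@cplx R n H) f -> hwc f mu ->
       semi_kahler M ->
       conclusion _ M f)).
Proof.
split.
  move=> m n M N f mu m0 n0 fs [s [s1 hol]] hw.
  have s2 : s ^+ 2 = 1 by case: s1 => ->; rewrite ?sqrrN expr1n.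
  have s0 : s != 0 by case: s1 => ->; rewrite ?oppr_eq0 oner_neq0.
  split=> [hM hN|lam lams lamP].
    pose lam p := (@xi R m M p *m dmx f p *m @eta_vec R n N (f p)) 0 0.
    have lamP p : dmap f p (xi p) = lam p *: xi (f p).
      by rewrite dmapE //; exact: (reeb_image fs s0 hol).
    have lams : smooth_fun lam by exact: lam_exists_smooth.
    have [c c0 fM] := classA167_facts m0 hM.
    have gN q := classA_geodesic q n0 hN.
    have hN' : classA1 N \/ classA4 N \/ classA6 N \/ classA7a N.
      by case: hN => [|[|[|[]]]]; tauto.
    have fN q := classA_facts q n0 hN'.
    have d0 p : dfun lam p (xi p) = 0.
      apply: closed_multiple_eta => // [q v|].
        by have [g1 _ _] := fM q; exact: (dlam_eta fs hol lamP lams v g1 (gN _)).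
      by have [_ _ ->] := fM p; rewrite -scalemxAl xi_eta scalemxE mxE mulr1.
    have hMg (p : M) : [/\ nX p (xi p) = 0, \tr (nXm p) = 0 & Dphi p *m phi p = 0].
      by have [g1 t1 D1] := fM p; split=> //; exact: vertical_Dphi D1.
    have hNg (q : N) : [/\ nX q (xi q) = 0, \tr (nXm q) = 0 & Dphi q *m phi q = 0].
      by have [t1 D1] := fN q; split.
    have [h1 h2] := geodesic_morphism fs s2 hw hol lamP lams hMg hNg.
    by have [hh hm] := proj2 h1 d0; split=> //; exact: h2.
  split.
  - move=> hM hN; have fN q := classA_facts q n0 hN.
    have hM' : classA1 M \/ classA4 M \/ classA6 M \/ classA7a M by tauto.
    have fM p := classA_facts p m0 hM'.
    have [h1 h2 h3] := divergence_free_morphism fs s2 hw hol lamP lams fM fN.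
    split=> // hM4 hN4; apply: (geodesic_morphism fs s2 hw hol lamP lams).
      by move=> p; exact: classA4_facts.
    move=> q; have gN := classA_geodesic q n0 hN4.
    by have [t1 D1] := fN q; split.
  - split=> [hM hN|hM hN].
      apply: (divergence_free_morphism fs s2 hw hol lamP lams).
        by move=> p; have [t1 ->] := classB2a_facts p hM; rewrite mul0mx.
      by move=> q; have [t1 ->] := classB2a_facts q hN; rewrite mul0mx.
    apply: (geodesic_morphism fs s2 hw hol lamP lams).
      by move=> p; have [g1 t1 ->] := classB_facts p hM; rewrite mul0mx.
    by move=> q; have [g1 t1 ->] := classB_facts q hN; rewrite mul0mx.
  - move=> betaN hM hN.
    have D1 (p : M) : Dphi p *m phi p = 0.
      by have [_ ->] := classB2a_facts p hM; rewrite mul0mx.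
    have D2 (q : N) : Dphi q *m phi q = 0.
      by have [_ _ ->] := almost_kenmotsu_facts q hN; rewrite mul0mx.
    have h := harmonic_morphism_lam fs s2 hw hol lamP lams D1 D2.
    have E (p : M) : dfun lam p (xi p) + lam p * \tr (nXm p) - lam p ^+ 2 * \tr (nXm (f p))
      = dfun lam p (xi p) - 2 * n%:R * lam p ^+ 2 * betaN (f p).
      have [-> _] := classB2a_facts p hM.
      by have [_ -> _] := almost_kenmotsu_facts (f p) hN; rewrite natrM; ring.
    by split=> [/h h0 p|h0]; [rewrite -E|apply/h => p; rewrite E].
  - move=> betaM hM hN.
    have D1 (p : M) : Dphi p *m phi p = 0.
      by have [_ _ ->] := almost_kenmotsu_facts p hM; rewrite mul0mx.
    have D2 (q : N) : Dphi q *m phi q = 0.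
      by have [_ ->] := classB2a_facts q hN; rewrite mul0mx.
    have h := harmonic_morphism_lam fs s2 hw hol lamP lams D1 D2.
    have E (p : M) : dfun lam p (xi p) + lam p * \tr (nXm p) - lam p ^+ 2 * \tr (nXm (f p))
      = dfun lam p (xi p) + 2 * m%:R * lam p * betaM p.
      have [-> _] := classB2a_facts (f p) hN.
      by have [_ -> _] := almost_kenmotsu_facts p hM; rewrite natrM; ring.
    by split=> [/h h0 p|h0]; [rewrite -E|apply/h => p; rewrite E].
  - by move=> betaM betaN kM kN; exact: (kenmotsu_morphism fs s2 hw hol lamP lams n0 m0).
move=> n H n0 conclusion; split=> m M f mu m0 fs [s [s1 hol]] hw hM.
  have s0 : s != 0 by case: s1 => ->; rewrite ?oppr_eq0 oner_neq0.
  apply: (into_hermitian fs s0 (@phi_smooth R m M) (@phi_skewi R m M) hw n0 hol) => p.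
  have D0 := holomorphic_class_facts p m0 hM.
  have -> : gtr (invmx (met p)) (fun v w => w *m cendo (@phi R m M) p (chart p p) v) = Dphi p.
    by apply: eq_gtr => v w; rewrite nP.unlock.
  (* J1 (f_* xi) is, up to sign, f_* (phi xi) = 0, and J1 is injective; so df annihilates the trace
     of nabla phi, a multiple of xi. *)
  have XJ : @xi R m M p *m dmx f p = 0.
    have : s *: (xi p *m dmx f p *m cplx (f p)) = 0.
      by rewrite -!dmapE // -hol xi_phi dmapE // mul0mx.
    move/eqP; rewrite scaler_eq0 (negPf s0) => /eqP.
    move/(congr1 (mulmx^~ (cplx (f p)))); rewrite cplx_sq mul0mx => /eqP.
    by rewrite oppr_eq0 => /eqP.
  by rewrite (phi_ker D0) -scalemxAl XJ scaler0.
have s0 : s != 0 by case: s1 => ->; rewrite ?oppr_eq0 oner_neq0.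
have skew p : (invmx (met p) *m @cplx R m M p)^T = - (invmx (met p) *m cplx p).
  rewrite trmx_mul trmx_inv met_sym.
  apply: (can_inj (mulmxK (met_unit p))); rewrite mulmxKV ?met_unit // mulNmx.
  by rewrite -[RHS]opprK -mulmxA cplx_skew mulmxN !opprK mulKmx ?met_unit.
apply: (into_hermitian fs s0 (@cplx_smooth R m M) skew hw n0 hol) => p.
have -> : gtr (invmx (met p)) (fun v w => w *m cendo (@cplx R m M) p (chart p p) v) = DJ p.
  by apply: eq_gtr => v w; rewrite nJ.unlock.
by rewrite (proj1 (semi_kahler_atP p) (hM p)) mul0mx.
Qed.
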